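(* Equip $SU(1,1)$ and its universal cover $\widetilde{SU}(1,1)\cong\mathbb R\times\mathbb C$ with the left-invariant sub-Riemannian structures in which $X,Y$ is an orthonormal frame of the distribution $\mathrm{span}\{X,Y\}$. The cut locus from $\tilde 1=(0,0)$ for $\widetilde{SU}(1,1)$ is the vertical line without the identity, $\{(c,0): c\in\mathbb R,\ c\ne0\}$. The cut locus from the identity $1=(1,0)$ for $SU(1,1)$ consists of the points $(z_1,z_2)$ for which $z_1$ is a negative real number, together with the points $(z_1,z_2)$ other than the identity satisfying $z_2=0$.
   Context: $SU(1,1)$ is the group of matrices $\begin{pmatrix} z_1&z_2\\ \bar z_2&\bar z_1\end{pmatrix}$ with $|z_1|^2-|z_2|^2=1$; such a matrix is written $(z_1,z_2)$. Its Lie algebra contains $$X=\begin{pmatrix}0&-1\\-1&0\end{pmatrix},\quad Y=\begin{pmatrix}0&i\\-i&0\end{pmatrix}.$$ The universal cover $\widetilde{SU}(1,1)$ is $\mathbb R\times\mathbb C$ with covering homomorphism $\pi(c,w)=(\sqrt{1+|w|^2}\,e^{ic},\,w)$, with the unique Lie group structure having identity $\tilde 1=(0,0)$ and making $\pi$ a homomorphism. $X,Y$ are regarded as left-invariant vector fields on both groups. An absolutely continuous curve is horizontal if it is almost everywhere tangent to $\mathrm{span}\{X,Y\}$; a horizontal curve with $\dot\gamma=u_1X+u_2Y$ on $[0,\tau]$ has length $\int_0^\tau\sqrt{u_1^2+u_2^2}\,dt$. A horizontal curve is a minimizing geodesic if its length is the infimum of the lengths of horizontal curves with the same endpoints. The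 cut locus from the identity is the set of points reachable from the identity by more than one minimizing geodesic (up to reparametrization). *)

(* Defs.v *)
From HB Require Import structures.
From mathcomp Require Import all_boot all_order all_algebra.
From mathcomp Require Import complex.
From mathcomp Require Import all_classical all_reals all_analysis.
From mathcomp Require Import ring lra.
Import Order.TTheory GRing.Theory Num.Theory numFieldNormedType.Exports.

Set Implicit Arguments.
Unset Strict Implicit.
Unset Printing Implicit Defensive.

Local Open Scope classical_set_scope.
Local Open Scope ring_scope.
Local Open Scope complex_scope.

Definition absolutely_continuous (R : realType) (a b : R) (f : R -> R) : Prop :=
  forall e : R, 0 < e -> exists2 d : R, 0 < d &
    forall (n : nat) (x y : 'I_n -> R),
      (forall i, a <= x i /\ x i <= y i /\ y i <= b) ->
      trivIset [set: 'I_n] (fun i => `]x i, y i[%classic) ->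
      \sum_(i < n) (y i - x i) < d ->
      \sum_(i < n) `|f (y i) - f (x i)| < e.

(* A rank-two sub-Riemannian structure with global orthonormal frame (X, Y), on
   a subset [sr_dom] of a finite-dimensional real vector space.  The ambient
   space is described by linear coordinates [sr_coord]; tangent vectors are
   identified with vectors of the ambient space, so the frame is a pair of
   maps from the carrier to itself. *)
Record sub_riemannian (R : realType) := SubRiemannian {
  sr_pt :> Type ;
  sr_idx : Type ;
  sr_coord : sr_idx -> sr_pt -> R ;
  sr_dom : set sr_pt ;
  sr_X : sr_pt -> sr_pt ;
  sr_Y : sr_pt -> sr_pt }.

Section Curves.
Variables (R : realType) (M : sub_riemannian R).
Implicit Types (p q : M) (tau : R) (gamma : R -> M).

(* gamma, restricted to [0, tau], is an absolutely continuous curve in M with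
   gamma' = u1 X + u2 Y almost everywhere. *)
Definition horizontal tau gamma (u1 u2 : R -> R) : Prop :=
  [/\ forall t, t \in `[0, tau] -> sr_dom (gamma t),
      forall k, absolutely_continuous 0 tau (fun t => sr_coord k (gamma t)),
      measurable_fun `[0, tau] u1, measurable_fun `[0, tau] u2
    & {ae lebesgue_measure, forall t : R, t \in `[0, tau] ->
        forall k : sr_idx M,
          is_derive t 1 (fun s => sr_coord k (gamma s))
            (u1 t * sr_coord k (sr_X (gamma t)) +
             u2 t * sr_coord k (sr_Y (gamma t)))}].

Definition curve_length tau (u1 u2 : R -> R) : \bar R :=
  (\int[lebesgue_measure]_(t in `[0%R, tau])
     (Num.sqrt (u1 t ^+ 2 + u2 t ^+ 2))%:E)%E.

Definition curve_lengths p q : set (\bar R) :=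
  [set l | exists tau gamma u1 u2,
    [/\ 0 < tau, horizontal tau gamma u1 u2, gamma 0 = p, gamma tau = q
      & l = curve_length tau u1 u2]].

Definition minimizing_geodesic p q tau gamma : Prop :=
  [/\ 0 < tau, gamma 0 = p, gamma tau = q
    & exists u1 u2, horizontal tau gamma u1 u2 /\
        curve_length tau u1 u2 = ereal_inf (curve_lengths p q)].

(* Such an s is automatically continuous.  It need not be injective: an
   absolutely continuous curve may be constant on subintervals. *)
Definition time_change (tau ell : R) (s : R -> R) : Prop :=
  {in `[0, tau] &, {homo s : x y / x <= y}} /\
  s @` `[0, tau]%classic = `[0, ell]%classic.

Definition same_up_to_reparam (tau1 : R) (gamma1 : R -> M) (tau2 : R) (gamma2 : R -> M) :
    Prop :=
  exists (ell : R) (sigma : R -> M) (s1 s2 : R -> R),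
    [/\ time_change tau1 ell s1, time_change tau2 ell s2,
        {in `[0, tau1], gamma1 =1 sigma \o s1}
      & {in `[0, tau2], gamma2 =1 sigma \o s2}].

Definition cut_locus p : set M :=
  [set q | exists tau1 gamma1 tau2 gamma2,
    [/\ minimizing_geodesic p q tau1 gamma1,
        minimizing_geodesic p q tau2 gamma2
      & ~ same_up_to_reparam tau1 gamma1 tau2 gamma2]].

End Curves.

Section SU11.
Variable R : realType.
Local Notation C := R[i].
Implicit Types (A : 'M[C]_2).

Definition mx22 (a b c d : C) : 'M[C]_2 :=
  \matrix_(i, j) (if i == 0 then (if j == 0 then a else b)
                  else (if j == 0 then c else d)).

Definition su_mx (z1 z2 : C) : 'M[C]_2 := mx22 z1 z2 z2^*%C z1^*%C.

Definition SU11 : set 'M[C]_2 :=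
  [set A | exists z1 z2, `|z1| ^+ 2 - `|z2| ^+ 2 = 1 /\ A = su_mx z1 z2].

Definition lieX : 'M[C]_2 := mx22 0 (-1) (-1) 0.
Definition lieY : 'M[C]_2 := mx22 0 (0 +i* 1) (0 -i* 1) 0.

Definition su_coord (k : 'I_2 * 'I_2 * bool) A : R :=
  let: (i, j, b) := k in if b then complex.Im (A i j) else complex.Re (A i j).

Definition su11_sr : sub_riemannian R :=
  SubRiemannian su_coord SU11 (fun A => A *m lieX) (fun A => A *m lieY).

End SU11.
Arguments SU11 {R}.
Arguments lieX {R}.
Arguments lieY {R}.

Section Cover.
Variable R : realType.
Local Notation C := R[i].
Local Notation G := (R * C)%type.
Implicit Types g h v : G.

Definition cover_z1 g : C :=
  (Num.sqrt (1 + (complex.Re g.2 ^+ 2 + complex.Im g.2 ^+ 2)))%:C * (cos g.1 +i* sin g.1).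

Definition cover_proj g : 'M[C]_2 := su_mx (cover_z1 g) g.2.

Definition cover_one : G := (0, 0).

(* Write pi g = (z1, z2) and pi h = (z1', z2').  The first entry of the product
   pi g * pi h is z1 z1' + z2 conj(z2') = z1 z1' q, where |q - 1| < 1; hence
   Re q > 0 and atan (Im q / Re q) is the continuous argument of q that
   vanishes at q = 1. *)
Definition cover_mul g h : G :=
  let q := 1 + g.2 * h.2^*%C / (cover_z1 g * cover_z1 h) in
  (g.1 + h.1 + atan (complex.Im q / complex.Re q),
   cover_z1 g * h.2 + g.2 * (cover_z1 h)^*%C).

(* The left-invariant vector field with value v at the identity: the
   derivative at s = 0 of s |-> g * (s v). *)
Definition cover_field v g : G :=
  let L s := cover_mul g (s * v.1, s%:C * v.2) in
  (derive1 (fun s => (L s).1) 0,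
   derive1 (fun s => complex.Re (L s).2) 0 +i*
   derive1 (fun s => complex.Im (L s).2) 0).

(* The differential of cover_proj at the identity sends (c, w) to the matrix
   with first row (i c, w), so X and Y correspond to (0, -1) and (0, i). *)
Definition cover_X : G -> G := cover_field (0, -1).
Definition cover_Y : G -> G := cover_field (0, 0 +i* 1).

Definition cover_coord (k : 'I_3) g : R := [:: g.1; complex.Re g.2; complex.Im g.2]`_k.

Definition cover_sr : sub_riemannian R :=
  SubRiemannian cover_coord [set: G] cover_X cover_Y.


Lemma cover_proj_one : cover_proj cover_one = 1%:M.
Proof.
apply/matrixP => i j; rewrite !mxE /cover_z1 /= cos0 sin0.
rewrite expr0n /= !addr0 sqrtr1.
by case: ifPn; case: ifPn; case: i => -[|[|[]]] //; case: j => -[|[|[]]] //= *;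
   apply/eqP; rewrite eq_complex /=; apply/andP; split; apply/eqP; ring.
Qed.

Let sqn (z : C) : R := complex.Re z ^+ 2 + complex.Im z ^+ 2.
Let cis (t : R) : C := cos t +i* sin t.

Let sqnM z w : sqn (z * w) = sqn z * sqn w.
Proof. by case: z w => [a b] [c d]; rewrite /sqn /=; ring. Qed.

Let sqn_ge0 z : 0 <= sqn z. Proof. by rewrite addr_ge0 ?sqr_ge0. Qed.

Let sqn_gt0 z : z != 0 -> 0 < sqn z.
Proof.
case: z => a b; rewrite eq_complex negb_and /sqn /= => ab.
by rewrite lt_def paddr_eq0 ?sqr_ge0 // !sqrf_eq0 negb_and ab addr_ge0 ?sqr_ge0.
Qed.

Let cisD s t : cis (s + t) = cis s * cis t.
Proof.
rewrite /cis cosD sinD; apply/eqP; rewrite eq_complex /=.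
by apply/andP; split; apply/eqP; ring.
Qed.

Let sqn_z1 g : sqn (cover_z1 g) = 1 + sqn g.2.
Proof.
rewrite sqnM /sqn /= expr0n /= addr0 cos2Dsin2 mulr1 sqr_sqrtr //.
by rewrite addr_ge0 ?addr_ge0 ?sqr_ge0.
Qed.

Let cis_atan (z : C) : 0 < complex.Re z ->
  z = (Num.sqrt (sqn z))%:C * cis (atan (complex.Im z / complex.Re z)).
Proof.
case: z => x y; rewrite /sqn /= => x0.
have N0 : 0 < x ^+ 2 + y ^+ 2 by rewrite ltr_pwDl ?exprn_gt0 ?sqr_ge0.
have xn0 : x != 0 by rewrite gt_eqF.
have N1 : Num.sqrt (x ^+ 2 + y ^+ 2) != 0 by rewrite gt_eqF // sqrtr_gt0.
have cE : cos (atan (y / x)) = x / Num.sqrt (x ^+ 2 + y ^+ 2).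
  rewrite cos_atan (_ : 1 + _ = (x ^+ 2 + y ^+ 2) / x ^+ 2); last by field.
  by rewrite sqrtrM ?ltW // sqrtrV ?sqr_ge0 // sqrtr_sqr gtr0_norm // invf_div.
have c0 : cos (atan (y / x)) != 0 by rewrite cE mulf_neq0 ?invr_eq0.
have sE : sin (atan (y / x)) = y / Num.sqrt (x ^+ 2 + y ^+ 2).
  have := atanK (y / x); rewrite /tan => /(canRL (mulfVK c0)) ->.
  by rewrite cE; field; rewrite N1.
apply/eqP; rewrite /cis cE sE eq_complex /=.
by apply/andP; split; apply/eqP; field.
Qed.

Lemma cover_z1M g h :
  cover_z1 (cover_mul g h) = cover_z1 g * cover_z1 h + g.2 * h.2^*%C.
Proof.
have z1g := sqn_z1 g; have z1h := sqn_z1 h.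
have sqnC (z : C) : sqn z^*%C = sqn z by case: z => a b; rewrite /sqn /= sqrrN.
have sqn0 : sqn 0 = 0 by rewrite /sqn /= expr0n addr0.
have Z0 g' : cover_z1 g' != 0.
  apply/eqP => z0; have := sqn_z1 g'; rewrite z0 sqn0 => /eqP.
  by rewrite eq_sym gt_eqF // ltr_pwDl.
set q := 1 + g.2 * h.2^*%C / (cover_z1 g * cover_z1 h).
have ZZ0 : cover_z1 g * cover_z1 h != 0 by rewrite mulf_neq0.
have qE : cover_z1 g * cover_z1 h * q = cover_z1 g * cover_z1 h + g.2 * h.2^*%C.
  by rewrite /q mulrDr mulr1 [X in _ + X]mulrC divfK.
have q0 : 0 < complex.Re q.
  pose r := g.2 * h.2^*%C / (cover_z1 g * cover_z1 h).
  have r1 : sqn r < 1.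
    have : sqn r * sqn (cover_z1 g * cover_z1 h) = sqn (g.2 * h.2^*%C).
      by rewrite -sqnM /r divfK.
    rewrite [sqn (_ _ * _)]sqnM [sqn (g.2 * _)]sqnM sqnC z1g z1h => rE.
    have p : 0 < (1 + sqn g.2) * (1 + sqn h.2).
      by rewrite mulr_gt0 // ltr_pwDl.
    rewrite -(ltr_pM2r p) rE mul1r -subr_gt0.
    rewrite (_ : _ - _ = 1 + (sqn g.2 + sqn h.2)); last ring.
    by rewrite ltr_pwDl // addr_ge0.
  have := sqr_ge0 (complex.Im r); move: r1; rewrite /q -/r {}/sqn => r1 i0.
  have -> : complex.Re (1 + r) = 1 + complex.Re r by case: (r).
  nra.
rewrite -qE (cis_atan q0) {1}/cover_z1 /= -/(cis _) !cisD.
have -> : Num.sqrt (1 + sqn (cover_mul g h).2) =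
   Num.sqrt (1 + sqn g.2) * Num.sqrt (1 + sqn h.2) * Num.sqrt (sqn q).
  have p1 z : 0 <= 1 + sqn z by rewrite addr_ge0.
  rewrite -!sqrtrM ?mulr_ge0 //; congr Num.sqrt.
  rewrite -z1g -z1h -!sqnM qE.
  have -> : (cover_mul g h).2 = cover_z1 g * h.2 + g.2 * (cover_z1 h)^*%C by [].
  move: z1g z1h; case: (cover_z1 g) (cover_z1 h) => [x y] [x' y'].
  case: g.2 h.2 => [a b] [a' b']; rewrite /sqn /= => z1g z1h.
  have {z1g}Hx : x ^+ 2 = 1 + (a ^+ 2 + b ^+ 2) - y ^+ 2 by rewrite -z1g addrK.
  have {z1h}Hx' : x' ^+ 2 = 1 + (a' ^+ 2 + b' ^+ 2) - y' ^+ 2.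
    by rewrite -z1h addrK.
  ring: Hx Hx'.
rewrite /cover_z1 -/(cis g.1) -/(cis h.1) !rmorphM /=.
rewrite -/(sqn g.2) -/(sqn h.2).
ring.
Qed.

Lemma cover_projM g h :
  cover_proj (cover_mul g h) = cover_proj g *m cover_proj h.
Proof.
rewrite /cover_proj /su_mx cover_z1M; apply/matrixP => i j.
have -> : (cover_mul g h).2 = cover_z1 g * h.2 + g.2 * (cover_z1 h)^*%C by [].
move: (cover_z1 g) (cover_z1 h) g.2 h.2 => z z' w w'.
rewrite !mxE !big_ord_recl big_ord0 !mxE.
have -> : (z * w' + w * z'^*%C)^*%C = z^*%C * w'^*%C + w^*%C * z'.
  by rewrite rmorphD !rmorphM /= conjcK.
have -> : (z * z' + w * w'^*%C)^*%C = z^*%C * z'^*%C + w^*%C * w'.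
  by rewrite rmorphD !rmorphM /= conjcK.
rewrite addr0 /=.
by case: (i == 0); case: (j == 0) => //; rewrite addrC.
Qed.

Let z1_one : cover_z1 cover_one = 1.
Proof.
rewrite /cover_z1 /= cos0 sin0 expr0n /= !addr0 sqrtr1.
by apply/eqP; rewrite eq_complex /= !(mulr0, mul0r, mulr1, subr0, addr0) !eqxx.
Qed.

Lemma cover_mul1g g : cover_mul cover_one g = g.
Proof.
rewrite /cover_mul z1_one /= !mul0r !addr0 /= mul0r atan0 mul1r addr0 add0r.
by case: g.
Qed.

Lemma cover_mulg1 g : cover_mul g cover_one = g.
Proof.
rewrite /cover_mul z1_one conjc0 conjc1 [cover_one.2]/= [cover_one.1]/=.
rewrite !mulr0 mul0r !addr0 mulr1 add0r.
have -> : complex.Im (1 : C) = 0 by [].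
by rewrite mul0r atan0 addr0; case: g.
Qed.

Lemma cover_proj_SU11 g : SU11 (cover_proj g).
Proof.
exists (cover_z1 g), g.2; split=> //.
have E z : `|z| ^+ 2 = (sqn z)%:C.
  by rewrite normc_def -rmorphXn /= sqr_sqrtr // sqn_ge0.
by rewrite !E sqn_z1 rmorphD /= addrK.
Qed.

End Cover.
Arguments cover_one {R}.

(* Main.v *)
(* Record a point of either group by [w = z2] and by an argument [c] of [z1]; a horizontal
   curve of speed [n] then satisfies [|w'|^2 = (1 + |w|^2) n^2] and
   [c' = Im (w conj w') / (1 + |w|^2)].  For each charge [l] the function
   [l c + f_l(|w|)], with [(1 + x^2) f_l'(x) = sqrt (1 + (1 - l^2) x^2)], calibrates the
   geodesics on which [|w|] is monotone; the geodesics on which [|w|] turns back are handled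
   by an isoperimetric completion to a full period.  Hence, among curves from the identity to
   [w] whose argument changes by at least [|c|], the minimizer is unique when [w <> 0], while
   for [w = 0], [c <> 0] it can be rotated about the axis.  On the cover [c] is determined by
   the end point; on SU(1,1) the least [|c|] is attained twice exactly when [z1 < 0], with
   [c = pi] and [c = - pi]. *)

Require Import Defs.
From HB Require Import structures.
From mathcomp Require Import all_boot all_order all_algebra.
From mathcomp Require Import complex.
From mathcomp Require Import all_classical all_reals all_analysis.
From mathcomp Require Import measurable_realfun.
From mathcomp Require Import ring lra.
Import Order.TTheory GRing.Theory Num.Theory numFieldNormedType.Exports.
Set Implicit Arguments.
Unset Strict Implicit.
Unset Printing Implicit Defensive.
Local Open Scope classical_set_scope.
Local Open Scope complex_scope.
Local Open Scope ring_scope.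

(** * Absolutely continuous functions *)

Section AbsolutelyContinuous.
Variable R : realType.
Implicit Types (a b e t : R) (f g h : R -> R).
Notation mu := (@lebesgue_measure R).

(** The infimum of the lengths is not obtained by compactness: [arc_exists] gives an explicit arc to
    every radius and argument, and calibration bounds every competitor below by its length. Two
    obstacles shape the rest. Horizontal curves are only absolutely continuous, and [|z2|] need not
    be differentiable on the axis, so monotonicity is derived from estimates on intervals straddling
    a point, which make sense without a derivative. Moreover, for [l > 1] the eikonal function of
    charge [l] stops at the radius [1 / sqrt (l^2 - 1)], exactly where the arc of charge [l] turns
    back; a competitor that goes farther has to be measured with another charge. For uniqueness, a
    tight calibration is perturbed in the charge: the linear term must vanish, which gives radius
    and argument as functions of arc length without a study of the equality case of Cauchy-Schwarz
    at almost every time. The perturbation needs room below the turning radius, so the top itself is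
    reached by continuity. *)

Lemma ae_imply (P Q : R -> Prop) : (forall t, P t -> Q t) ->
  {ae mu, forall t, P t} -> {ae mu, forall t, Q t}.
Proof. move=> PQ; apply: filterS; first exact: (ae_filter_ringOfSetsType mu).
exact: PQ. Qed.

Lemma ae_and (P Q : R -> Prop) : {ae mu, forall t, P t} ->
  {ae mu, forall t, Q t} -> {ae mu, forall t, P t /\ Q t}.
Proof. by apply: filterI; exact: (ae_filter_ringOfSetsType mu). Qed.

(** Real induction: [Q a] is carried a little beyond the supremum of the points where it holds.
    Locally only the intervals containing the given point have to be treated. *)
Lemma interval_induction a b (Q : R -> R -> Prop) : a <= b ->
  (forall x y z, a <= x -> x <= y -> y <= z -> z <= b -> Q x y -> Q y z -> Q x z) ->
  (forall t, a <= t -> t <= b -> exists2 d, 0 < d &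
    forall x y, a <= x -> x <= t -> t <= y -> y <= b -> y - x < d -> Q x y) ->
  Q a b.
Proof.
move=> ab Qtrans Qloc.
pose E := [set x | a <= x <= b /\ Q a x].
have Ea : E a.
  split; first by rewrite lexx ab.
  have [d d0 dQ] := Qloc _ (lexx a) ab.
  by apply: dQ => //; rewrite subrr.
have supE : has_sup E.
  by split; [exists a|exists b => x [/andP[_ xb] _]].
pose s := sup E.
have sa : a <= s by apply: ub_le_sup => //; case: supE.
have sb : s <= b by apply: ge_sup; [exists a|move=> x [/andP[]]].
have [d d0 dQ] := Qloc _ sa sb.
have [x Ex sx] : exists2 x, E x & s - d / 2 < x.
  by apply: sup_gt; [exists a|rewrite ltrBlDr ltrDl divr_gt0].
have xs : x <= s by apply: ub_le_sup => //; case: supE.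
case: Ex => /andP[ax xb] Qax.
pose y := Num.min b (s + d / 4).
have sy : s <= y by rewrite le_min sb lerDl divr_ge0 // ltW.
have yb : y <= b by rewrite ge_min lexx.
have ysd : y <= s + d / 4 by rewrite ge_min lexx orbT.
have Qxy : Q x y by apply: dQ => //; lra.
have Qay : Q a y by apply: (Qtrans _ x) => //; apply: le_trans sy.
have : y <= s.
  apply: ub_le_sup; first by case: supE.
  by split => //; rewrite (le_trans sa sy).
rewrite /y; case: (leP b (s + d / 4)) => [bs|bs]; last by lra.
by move=> bs'; move: Qay; rewrite /y (elimT min_idPl bs).
Qed.

(** Lists replace the indexed families of [absolutely_continuous] because interval induction
    concatenates them; their order yields disjointness. *)
Fixpoint chain (x : R) (l : seq (R * R)) (y : R) : Prop :=
  if l is p :: l' then x <= p.1 /\ p.1 <= p.2 /\ chain p.2 l' y else x <= y.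

Lemma chain_le x l y : chain x l y -> x <= y.
Proof.
elim: l x => [//|p l IH] x /= [xp [pp /IH py]].
exact: le_trans xp (le_trans pp py).
Qed.

Lemma chain_cat x l y l' z : chain x l y -> chain y l' z -> chain x (l ++ l') z.
Proof.
elim: l x => [|p l IH] x /=.
  case: l' => [|p l'] /= xy; first exact: le_trans.
  by move=> [yp ?]; split=> //; apply: le_trans yp.
by move=> [xp [pp /IH py]] /py; split.
Qed.

Lemma chain_nth x l y i : chain x l y -> (i < size l)%N ->
  x <= (nth 0 l i).1 /\ (nth 0 l i).1 <= (nth 0 l i).2 /\ (nth 0 l i).2 <= y.
Proof.
elim: l x i => [//|p l IH] x [|i] /= [xp [pp pl]] il.
  by split => //; split => //; apply: chain_le pl.
have [h1 [h2 h3]] := IH _ _ pl il.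
by split=> //; apply: le_trans xp (le_trans pp h1).
Qed.

Lemma chain_nth_lt x l y i j : chain x l y -> (i < j < size l)%N ->
  (nth 0 l i).2 <= (nth 0 l j).1.
Proof.
elim: l x i j => [|p l IH] x i j /=; first by rewrite andbF.
case: i j => [|i] [|j] //= [xp [pp pl]].
  by move=> jl; have [] := chain_nth pl jl.
by rewrite !ltnS => /(IH _ _ _ pl).
Qed.

Lemma ac_chain a b f : absolutely_continuous a b f ->
  forall e, 0 < e -> exists2 d, 0 < d & forall l, chain a l b ->
    \sum_(p <- l) (p.2 - p.1) < d -> \sum_(p <- l) `|f p.2 - f p.1| < e.
Proof.
move=> acf e e0; have [d d0 dP] := acf e e0.
exists d => // l cl ld.
have := dP (size l) (fun i => (nth 0 l i).1) (fun i => (nth 0 l i).2).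
rewrite -(big_mkord xpredT (fun i => (nth 0 l i).2 - (nth 0 l i).1)).
rewrite -(big_nth 0 xpredT (fun p : R * R => p.2 - p.1)).
rewrite -(big_mkord xpredT (fun i => `|f (nth 0 l i).2 - f (nth 0 l i).1|)).
rewrite -(big_nth 0 xpredT (fun p : R * R => `|f p.2 - f p.1|)).
apply => //.
- by move=> i; apply: chain_nth cl _.
- move=> i j _ _ [z []] /=; rewrite !in_itv /= => /andP[i1 i2] /andP[j1 j2].
  apply: val_inj; have [ij|ji|//] := ltngtP i j.
  + have : (i < j < size l)%N by rewrite ij /=.
    by move=> /(chain_nth_lt cl) h; exfalso; lra.
  + have : (j < i < size l)%N by rewrite ji /=.
    by move=> /(chain_nth_lt cl) h; exfalso; lra.
Qed.

(** An upper derivative over intervals that contain [t]. It is meaningful where [g] has no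
    derivative, such as a radius at one of its zeros. *)
Definition straddle_le a b g t d : Prop := forall e, 0 < e ->
  exists2 r, 0 < r & forall x y, a <= x -> x <= t -> t <= y -> y <= b ->
    y - x < r -> g y - g x <= (d + e) * (y - x).

(** The exceptional null set lies in an open set [U] shorter than the threshold of absolute
    continuity. Interval induction cuts [[a, b]] into intervals around bad points, contained in [U],
    whose increments sum to less than [e], and intervals straddling a good point, over which [g]
    grows at rate at most [e]. *)
Lemma ac_straddle_le a b g : a <= b -> absolutely_continuous a b g ->
  {ae mu, forall t, t \in `[a, b] -> straddle_le a b g t 0} -> g b <= g a.
Proof.
move=> ab acg [N [mN N0 badN]].
suff H e : 0 < e -> g b - g a <= e * (b - a) + e.
  rewrite -subr_le0; apply/ler_addgt0Pl => e e0; rewrite addr0.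
  have c0 : 0 < b - a + 1 by lra.
  apply: le_trans (H (e / (b - a + 1)) _) _; first by rewrite divr_gt0.
  by rewrite le_eqVlt; apply/orP; left; apply/eqP; field; lra.
move=> e0; have [d d0 dP] := ac_chain acg e0.
have [U [oU NU Ud]] : exists U : set R, [/\ open U, N `<=` U & (mu U < d%:E)%E].
  have [|U [oU NU Ud]] := lebesgue_regularity_outer mN _ d0.
    apply: le_lt_trans (ltry 0); rewrite le_eqVlt; apply/orP; left.
    by apply/eqP; exact: N0.
  exists U; split => //; apply: le_lt_trans Ud.
  have mU : measurable U by exact: measurable_realfun.open_measurable oU.
  rewrite [X in (X <= _)%E](_ : _ = mu ((U `\` N) `|` N)); last first.
    by rewrite setUC setDUK.
  apply: le_trans (measureU2 _ _ _) _ => //; first exact: measurableD.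
  have N0' : mu N = 0%E by exact: N0.
  rewrite -[leRHS]adde0; apply: leeD; first exact: lexx.
  by rewrite le_eqVlt; apply/orP; left; apply/eqP; exact: N0'.
have mU : measurable U by exact: measurable_realfun.open_measurable oU.
have mUI x y : measurable (U `&` `]x, y]) by apply: measurableI.
(* [l] lists the intervals spent on bad points. Bounding their total length by the part of [U]
   inside []x, y]] makes [Q] additive. *)
pose Q x y := exists l, [/\ chain x l y,
  ((\sum_(p <- l) (p.2 - p.1))%:E <= mu (U `&` `]x, y]))%E
  & g y - g x <= e * (y - x) + \sum_(p <- l) `|g p.2 - g p.1|].
have : Q a b.
  apply: interval_induction => // [x y z ax xy yz zb|t at_ tb].
    move=> [l [cl ml gl]] [l' [cl' ml' gl']]; exists (l ++ l'); split.
    - exact: chain_cat cl'.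
    - rewrite big_cat EFinD (@itv_bndbnd_setU _ _ (BRight x) (BRight y) (BRight z)) ?bnd_simp //.
      rewrite setIUr measureU //; [exact: leeD|exact: mUI|exact: mUI|].
      rewrite -subset0 => u [[_ /=]]; rewrite in_itv /= => /andP[_ uy] [_ /=].
      by rewrite in_itv /= ltNge uy.
    - rewrite big_cat /=.
      by rewrite !mulrBr in gl gl' *; lra.
  have [Nt|Nt] := pselect (N t).
    have [r /= r0 rU] : nbhs t U by apply: open_nbhs_nbhs; split => //; apply: NU.
    exists r => // x y ax xt ty yb yxr; exists [:: (x, y)]; split.
    - by rewrite /= !lexx (le_trans xt ty).
    - rewrite big_seq1 /=.
      rewrite (_ : U `&` _ = `]x, y]%classic); last first.
        apply/seteqP; split => [u []//|u] /= uxy; split => //; apply: rU.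
        by move: uxy; rewrite /= in_itv /= => /andP[xu uy]; rewrite ltr_distlC; lra.
      have := le_trans xt ty; rewrite le_eqVlt => /predU1P[->|xy].
        by rewrite subrr measure_ge0.
      by rewrite lebesgue_measure_itv /= lte_fin xy.
    - rewrite big_seq1 /=; apply: le_trans (ler_norm _) _.
      by rewrite lerDr mulr_ge0 ?(ltW e0) // subr_ge0 (le_trans xt ty).
  have /(_ _ e0) [r r0 rP] : straddle_le a b g t 0.
    by apply: contrapT => h; apply: Nt; apply: badN => /=; apply: contra_not h; apply;
        rewrite in_itv /= at_ tb.
  exists r => // x y ax xt ty yb yxr; exists [::]; split.
  - exact: le_trans xt ty.
  - by rewrite big_nil measure_ge0.
  - by rewrite big_nil addr0 -[e]add0r; apply: rP.
move=> [l [cl ml gl]]; apply: le_trans gl _; rewrite lerD2l ltW //.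
apply: dP cl _; rewrite -lte_fin; apply: le_lt_trans ml (le_lt_trans _ Ud).
by apply: le_measure; [rewrite inE; exact: mUI|rewrite inE|exact: subIsetl].
Qed.

Lemma acS a b a' b' f : a <= a' -> b' <= b ->
  absolutely_continuous a b f -> absolutely_continuous a' b' f.
Proof.
move=> aa bb acf e /acf[d d0 dP]; exists d => // n x y xy; apply: dP => i.
have [h1 [h2 h3]] := xy i; split; first exact: le_trans h1.
by split => //; apply: le_trans bb.
Qed.

(** Two dominating functions are allowed so that sums, products and plane norms are all
    instances. *)
Lemma ac_dominated a b (K : R) f1 f2 h : absolutely_continuous a b f1 ->
  absolutely_continuous a b f2 ->
  (forall x y, a <= x -> x <= y -> y <= b ->
    `|h y - h x| <= K * (`|f1 y - f1 x| + `|f2 y - f2 x|)) ->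
  absolutely_continuous a b h.
Proof.
move=> ac1 ac2 dom e e0.
have K0 : 0 < `|K| + 1 by rewrite ltr_wpDl.
have e20 : 0 < e / (2 * (`|K| + 1)) by rewrite divr_gt0 // mulr_gt0.
have [d1 d10 P1] := ac1 _ e20; have [d2 d20 P2] := ac2 _ e20.
exists (Num.min d1 d2); first by rewrite lt_min d10.
move=> n x y xy tr; rewrite lt_min => /andP[s1 s2].
have {}P1 := P1 _ _ _ xy tr s1; have {}P2 := P2 _ _ _ xy tr s2.
apply: (@le_lt_trans _ _ ((`|K| + 1) * (\sum_(i < n) `|f1 (y i) - f1 (x i)|
     + \sum_(i < n) `|f2 (y i) - f2 (x i)|))).
  rewrite -big_split mulr_sumr; apply: ler_sum => i _.
  have [h1 [h2 h3]] := xy i; apply: le_trans (dom _ _ h1 h2 h3) _.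
  by rewrite ler_wpM2r ?addr_ge0 // (le_trans (ler_norm _)) // lerDl.
rewrite -ltr_pdivlMl //.
have -> : (`|K| + 1)^-1 * e = e / (2 * (`|K| + 1)) + e / (2 * (`|K| + 1)).
  by field; rewrite gt_eqF.
exact: ltrD.
Qed.

Lemma ac_lipschitz a b (K : R) f h : absolutely_continuous a b f ->
  (forall x y, a <= x -> x <= y -> y <= b -> `|h y - h x| <= K * `|f y - f x|) ->
  absolutely_continuous a b h.
Proof.
move=> acf dom; apply: (ac_dominated (K := `|K|) acf acf) => x y ax xy yb.
apply: le_trans (dom x y ax xy yb) _; rewrite mulrDr.
apply: (@le_trans _ _ (`|K| * `|f y - f x|)); first by rewrite ler_wpM2r ?ler_norm.
by rewrite lerDl mulr_ge0.
Qed.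

Lemma ac_id a b : absolutely_continuous a b (fun x => x).
Proof.
move=> e e0; exists e => // n x y xy _; apply: le_lt_trans.
rewrite le_eqVlt; apply/orP; left; apply/eqP/eq_bigr => i _.
by have [_ [h _]] := xy i; rewrite ger0_norm // subr_ge0.
Qed.

Lemma acD a b f g : absolutely_continuous a b f -> absolutely_continuous a b g ->
  absolutely_continuous a b (fun t => f t + g t).
Proof.
move=> acf acg; apply: (ac_dominated (K := 1) acf acg) => x y _ _ _.
by rewrite mul1r (le_trans _ (ler_normD _ _)) // le_eqVlt; apply/orP; left;
   apply/eqP; congr `|_|; ring.
Qed.

Lemma acZ a b (k : R) f : absolutely_continuous a b f ->
  absolutely_continuous a b (fun t => k * f t).
Proof.
by move=> acf; apply: (ac_lipschitz (K := `|k|) acf) => x y _ _ _; rewrite -mulrBr normrM.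
Qed.

Lemma acN a b f : absolutely_continuous a b f ->
  absolutely_continuous a b (fun t => - f t).
Proof.
move=> acf; apply: (ac_lipschitz (K := 1) acf) => x y _ _ _.
by rewrite mul1r -normrN opprB opprK addrC.
Qed.

Lemma acB a b f g : absolutely_continuous a b f -> absolutely_continuous a b g ->
  absolutely_continuous a b (fun t => f t - g t).
Proof. by move=> acf acg; apply: acD => //; apply: acN. Qed.

Lemma ac_uniform a b f : absolutely_continuous a b f -> forall e, 0 < e ->
  exists2 d, 0 < d & forall x y, a <= x -> x <= y -> y <= b -> y - x < d ->
    `|f y - f x| < e.
Proof.
move=> acf e e0; have [d d0 dP] := acf e e0; exists d => // x y ax xy yb yx.
have := dP 1%N (fun=> x) (fun=> y); rewrite !big_ord1; apply => //.
by move=> i j _ _ _; rewrite !ord1.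
Qed.

Lemma ac_within a b f : absolutely_continuous a b f ->
  {within `[a, b], continuous f}.
Proof.
move=> acf; apply/subspace_continuousP => x /=; rewrite in_itv /= => /andP[ax xb].
apply/cvgrPdist_lt => e e0; have [d d0 dP] := ac_uniform acf e0.
exists d => //= y xyd; rewrite in_itv /= => /andP[ay yb].
have [xy|/ltW yx] := leP x y.
  rewrite distrC; apply: dP => //; rewrite -[_ - _]ger0_norm ?subr_ge0 //.
  by rewrite distrC.
by apply: dP => //; rewrite -[_ - _]ger0_norm ?subr_ge0.
Qed.

Lemma ac_bounded a b f : a <= b -> absolutely_continuous a b f ->
  exists2 M, 0 < M & forall t, a <= t -> t <= b -> `|f t| <= M.
Proof.
move=> ab acf.
have acn : absolutely_continuous a b (fun t => `|f t|).
  apply: (ac_lipschitz (K := 1) acf) => x y _ _ _.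
  by rewrite mul1r ler_dist_dist.
have [c _ cP] := EVT_max ab (ac_within acn).
exists (`|f c| + 1); first by rewrite ltr_wpDl.
move=> t at_ tb; apply: le_trans (_ : `|f c| <= _); last by rewrite lerDl.
by apply: cP; rewrite in_itv /= at_.
Qed.

Lemma acM a b f g : a <= b -> absolutely_continuous a b f ->
  absolutely_continuous a b g -> absolutely_continuous a b (fun t => f t * g t).
Proof.
move=> ab acf acg; have [Mf Mf0 fM] := ac_bounded ab acf.
have [Mg Mg0 gM] := ac_bounded ab acg.
apply: (ac_dominated (K := Mf + Mg) acf acg) => x y ax xy yb.
have -> : f y * g y - f x * g x = f y * (g y - g x) + g x * (f y - f x) by ring.
apply: le_trans (ler_normD _ _) _; rewrite !normrM mulrDr.
have := fM _ (le_trans ax xy) yb; have := gM _ ax (le_trans xy yb) => g1 f1.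
have := normr_ge0 (f y - f x); have := normr_ge0 (g y - g x).
by nra.
Qed.

Lemma ac_const a b (k : R) : absolutely_continuous a b (fun=> k).
Proof.
apply: (ac_lipschitz (K := 1) (ac_id a b)) => x y _ _ _.
by rewrite subrr normr0 mul1r.
Qed.

Lemma mvt_lipschitz a b f df (K : R) :
  (forall t, a <= t -> t <= b -> is_derive t 1 f (df t)) ->
  (forall t, a <= t -> t <= b -> `|df t| <= K) ->
  forall x y, a <= x -> x <= y -> y <= b -> `|f y - f x| <= K * (y - x).
Proof.
move=> fd dfK x y ax xy yb.
have [||c] := @MVT_segment _ f df x y xy.
- move=> z; rewrite in_itv /= => /andP[xz zy]; apply: fd.
    exact: le_trans (ltW xz).
  exact: le_trans (ltW zy) yb.
- apply: derivable_within_continuous => z; rewrite in_itv /= => /andP[xz zy].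
  by have /@ex_derive := fd z (le_trans ax xz) (le_trans zy yb).
rewrite in_itv /= => /andP[xc cy] ->.
rewrite normrM [X in _ * X]ger0_norm ?subr_ge0 //.
rewrite ler_wpM2r ?subr_ge0 //; apply: dfK; first exact: le_trans xc.
exact: le_trans cy yb.
Qed.

Lemma ac_derive_bounded a b f df (K : R) :
  (forall t, a <= t -> t <= b -> is_derive t 1 f (df t)) ->
  (forall t, a <= t -> t <= b -> `|df t| <= K) -> absolutely_continuous a b f.
Proof.
move=> fd dfK; apply: (ac_lipschitz (K := K) (ac_id a b)) => x y ax xy yb.
by rewrite (ger0_norm (_ : 0 <= y - x)) ?subr_ge0 //; apply: mvt_lipschitz fd dfK _ _ ax xy yb.
Qed.

Lemma derive_approx f t d : is_derive t 1 f d -> forall e, 0 < e ->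
  exists2 r, 0 < r & forall z, `|z - t| < r -> `|f z - f t - d * (z - t)| <= e * `|z - t|.
Proof.
move=> fd e e0.
have /cvgrPdist_le/(_ _ e0) : h^-1 *: (f (h *: 1 + t) - f t) @[h --> 0^'] --> d.
  by have := @ex_derive _ _ _ _ _ _ _ fd; have := @derive_val _ _ _ _ _ _ _ fd => <-.
rewrite near_withinE /= => -[r /= r0 rP]; exists r => // z zr.
have [->|zt] := eqVneq z t; first by rewrite !subrr mulr0 subr0 normr0 mulr0.
have zt0 : z - t != 0 by rewrite subr_eq0.
have := rP (z - t); rewrite /ball_ /= sub0r normrN => /(_ zr zt0).
rewrite scaler1 subrK /GRing.scale /= => H.
have -> : f z - f t - d * (z - t) = - (d - (z - t)^-1 * (f z - f t)) * (z - t).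
  by field.
by rewrite normrM normrN ler_wpM2r.
Qed.

(** Since [t] lies between [x] and [y], the errors at the two ends add up to [e * (y - x)]. *)
Lemma derive_straddle a b f t d : is_derive t 1 f d -> straddle_le a b f t d.
Proof.
move=> fd e e0; have [r r0 rP] := derive_approx fd e0.
exists r => // x y ax xt ty yb yxr.
have hy : `|y - t| < r by rewrite ger0_norm ?subr_ge0 //; lra.
have hx : `|x - t| < r by rewrite ler0_norm ?subr_le0 //; lra.
have := rP y hy; have := rP x hx.
rewrite (ger0_norm (_ : 0 <= y - t)) ?subr_ge0 // (ler0_norm (_ : x - t <= 0)) ?subr_le0 //.
by rewrite !ler_norml => /andP[h1 h2] /andP[h3 h4]; nra.
Qed.

Lemma straddleD a b f g t d d' : straddle_le a b f t d -> straddle_le a b g t d' ->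
  straddle_le a b (fun x => f x + g x) t (d + d').
Proof.
move=> sf sg e e0; have e2 : 0 < e / 2 by lra.
have [r r0 rP] := sf _ e2; have [r' r'0 r'P] := sg _ e2.
exists (Num.min r r'); first by rewrite lt_min r0.
move=> x y ax xt ty yb; rewrite lt_min => /andP[h h'].
have := rP _ _ ax xt ty yb h; have := r'P _ _ ax xt ty yb h'.
by rewrite !mulrDl; lra.
Qed.

Lemma ae_derive_le a b f df : a <= b -> absolutely_continuous a b f ->
  {ae mu, forall t, t \in `[a, b] -> is_derive t 1 f (df t) /\ df t <= 0} ->
  f b <= f a.
Proof.
move=> ab acf aef; apply: ac_straddle_le ab acf _.
apply: ae_imply aef => t + tab => /(_ tab) [fd df0] e e0.
have [r r0 rP] := derive_straddle a b fd e0; exists r => // x y ax xt ty yb yx.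
apply: le_trans (rP _ _ ax xt ty yb yx) _.
by rewrite ler_wpM2r ?lerD2r // subr_ge0 (le_trans xt ty).
Qed.

Lemma ae_derive0 a b f : a <= b -> absolutely_continuous a b f ->
  {ae mu, forall t, t \in `[a, b] -> is_derive t 1 f 0} -> f b = f a.
Proof.
move=> ab acf aef; apply/eqP; rewrite eq_le; apply/andP; split.
  apply: (ae_derive_le (df := fun=> 0) ab acf).
  by apply: ae_imply aef => t + tab => /(_ tab).
rewrite -lerN2; apply: (ae_derive_le (f := fun t => - f t) (df := fun=> 0) ab (acN acf)).
apply: ae_imply aef => t + tab => /(_ tab) fd; split => //.
by rewrite -[0]oppr0; apply: is_deriveN.
Qed.

Lemma ae_neq (t0 : R) : {ae mu, forall t, t != t0}.
Proof.
exists [set t0]; split; [by []|exact: lebesgue_measure_set1|].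
by move=> t /= /negP; rewrite negbK => /eqP.
Qed.

(** Extension by zero outside [[0, tau]] turns integrability on that interval into integrability on
    every [[0, y]], the form that [FTC1] asks for. *)
Definition cumul (tau : R) (nu : R -> R) t : R :=
  \int[mu]_(x in `[0, t]) (nu \_ `[0, tau]) x.

Lemma cumul_integrable tau nu : mu.-integrable `[0, tau] (EFin \o nu) ->
  mu.-integrable setT (EFin \o (nu \_ `[0, tau])).
Proof.
by move=> inu; rewrite -restrict_EFin; apply/integrable_restrict => //=; rewrite setTI.
Qed.

Lemma cumulB tau nu x y : mu.-integrable `[0, tau] (EFin \o nu) -> 0 <= x -> x <= y ->
  cumul tau nu y - cumul tau nu x = \int[mu]_(z in `]x, y]) (nu \_ `[0, tau]) z.
Proof.
move=> inu x0 xy; apply: Rintegral_itvB; rewrite ?bnd_simp //.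
by apply: integrableS (cumul_integrable inu).
Qed.

Lemma cumul0 tau nu : cumul tau nu 0 = 0.
Proof. by rewrite /cumul set_itv1 Rintegral_set1. Qed.

Lemma cumul_le tau nu x y : mu.-integrable `[0, tau] (EFin \o nu) ->
  (forall t, 0 <= nu t) -> 0 <= x -> x <= y -> cumul tau nu x <= cumul tau nu y.
Proof.
move=> inu nu0 x0 xy; rewrite -subr_ge0 cumulB //; apply: Rintegral_ge0 => t _.
by rewrite patchE; case: ifP.
Qed.

Lemma cumul_ac tau nu : mu.-integrable `[0, tau] (EFin \o nu) ->
  absolutely_continuous 0 tau (cumul tau nu).
Proof.
move=> inu e e0; have iN := cumul_integrable inu.
have [d [d0 dP]] := integral_normr_continuous iN e0.
exists d => // n x y xy tr sd.
have mI (i : 'I_n) : measurable (`]x i, y i[%classic : set R) by [].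
have := dP (\big[setU/set0]_(i < n) `]x i, y i[%classic).
have mB : measurable (\big[setU/set0]_(i < n) (`]x i, y i[%classic : set R)).
  by apply: bigsetU_measurable.
move=> /(_ mB); rewrite measure_bigsetU_ord //.
have -> : (\sum_(i < n) mu `]x i, y i[%classic = (\sum_(i < n) (y i - x i))%:E)%E.
  rewrite -sumEFin; apply: eq_bigr => i _; rewrite lebesgue_measure_itv /= lte_fin.
  have [_ [h _]] := xy i; case: ltP => // h'.
  by rewrite (_ : x i = y i); last (by apply/eqP; rewrite eq_le h h'); rewrite subrr.
rewrite lte_fin => /(_ sd); apply: le_lt_trans.
rewrite /Rintegral integral_bigsetU_EFin //; last 3 first.
- by rewrite /index_enum -enumT enum_uniq.
- by apply: sub_trivIset tr.
- apply: (@measurable_funS _ _ _ _ setT) => //.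
  exact: measurable_int (integrable_abse iN).
have iA (i : 'I_n) : mu.-integrable `]x i, y i[ (EFin \o (fun z => `|(nu \_ `[0, tau]) z|)).
  apply: integrableS (integrable_abse iN) => //.
rewrite -sum_fine; last by move=> i _; exact: integrable_fin_num.
apply: ler_sum => i _; have [h1 [h2 h3]] := xy i.
rewrite cumulB //.
rewrite -[leRHS]/(\int[mu]_(z in `]x i, y i[) `|(nu \_ `[0, tau]) z|).
rewrite Rintegral_itv_bndo_bndc //.
by apply: le_normr_Rintegral => //; apply: integrableS iN.
Qed.

Lemma cumul_derive tau nu : mu.-integrable `[0, tau] (EFin \o nu) ->
  {ae mu, forall t, t \in `[0, tau] -> is_derive t 1 (cumul tau nu) (nu t)}.
Proof.
move=> inu; have iN := cumul_integrable inu.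
have := @FTC1 R (nu \_ `[0, tau]) (BLeft 0).
have h1 y : mu.-integrable `[0, y] (EFin \o (nu \_ `[0, tau])).
  by apply: integrableS iN.
move=> /(_ h1); have h2 : locally_integrable [set: R] (nu \_ `[0, tau]).
  by apply: integrable_locally.
(* The differentiation theorem speaks of points strictly to the right of the base point, so 0 is
   discarded. *)
move=> /(_ h2) /= F; have := ae_and F (ae_neq 0).
apply: ae_imply => t /= [+ t0] ttau.
have tp : 0 < t by move: ttau; rewrite in_itv /= lt_def t0 => /andP[].
rewrite lte_fin => /(_ tp) [dF F'].
apply: DeriveDef => //; rewrite -derive1E F' patchE ifT // inE; exact: ttau.
Qed.

End AbsolutelyContinuous.

(** * Derivative rules and a tactic that computes derivatives *)

Section DeriveRules.
Variable R : realType.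
Implicit Types (f g : R -> R) (t a b k : R).

Lemma drv_cst t k : is_derive t 1 (fun=> k) 0.
Proof. exact: is_derive_cst. Qed.

Lemma drv_id t : is_derive t 1 (fun x : R => x) 1.
Proof. exact: is_derive_id. Qed.

Lemma drv_add t f g a b : is_derive t 1 f a -> is_derive t 1 g b ->
  is_derive t 1 (fun x => f x + g x) (a + b).
Proof. exact: is_deriveD. Qed.

Lemma drv_opp t f a : is_derive t 1 f a -> is_derive t 1 (fun x => - f x) (- a).
Proof. exact: is_deriveN. Qed.

Lemma drv_mul t f g a b : is_derive t 1 f a -> is_derive t 1 g b ->
  is_derive t 1 (fun x => f x * g x) (a * g t + f t * b).
Proof.
move=> fa gb; apply: (is_derive_eq (is_deriveM fa gb)).
by rewrite /GRing.scale /= addrC mulrC.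
Qed.

Lemma drv_inv t f a : f t != 0 -> is_derive t 1 f a ->
  is_derive t 1 (fun x => (f x)^-1) (- a / f t ^+ 2).
Proof.
move=> f0 fa; apply: (is_derive_eq (is_deriveV f0 fa)).
by rewrite /GRing.scale /= mulNr mulrC mulNr.
Qed.

Lemma drv_exp t f a n : is_derive t 1 f a ->
  is_derive t 1 (fun x => f x ^+ n.+1) (n.+1%:R * f t ^+ n * a).
Proof.
move=> fa; elim: n => [|n IH]; first by apply: is_derive_eq fa _; rewrite mul1r mul1r.
have -> : (fun x => f x ^+ n.+2) = (fun x => f x * f x ^+ n.+1).
  by apply/funext => x; rewrite exprS.
apply: is_derive_eq (drv_mul fa IH) _.
by rewrite [in RHS]mulrSr exprS; ring.
Qed.

Lemma drv_comp t f g a b : is_derive (g t) 1 f a -> is_derive t 1 g b ->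
  is_derive t 1 (fun x => f (g x)) (a * b).
Proof. exact: is_derive1_comp. Qed.

Lemma drv_sin t f a : is_derive t 1 f a ->
  is_derive t 1 (fun x => sin (f x)) (cos (f t) * a).
Proof. by apply: drv_comp. Qed.

Lemma drv_cos t f a : is_derive t 1 f a ->
  is_derive t 1 (fun x => cos (f x)) (- sin (f t) * a).
Proof. by apply: drv_comp. Qed.

Lemma drv_expR t f a : is_derive t 1 f a ->
  is_derive t 1 (fun x => expR (f x)) (expR (f t) * a).
Proof. by apply: drv_comp. Qed.

Lemma drv_atan t f a : is_derive t 1 f a ->
  is_derive t 1 (fun x => atan (f x)) ((1 + f t ^+ 2)^-1 * a).
Proof. by apply: drv_comp. Qed.

Lemma drv_sqrt t f a : 0 < f t -> is_derive t 1 f a ->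
  is_derive t 1 (fun x => Num.sqrt (f x)) ((2 * Num.sqrt (f t))^-1 * a).
Proof. by move=> f0; apply: drv_comp; exact: is_derive1_sqrt. Qed.

Lemma drv_mull t k : is_derive t 1 (GRing.mul k) k.
Proof.
by apply: is_derive_eq (drv_mul (drv_cst t k) (drv_id t)) _; rewrite mul0r add0r mulr1.
Qed.

Lemma drv_addl t k : is_derive t 1 (GRing.add k) 1.
Proof. by apply: is_derive_eq (drv_add (drv_cst t k) (drv_id t)) _; rewrite add0r. Qed.

End DeriveRules.

(** The derivative is an existential variable filled in by descending through the expression;
    hypotheses about atomic functions take precedence over the rules. [der] then leaves the
    comparison with the announced value and the side conditions. *)
Ltac der_step :=
  first
  [ eassumption
  | match goal with H : forall t, is_derive t 1 ?f _ |- is_derive _ 1 ?f _ => exact: H end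
  | lazymatch goal with
    | |- is_derive _ _ (fun x => x) _ => exact: drv_id
    | |- is_derive _ _ (GRing.mul _) _ => exact: drv_mull
    | |- is_derive _ _ (GRing.add _) _ => exact: drv_addl
    | |- is_derive _ _ GRing.opp _ => exact: (drv_opp (drv_id _))
    | |- is_derive _ _ sin _ => exact: is_derive_sin
    | |- is_derive _ _ cos _ => exact: is_derive_cos
    | |- is_derive _ _ expR _ => exact: is_derive_expR
    | |- is_derive _ _ atan _ => exact: is_derive1_atan
    | |- is_derive _ _ (fun x => GRing.add (@?f x) (@?g x)) _ => eapply drv_add
    | |- is_derive _ _ (fun x => GRing.opp (@?f x)) _ => eapply drv_opp
    | |- is_derive _ _ (fun x => GRing.mul (@?f x) (@?g x)) _ => eapply drv_mul
    | |- is_derive _ _ (fun x => GRing.inv (@?f x)) _ => eapply drv_inv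
    | |- is_derive _ _ (fun x => GRing.exp (@?f x) _) _ => eapply drv_exp
    | |- is_derive _ _ (fun x => sin (@?f x)) _ => eapply drv_sin
    | |- is_derive _ _ (fun x => cos (@?f x)) _ => eapply drv_cos
    | |- is_derive _ _ (fun x => expR (@?f x)) _ => eapply drv_expR
    | |- is_derive _ _ (fun x => atan (@?f x)) _ => eapply drv_atan
    | |- is_derive _ _ (fun x => Num.sqrt (@?f x)) _ => eapply drv_sqrt
    end
  | exact: drv_cst ].
Ltac der := eapply is_derive_eq; [repeat der_step|]; cbv beta;
  match goal with |- is_true (_ != 0) => try (by rewrite pnatr_eq0) | _ => idtac end.

(** The integral starts at -1 so that 0 is an interior point and the derivative there is two-sided;
    the second integral normalizes the value at 0. *)
HB.lock Definition primitive (R : realType) (g : R -> R) (x : R) : R :=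
  \int[lebesgue_measure]_(t in `[-1, x]) g t - \int[lebesgue_measure]_(t in `[-1, 0]) g t.

Section Calculus.
Variable R : realType.
Implicit Types (f g : R -> R) (a b t l : R).
Notation mu := (@lebesgue_measure R).

Lemma derive_incr f df a b : a <= b ->
  (forall t, a <= t -> t <= b -> is_derive t 1 f (df t)) ->
  (forall t, a <= t -> t <= b -> 0 <= df t) -> f a <= f b.
Proof.
move=> ab fd df0.
have [||c] := @MVT_segment _ f df a b ab.
- by move=> z; rewrite in_itv /= => /andP[xz zy]; apply: fd; apply: ltW.
- apply: derivable_within_continuous => z; rewrite in_itv /= => /andP[xz zy].
  by have /@ex_derive := fd z xz zy.
rewrite in_itv /= => /andP[xc cy] h.
by rewrite -subr_ge0 h mulr_ge0 ?subr_ge0 // df0.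
Qed.

Lemma derive_const f a b : a <= b ->
  (forall t, a <= t -> t <= b -> is_derive t 1 f 0) -> f a = f b.
Proof.
move=> ab fd; apply/eqP; rewrite eq_le (derive_incr (df := fun=> 0)) //=.
rewrite -lerN2; apply: (@derive_incr (fun x => - f x) (fun=> 0)) => // t at_ tb.
by have h := fd t at_ tb; der; rewrite ?oppr0.
Qed.

Lemma derive_eq f g a b df : a <= b -> f a = g a ->
  (forall t, a <= t -> t <= b -> is_derive t 1 f (df t)) ->
  (forall t, a <= t -> t <= b -> is_derive t 1 g (df t)) -> f b = g b.
Proof.
move=> ab fga fd gd; apply/eqP; rewrite -subr_eq0.
suff <- : f a - g a = f b - g b by rewrite fga subrr.
apply: (@derive_const (fun x => f x - g x) a b ab) => t at_ tb.
by have hf := fd t at_ tb; have hg := gd t at_ tb; der; rewrite ?subrr.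
Qed.

Lemma primitive0 g : primitive g 0 = 0.
Proof. by rewrite primitive.unlock subrr. Qed.

Lemma primitive_derive g (x : R) : continuous g -> -1 < x -> is_derive x 1 (primitive g) (g x).
Proof.
move=> cg x1.
have x1' : x < x + 1 by rewrite ltrDl.
have int : mu.-integrable `[-1, x + 1] (EFin \o g).
  apply: continuous_compact_integrable; first exact: segment_compact.
  exact: continuous_subspaceT.
have := continuous_FTC1_closed x1' int x1 (cg x).
set F := fun x0 : R => _ => -[D1 D2].
have h : is_derive x 1 F (g x).
  by rewrite -D2 derive1E; exact: derivableP D1.
rewrite primitive.unlock; apply: is_derive_eq (drv_add h (drv_cst x _)) _; exact: addr0.
Qed.

End Calculus.

(** * Eikonal functions and model arcs *)

Section Arcs.
Variable R : realType.
Implicit Types (l t r x : R).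

(* [l * arg z1 + cal l |z2|] solves the eikonal equation: its horizontal gradient has norm 1
   as long as [1 + (1 - l^2) |z2|^2] is nonnegative (it is clamped elsewhere). *)
Definition cal_slope l x := Num.sqrt (Num.max 0 (1 + (1 - l ^+ 2) * x ^+ 2)) / (1 + x ^+ 2).
Definition cal l := primitive (cal_slope l).

Lemma oneDx_gt0 x : 0 < 1 + x ^+ 2.
Proof. by rewrite ltr_pwDl // sqr_ge0. Qed.

Lemma cal_slope_cont l : continuous (cal_slope l).
Proof.
move=> x; apply: cvgM; last first.
  apply: cvgV; first by rewrite gt_eqF // oneDx_gt0.
  by apply: cvgD; [exact: cvg_cst|exact: exprn_continuous].
apply: (@continuous_comp _ _ _ (fun x => Num.max 0 (1 + (1 - l ^+ 2) * x ^+ 2)) Num.sqrt);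
    last exact: sqrt_continuous.
apply: continuous_max; first exact: cvg_cst.
apply: cvgD; first exact: cvg_cst.
by apply: cvgM; [exact: cvg_cst|exact: exprn_continuous].
Qed.

Lemma cal_slope_ge0 l x : 0 <= cal_slope l x.
Proof. by rewrite divr_ge0 ?sqrtr_ge0 // ltW // oneDx_gt0. Qed.

Lemma cal_slope_le1 l x : cal_slope l x <= 1.
Proof.
have p := oneDx_gt0 x; have x0 := sqr_ge0 x; have l0 := sqr_ge0 l.
rewrite ler_pdivrMr // mul1r -[leRHS]ger0_norm; last exact: ltW.
rewrite -sqrtr_sqr ler_sqrt; last exact: sqr_ge0.
by rewrite ge_max sqr_ge0 /=; nra.
Qed.

Lemma cal0 l : cal l 0 = 0. Proof. exact: primitive0. Qed.

Lemma cal_derive l x : 0 <= x -> is_derive x 1 (cal l) (cal_slope l x).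
Proof.
move=> x0; apply: primitive_derive; first exact: cal_slope_cont.
by apply: lt_le_trans x0; rewrite ltrN10.
Qed.

Lemma cal_le l x y : 0 <= x -> x <= y -> cal l x <= cal l y.
Proof.
move=> x0 xy; apply: (derive_incr (df := cal_slope l)) => // t xt _.
  exact/cal_derive/(le_trans x0).
exact: cal_slope_ge0.
Qed.

Lemma cal_lip l x y : 0 <= x -> 0 <= y -> `|cal l y - cal l x| <= `|y - x|.
Proof.
wlog xy : x y / x <= y.
  move=> H x0 y0; have [xy|/ltW yx] := leP x y; first exact: H.
  by rewrite distrC (distrC y) H.
move=> x0 y0; rewrite [leRHS]ger0_norm ?subr_ge0 // -[leRHS]mul1r.
apply: (@mvt_lipschitz _ 0 y _ (cal_slope l)) => // t t0 _.
  exact: cal_derive.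
by rewrite ger0_norm ?cal_slope_ge0 // cal_slope_le1.
Qed.

Lemma cal_ge0 l x : 0 <= x -> 0 <= cal l x.
Proof. by move=> x0; rewrite -(cal0 l) cal_le. Qed.

Lemma cal_lex l x : 0 <= x -> cal l x <= x.
Proof.
move=> x0; have := cal_lip l (lexx 0) x0; rewrite cal0 !subr0.
by rewrite (ger0_norm x0) ger0_norm // cal_ge0.
Qed.

Definition om l := Num.sqrt (`|l ^+ 2 - 1|).
(** For [l > 1], the turning time: [snl l] attains its maximum [(om l)^-1] there and vanishes again
    at twice this time. The period halved is that of [|snl l|]. *)
Definition half_period l := pi / (2 * om l).

(* [S = snl l] and [C = csl l] solve [S' = C], [C' = (1 - l^2) S], [S 0 = 0], [C 0 = 1];
   [snl l t] is [|z2|] at time [t] along the geodesic of charge [l] from the identity, and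
   [arcK l t] below is the argument of [z1]. *)
Definition snl l t :=
  if 1 < l then sin (om l * t) / om l
  else if l == 1 then t else (expR (om l * t) - expR (- (om l * t))) / (2 * om l).
Definition csl l t :=
  if 1 < l then cos (om l * t)
  else if l == 1 then 1 else (expR (om l * t) + expR (- (om l * t))) / 2.

Lemma om_gt1 l : 1 < l -> 0 < om l /\ om l ^+ 2 = l ^+ 2 - 1.
Proof.
move=> l1; have h : 0 < l ^+ 2 - 1 by rewrite subr_gt0 expr_gt1 // ltW // (lt_trans _ l1).
by rewrite /om gtr0_norm // sqr_sqrtr ?ltW // sqrtr_gt0.
Qed.

Lemma om_lt1 l : 0 <= l -> l < 1 -> 0 < om l /\ om l ^+ 2 = 1 - l ^+ 2.
Proof.
move=> l0 l1; have h : l ^+ 2 - 1 < 0 by rewrite subr_lt0 expr_lt1.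
have h' : 0 < 1 - l ^+ 2 by lra.
by rewrite /om ltr0_norm // opprB sqr_sqrtr ?(ltW h') // sqrtr_gt0.
Qed.

Lemma half_period_gt0 l : 1 < l -> 0 < half_period l.
Proof. by move=> /om_gt1[w0 _]; rewrite divr_gt0 ?pi_gt0 // mulr_gt0. Qed.

Lemma snlE_gt l : 1 < l -> snl l = (fun t => sin (om l * t) / om l) /\
  csl l = (fun t => cos (om l * t)).
Proof. by move=> l1; split; apply/funext => t; rewrite /snl /csl l1. Qed.

Lemma snlE_lt l : l < 1 ->
  snl l = (fun t => (expR (om l * t) - expR (- (om l * t))) / (2 * om l)) /\
  csl l = (fun t => (expR (om l * t) + expR (- (om l * t))) / 2).
Proof. by move=> l1; split; apply/funext => t; rewrite /snl /csl; case: (ltgtP l 1) l1. Qed.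

Lemma snlE_eq : snl 1 = (fun t => t) /\ csl 1 = (fun t => 1).
Proof. by split; apply/funext => t; rewrite /snl /csl ltxx eqxx. Qed.

Lemma snl_derive l t : 0 <= l -> is_derive t 1 (snl l) (csl l t).
Proof.
move=> l0; have [l1|l1|->] := ltgtP l 1.
- have [w0 w2] := om_lt1 l0 l1; have [-> ->] := snlE_lt l1.
  der; first by rewrite gt_eqF // mulr_gt0.
 by field; rewrite gt_eqF.
- have [w0 w2] := om_gt1 l1; have [-> ->] := snlE_gt l1.
  by der; [rewrite gt_eqF|field; rewrite gt_eqF].
- by have [-> ->] := snlE_eq; exact: drv_id.
Qed.

Lemma csl_derive l t : 0 <= l -> is_derive t 1 (csl l) ((1 - l ^+ 2) * snl l t).
Proof.
move=> l0; have [l1|l1|->] := ltgtP l 1.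
- have [w0 w2] := om_lt1 l0 l1; rewrite -w2; have [-> ->] := snlE_lt l1.
  by der; field; rewrite gt_eqF.
- have [w0 w2] := om_gt1 l1; rewrite -opprB -w2; have [-> ->] := snlE_gt l1.
  by der; field; rewrite gt_eqF.
- have [-> ->] := snlE_eq.
  by apply: is_derive_eq (drv_cst t 1) _; rewrite expr1n subrr mul0r.
Qed.

Lemma snl0 l : snl l 0 = 0.
Proof. by rewrite /snl mulr0 sin0 oppr0 subrr !mul0r; do !case: ifP. Qed.

Lemma csl0 l : csl l 0 = 1.
Proof.
rewrite /csl mulr0 cos0 oppr0 expR0; case: ifP => //; case: ifP => // _ _.
by field.
Qed.

Lemma csl2 l t : 0 <= l -> csl l t ^+ 2 = 1 + (1 - l ^+ 2) * snl l t ^+ 2.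
Proof.
move=> l0; rewrite /snl /csl; case: (ltgtP l 1) => [l1|l1|->].
- have [w0 w2] := om_lt1 l0 l1; rewrite -w2 expRN.
  by field; rewrite ?gt_eqF ?expR_gt0.
- have [w0 w2] := om_gt1 l1; rewrite -opprB -w2 cos2sin2.
  by field; rewrite gt_eqF.
- by rewrite expr1n subrr mul0r addr0.
Qed.

Lemma csl_gt0 l t : 0 <= l -> 0 <= t -> (1 < l -> t < half_period l) -> 0 < csl l t.
Proof.
move=> l0 t0; rewrite /csl; case: (ltgtP l 1) => [l1|l1|->] // th.
- by rewrite divr_gt0 // addr_gt0 // expR_gt0.
- have [w0 w2] := om_gt1 l1; have {}th := th isT.
  apply: cos_gt0_pihalf; apply/andP; split.
    by apply: lt_le_trans (_ : 0 <= _); rewrite ?oppr_lt0 ?divr_gt0 ?pi_gt0 // mulr_ge0 // ltW.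
  move: th; rewrite /half_period ltr_pdivlMr ?mulr_gt0 // => th.
  by rewrite ltr_pdivlMr //; lra.
Qed.

Lemma csl_ge0 l t : 0 <= l -> 0 <= t -> (1 < l -> t <= half_period l) -> 0 <= csl l t.
Proof.
move=> l0 t0; rewrite /csl; case: (ltgtP l 1) => [l1|l1|->] // th.
have [w0 w2] := om_gt1 l1; have {}th := th isT.
  apply: cos_ge0_pihalf; apply/andP; split.
    by apply: le_trans (_ : 0 <= _); rewrite ?oppr_le0 ?divr_ge0 ?pi_ge0 // mulr_ge0 // ltW.
  move: th; rewrite /half_period ler_pdivlMr ?mulr_gt0 // => th.
  by rewrite ler_pdivlMr //; lra.
Qed.

Lemma snl_gt0 l t : 0 <= l -> 0 < t -> (1 < l -> t < half_period l *+ 2) -> 0 < snl l t.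
Proof.
move=> l0 t0; rewrite /snl; case: (ltgtP l 1) => [l1|l1|->] // th.
- have [w0 w2] := om_lt1 l0 l1.
  rewrite divr_gt0 ?mulr_gt0 // subr_gt0 ltr_expR.
  by have : 0 < om l * t by [rewrite mulr_gt0]; lra.
- have [w0 w2] := om_gt1 l1; have {}th := th isT.
  rewrite divr_gt0 // sin_gt0_pi // mulr_gt0 //=.
  move: th; rewrite /half_period -mulr_natr.
  have -> : pi / (2 * om l) * 2 = pi / om l by field; rewrite gt_eqF.
  by rewrite ltr_pdivlMr // mulrC.
Qed.

Lemma snl_ge0 l t : 0 <= l -> 0 <= t -> (1 < l -> t <= half_period l *+ 2) -> 0 <= snl l t.
Proof.
move=> l0 t0; rewrite /snl; case: (ltgtP l 1) => [l1|l1|->] // th.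
- have [w0 w2] := om_lt1 l0 l1.
  rewrite divr_ge0 ?mulr_ge0 ?(ltW w0) // subr_ge0 ler_expR.
  by have : 0 <= om l * t by [rewrite mulr_ge0 // ltW]; lra.
- have [w0 w2] := om_gt1 l1; have {}th := th isT.
  rewrite divr_ge0 ?(ltW w0) // sin_ge0_pi // mulr_ge0 ?(ltW w0) //=.
  move: th; rewrite /half_period -mulr_natr.
  have -> : pi / (2 * om l) * 2 = pi / om l by field; rewrite gt_eqF.
  by rewrite ler_pdivlMr // mulrC.
Qed.

Lemma snl_le l x y : 0 <= l -> 0 <= x -> x <= y -> (1 < l -> y <= half_period l) ->
  snl l x <= snl l y.
Proof.
move=> l0 x0 xy yh; apply: (derive_incr (df := csl l)) => // t xt ty.
  exact: snl_derive.
apply: csl_ge0 => //; first exact: le_trans xt.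
by move=> /yh; apply: le_trans.
Qed.

Lemma snl_lt l x y : 0 <= l -> 0 <= x -> x < y -> (1 < l -> y <= half_period l) ->
  snl l x < snl l y.
Proof.
move=> l0 x0 xy yh.
have [||c] := @MVT _ (snl l) (csl l) x y xy.
- by move=> z _; apply: snl_derive.
- apply: derivable_within_continuous => z _.
  by have /@ex_derive := snl_derive z l0.
rewrite in_itv /= => /andP[xc cy] h.
rewrite -subr_gt0 h mulr_gt0 ?subr_gt0 // csl_gt0 //.
  exact: ltW (le_lt_trans x0 xc).
by move=> /yh; apply: lt_le_trans.
Qed.

Lemma snl_inj l x y : 0 <= l -> 0 <= x -> 0 <= y -> (1 < l -> x <= half_period l) ->
  (1 < l -> y <= half_period l) -> snl l x = snl l y -> x = y.
Proof.
move=> l0 x0 y0 xh yh sxy; case: (ltgtP x y) => // [xy|yx].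
  by have := snl_lt l0 x0 xy yh; rewrite sxy ltxx.
by have := snl_lt l0 y0 yx xh; rewrite sxy ltxx.
Qed.

Lemma snl_cont l : 0 <= l -> continuous (snl l).
Proof.
move=> l0 x; apply: differentiable_continuous; apply/derivable1_diffP.
by have /@ex_derive := snl_derive x l0.
Qed.

Lemma half_om l : 1 < l -> om l * half_period l = pi / 2.
Proof. by move=> /om_gt1[w0 _]; rewrite /half_period; field; rewrite gt_eqF. Qed.

Lemma snl_half l : 1 < l -> snl l (half_period l) = (om l)^-1.
Proof. by move=> l1; rewrite /snl l1 half_om // sin_pihalf mul1r. Qed.

Lemma csl_half l : 1 < l -> csl l (half_period l) = 0.
Proof. by move=> l1; rewrite /csl l1 half_om // cos_pihalf. Qed.

Lemma snl_refl l t : 1 < l -> snl l (half_period l *+ 2 - t) = snl l t.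
Proof.
move=> l1; rewrite /snl l1 mulrBr mulrnAr half_om // -mulr_natr divfK ?pnatr_eq0 //.
by rewrite sinB sinpi cospi mul0r sub0r mulN1r opprK.
Qed.

Lemma snl_onto l r : 0 <= l -> 0 <= r -> (1 < l -> r <= (om l)^-1) ->
  exists t, [/\ 0 <= t, (1 < l -> t <= half_period l) & snl l t = r].
Proof.
move=> l0 r0 rl.
pose T := if 1 < l then half_period l else r.
have T0 : 0 <= T by rewrite /T; case: ifP => // l1; rewrite ltW // half_period_gt0.
have rT : r <= snl l T.
  rewrite /T; case: ifP => l1; first by rewrite snl_half // rl.
  (* For [l <= 1] the slope [csl l] is at least 1, so time [r] is enough to reach radius [r]. *)
  suff : snl l 0 - 0 <= snl l r - r by rewrite snl0 subr0 subr_ge0.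
  apply: (@derive_incr _ (fun x => snl l x - x) (fun x => csl l x - 1)) => // t t0 tr.
    by have h := snl_derive t l0; der.
  rewrite subr_ge0 -[leRHS]ger0_norm; last by apply: csl_ge0 => //; rewrite l1.
  rewrite -sqrtr_sqr -[leLHS]sqrtr1 ler_sqrt ?sqr_ge0 // csl2 // lerDl.
  by rewrite mulr_ge0 ?sqr_ge0 // subr_ge0 expr_le1 // leNgt l1.
have [||t] := @IVT _ (snl l) 0 T r T0.
- exact/continuous_subspaceT/snl_cont.
- by rewrite snl0 ge_min r0 /= le_max rT orbT.
rewrite in_itv /= => /andP[t0 tT] tr; exists t; split => //.
by move=> l1; move: tT; rewrite /T l1.
Qed.

Definition arcK_slope l t := l * snl l t ^+ 2 / (1 + snl l t ^+ 2).
Definition arcK l := primitive (arcK_slope l).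

Lemma arcK0 l : arcK l 0 = 0. Proof. exact: primitive0. Qed.

Lemma arcK_derive l t : 0 <= l -> 0 <= t -> is_derive t 1 (arcK l) (arcK_slope l t).
Proof.
move=> l0 t0; apply: primitive_derive; last by apply: lt_le_trans t0; rewrite ltrN10.
move=> x; have s : snl l y @[y --> x] --> snl l x by exact: snl_cont.
apply: cvgM; last first.
  apply: cvgV; first by rewrite gt_eqF // oneDx_gt0.
  apply: cvgD; first exact: cvg_cst.
  by rewrite expr2; under eq_fun do rewrite expr2; apply: cvgM.
apply: cvgM; first exact: cvg_cst.
by rewrite expr2; under eq_fun do rewrite expr2; apply: cvgM.
Qed.

Lemma arcK_slope_ge0 l t : 0 <= l -> 0 <= arcK_slope l t.
Proof. by move=> l0; rewrite divr_ge0 ?(ltW (oneDx_gt0 _)) // mulr_ge0 // sqr_ge0. Qed.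

Lemma arcK_le l x y : 0 <= l -> 0 <= x -> x <= y -> arcK l x <= arcK l y.
Proof.
move=> l0 x0 xy; apply: (derive_incr (df := arcK_slope l)) => // t xt ty.
  by apply: arcK_derive => //; apply: le_trans xt.
exact: arcK_slope_ge0.
Qed.

(** Along the arc [z1 = exp (i l t) (csl - i l snl)], of squared modulus [1 + snl^2]; this is its
    argument as long as [csl > 0]. *)
Lemma arcK_atan l t : 0 <= l -> 0 <= t -> (1 < l -> t < half_period l) ->
  arcK l t = l * t - atan (l * snl l t / csl l t).
Proof.
move=> l0 t0 th.
pose g t := l * t - atan (l * snl l t / csl l t); rewrite -/(g t).
apply: (@derive_eq R (arcK l) g 0 t (arcK_slope l)); first exact: t0.
- by rewrite /g arcK0 snl0 !mulr0 mul0r atan0 subrr.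
- by move=> x x0 _; apply: arcK_derive.
move=> x x0 xt; have c0 : 0 < csl l x.
  by apply: csl_gt0 => // /th; apply: le_lt_trans.
have s' := snl_derive x l0; have c' := csl_derive x l0.
have c2 := csl2 x l0; have p := oneDx_gt0 (snl l x).
have cn : csl l x != 0 by rewrite gt_eqF.
rewrite /g; der.
rewrite /arcK_slope.
have -> : (1 + (l * snl l x / csl l x) ^+ 2)^-1 = csl l x ^+ 2 / (1 + snl l x ^+ 2).
  have -> : 1 + (l * snl l x / csl l x) ^+ 2 = (1 + snl l x ^+ 2) / csl l x ^+ 2.
    apply: (mulIf (expf_neq0 2 cn)); rewrite divfK ?expf_neq0 // mulrDl expr_div_n divfK
        ?expf_neq0 //.
    by rewrite c2; ring.
  by rewrite invf_div.
have -> : (0 * snl l x + l * csl l x) / csl l x + l * snl l x * (- ((1 - l ^+ 2) * snl l x) /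
    csl l x ^+ 2) = l * (csl l x ^+ 2 - (1 - l ^+ 2) * snl l x ^+ 2) / csl l x ^+ 2 by field.
rewrite c2 addrK; field; rewrite gt_eqF //=; apply/eqP => h; move: c2 (sqr_ge0 (csl l x));
    rewrite h.
by move/eqP; rewrite expf_eq0 (negbTE cn).
Qed.

Lemma atanV_gt0 x : 0 < x -> atan x = pi / 2 - atan x^-1.
Proof.
move=> x0; have y0 : 0 < atan x^-1 by rewrite -(@atan0 R) lt_atan // invr_gt0.
have y1 := atan_ltpi2 x^-1; have p0 := pi_gt0 R.
have e : tan (pi / 2 - atan x^-1) = (tan (atan x^-1))^-1.
  by rewrite /tan addrC sinDpihalf cosDpihalf sinN cosN opprK invf_div.
rewrite atanK invrK in e.
by rewrite -[in LHS]e tanK // in_itv /=; apply/andP; split; lra.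
Qed.

(** The same argument through the inverse quotient. As [snl] does not vanish inside the period, this
    form passes the turning point, where [csl = 0] and [arcK_atan] stops. *)
Lemma arcK_atanV l t : 0 < l -> 0 < t -> (1 < l -> t < half_period l *+ 2) ->
  arcK l t = l * t - pi / 2 + atan (csl l t / (l * snl l t)).
Proof.
move=> lp t0 th; have l0 := ltW lp.
(* A time at which both closed forms apply, to start the comparison of derivatives. *)
pose u := if 1 < l then Num.min t (half_period l / 2) else t.
have u0 : 0 < u.
  by rewrite /u; case: ifP => // l1; rewrite lt_min t0 divr_gt0 // half_period_gt0.
have ut : u <= t by rewrite /u; case: ifP => // l1; rewrite ge_min lexx.
have uh : 1 < l -> u < half_period l.
  move=> l1; rewrite /u l1 gt_min; apply/orP; right.
  by have := half_period_gt0 l1; lra.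
have snp x : u <= x -> x <= t -> 0 < snl l x.
  by move=> ux xt; apply: snl_gt0 => //; [exact: lt_le_trans ux|move=> /th; apply: le_lt_trans].
pose g t := l * t - pi / 2 + atan (csl l t / (l * snl l t)); rewrite -/(g t).
apply: (@derive_eq R (arcK l) g u t (arcK_slope l)); first exact: ut.
- rewrite /g arcK_atan // ?ltW // atanV_gt0; last first.
    by rewrite divr_gt0 ?mulr_gt0 ?snp // csl_gt0 // ltW.
  by rewrite invf_div opprD opprK addrA.
- by move=> x ux _; apply: arcK_derive => //; apply: ltW; apply: lt_le_trans ux.
move=> x ux xt; have s0 := snp x ux xt.
have s' := snl_derive x l0; have c' := csl_derive x l0.
have c2 := csl2 x l0; have p := oneDx_gt0 (snl l x).
have cn : l * snl l x != 0 by rewrite mulf_neq0 ?gt_eqF.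
rewrite /g; der.
rewrite /arcK_slope.
have -> : (1 + (csl l x / (l * snl l x)) ^+ 2)^-1 = (l * snl l x) ^+ 2 / (1 + snl l x ^+ 2).
  have -> : 1 + (csl l x / (l * snl l x)) ^+ 2 = (1 + snl l x ^+ 2) / (l * snl l x) ^+ 2.
    apply: (mulIf (expf_neq0 2 cn)); rewrite divfK ?expf_neq0 // mulrDl expr_div_n divfK
        ?expf_neq0 //.
    by rewrite c2; ring.
  by rewrite invf_div.
have -> : (1 - l ^+ 2) * snl l x / (l * snl l x) + csl l x * (- (0 * snl l x + l * csl l x) / (l
    * snl l x) ^+ 2) = ((1 - l ^+ 2) * snl l x ^+ 2 - csl l x ^+ 2) * l / (l * snl l x) ^+ 2.
  by field; rewrite ?gt_eqF.
by rewrite c2; field; rewrite ?(gt_eqF p) ?(gt_eqF s0) ?(gt_eqF lp).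
Qed.

Lemma arcK_half l : 1 < l -> arcK l (half_period l) = l * half_period l - pi / 2.
Proof.
move=> l1; have l0 : 0 < l by exact: lt_trans l1.
have h0 := half_period_gt0 l1.
rewrite arcK_atanV // ?csl_half // ?mul0r ?atan0 ?addr0 // => _.
by rewrite mulr2n ltrDl.
Qed.

Lemma arcK_refl l t : 1 < l -> 0 <= t -> t <= half_period l *+ 2 ->
  arcK l (half_period l *+ 2 - t) = arcK l (half_period l) *+ 2 - arcK l t.
Proof.
move=> l1 t0 th; have l0 : 0 <= l by apply/ltW/lt_trans/l1.
have h0 := half_period_gt0 l1.
pose g x := arcK l (half_period l *+ 2 - x) + arcK l x.
have g' x : 0 <= x -> x <= half_period l *+ 2 -> is_derive x 1 g 0.
  move=> x0 xh; have d1 := arcK_derive l0 x0.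
  have d2 : is_derive (half_period l *+ 2 - x) 1 (arcK l) (arcK_slope l (half_period l *+ 2 - x)).
    by apply: arcK_derive => //; rewrite subr_ge0.
  have d3 : is_derive x 1 (fun x => half_period l *+ 2 - x) (-1).
    by der; rewrite sub0r.
  have d4 := @drv_comp R x (arcK l) (fun x => half_period l *+ 2 - x) _ _ d2 d3.
  apply: is_derive_eq (drv_add d4 d1) _.
  by rewrite /arcK_slope snl_refl // mulrN1 addNr.
suff : g t = g (half_period l) by rewrite /g (_ : _ - half_period l = half_period l) ?mulr2n
    ?addrK // => <-; rewrite addrK.
have [thl|/ltW htl] := leP t (half_period l).
  apply: (@derive_const R g) => [//|x tx xh]; apply: g'; first exact: le_trans tx.
  by apply: le_trans xh _; rewrite mulr2n lerDl ltW.
apply/esym; apply: (@derive_const R g) => [//|x hx xt]; apply: g'; last exact: le_trans th.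
by apply: le_trans hx; apply: ltW.
Qed.

Lemma arcK_full l : 1 < l -> arcK l (half_period l *+ 2) = arcK l (half_period l) *+ 2.
Proof.
move=> l1; have h0 := ltW (half_period_gt0 l1).
by have := arcK_refl l1 (lexx 0); rewrite subr0 arcK0 subr0 => ->; rewrite ?mulrn_wge0.
Qed.

Lemma cal_slope_snl l m t : 0 <= l ->
  cal_slope m (snl l t) = Num.sqrt (Num.max 0 (csl l t ^+ 2 - (m ^+ 2 - l ^+ 2) * snl l t ^+ 2))
      / (1 + snl l t ^+ 2).
Proof.
by move=> l0; rewrite /cal_slope csl2 //; congr (Num.sqrt (Num.max _ _) / _); ring.
Qed.

Lemma cal_slope_arc l t : 0 <= l -> 0 <= csl l t ->
  cal_slope l (snl l t) = csl l t / (1 + snl l t ^+ 2).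
Proof.
move=> l0 c0; rewrite cal_slope_snl // subrr mul0r subr0.
by rewrite (max_idPr (sqr_ge0 _)) sqrtr_sqr ger0_norm.
Qed.

(** The calibration of charge [l] is tight on the rising arc of the same charge. Past the turning
    point [csl] is negative while the slope of [cal] is not. *)
Lemma cal_arc l t : 0 <= l -> 0 <= t -> (1 < l -> t <= half_period l) ->
  cal l (snl l t) = t - l * arcK l t.
Proof.
move=> l0 t0 th.
pose g x := x - l * arcK l x; rewrite -/(g t).
apply: (@derive_eq R (fun x => cal l (snl l x)) g 0 t (fun x => cal_slope l (snl l x) * csl l x)).
- exact: t0.
- by rewrite /g snl0 cal0 arcK0 mulr0 subr0.
- move=> x x0 xt; apply: drv_comp (snl_derive _ l0); apply: cal_derive.
  apply: snl_ge0 => // l1; apply: le_trans xt _; apply: le_trans (th l1) _.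
  by rewrite mulr2n lerDl ltW // half_period_gt0.
move=> x x0 xt; have d1 := arcK_derive l0 x0.
have c0 : 0 <= csl l x by apply: csl_ge0 => // l1; apply: le_trans (th l1).
rewrite /g; der; rewrite cal_slope_arc //.
rewrite /arcK_slope mul0r add0r; have := csl2 x l0; have := oneDx_gt0 (snl l x).
move=> p c2; have -> : csl l x / (1 + snl l x ^+ 2) * csl l x = csl l x ^+ 2 / (1 + snl l x ^+
    2) by ring.
by rewrite c2; field; rewrite gt_eqF.
Qed.

Lemma cal_top l : 1 < l -> cal l (om l)^-1 = pi / 2 * (l - om l).
Proof.
move=> l1; have l0 : 0 <= l by apply/ltW/lt_trans/l1.
have h0 := ltW (half_period_gt0 l1).
rewrite -snl_half // cal_arc // arcK_half //; have [w0 w2] := om_gt1 l1.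
have hE : half_period l = pi / 2 / om l by rewrite -(half_om l1); field; rewrite gt_eqF.
have -> : half_period l - l * (l * half_period l - pi / 2) = - (l ^+ 2 - 1) * half_period l + l
    * (pi / 2) by ring.
by rewrite -w2 hE; field; rewrite gt_eqF.
Qed.

Lemma csl_lb l T t : 0 <= l -> 0 <= t -> t <= T -> (1 < l -> T <= half_period l) ->
  Num.min 1 (csl l T ^+ 2) <= csl l t ^+ 2.
Proof.
move=> l0 t0 tT Th; rewrite ge_min; have [l1|l1] := leP l 1.
  by apply/orP; left; rewrite csl2 // lerDl mulr_ge0 ?sqr_ge0 // subr_ge0 expr_le1.
apply/orP; right; rewrite !csl2 // lerD2l ler_wnM2l //.
  by rewrite subr_le0 expr_ge1 // ltW.
rewrite ler_sqr ?nnegrE.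
- by apply: snl_le.
- apply: snl_ge0 => // _; apply: le_trans tT (le_trans (Th l1) _).
  by rewrite mulr2n lerDl ltW // half_period_gt0.
- apply: snl_ge0 => //; first exact: le_trans tT.
  by move=> _; apply: le_trans (Th l1) _; rewrite mulr2n lerDl ltW // half_period_gt0.
Qed.

(** [C] is [csl l] and [A] its counterpart for charge [m]. Writing
    [C A = (C^2 + A^2 - (C - A)^2) / 2] cancels the terms linear in [m - l]. The term [(C - A)^2] is
    quadratic as well, since [(C - A)(C + A) = (m^2 - l^2) S2] and [C + A] is bounded below by
    [C]. *)
Lemma perturb_bound (l m C A S2 M C02 : R) : 0 <= l -> `|m - l| <= 1 ->
  0 < C -> 0 <= A -> 0 < C02 -> C02 <= C ^+ 2 -> 0 <= S2 -> S2 <= M ->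
  A ^+ 2 = C ^+ 2 - (m ^+ 2 - l ^+ 2) * S2 ->
  `|(C * A - C ^+ 2 + (m - l) * l * S2) / (1 + S2)| <=
    (M / 2 + (2 * l + 1) ^+ 2 * M ^+ 2 / (2 * C02)) * (m - l) ^+ 2.
Proof.
move=> l0 ml C0 A0 C020 CC S0 SM A2.
have p : 0 < 1 + S2 by lra.
have N0 : 0 <= ((m - l) ^+ 2 * S2 + (C - A) ^+ 2) / 2.
  apply: divr_ge0 => //; apply: addr_ge0; last exact: sqr_ge0.
  by apply: mulr_ge0 => //; exact: sqr_ge0.
have e : C * A - C ^+ 2 + (m - l) * l * S2 = - ((m - l) ^+ 2 * S2 + (C - A) ^+ 2) / 2.
  rewrite (_ : (C - A) ^+ 2 = C ^+ 2 + A ^+ 2 - 2 * C * A); last by ring.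
  by rewrite A2; field.
rewrite e normrM mulNr normrN [X in X * _]ger0_norm //.
rewrite [X in _ * X]ger0_norm ?invr_ge0 ?(ltW p) //.
apply: (@le_trans _ _ (((m - l) ^+ 2 * S2 + (C - A) ^+ 2) / 2)).
  by rewrite ler_pdivrMr // ler_peMr //; lra.
have CA : (C - A) ^+ 2 <= (m - l) ^+ 2 * ((2 * l + 1) ^+ 2 * M ^+ 2 / C02).
  rewrite mulrA ler_pdivlMr //.
  apply: (@le_trans _ _ ((C - A) ^+ 2 * (C + A) ^+ 2)).
    rewrite ler_wpM2l ?sqr_ge0 //; apply: le_trans CC _.
    by rewrite ler_sqr ?nnegrE ?addr_ge0 ?(ltW C0) // lerDl.
  rewrite -exprMn (_ : (C - A) * (C + A) = (m - l) * ((m + l) * S2)); last first.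
    by rewrite -subr_sqr A2; ring.
  rewrite exprMn ler_wpM2l ?sqr_ge0 // -exprMn -ler_sqrt ?sqr_ge0 // !sqrtr_sqr.
  rewrite !normrM (ger0_norm S0) (ger0_norm (le_trans S0 SM)).
  apply: ler_pM => //; rewrite [leRHS]ger0_norm; last by lra.
  by move: ml; rewrite ler_norml => /andP[m1 m2]; rewrite ler_norml; lra.
have S2M := ler_wpM2l (sqr_ge0 (m - l)) SM.
rewrite (_ : _ * (m - l) ^+ 2 = ((m - l) ^+ 2 * M + (m - l) ^+ 2 * ((2 * l + 1) ^+ 2 * M ^+ 2 /
    C02)) / 2).
  by lra.
by field; rewrite gt_eqF.
Qed.

(** The derivative of [cal m (snl l t)] in [m] at [m = l] is [- arcK l t], with a quadratic
    remainder uniform on [[0, T]]. Stopping before the turning point keeps [csl l] away from 0 and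
    makes nearby charges valid. *)
Lemma cal_perturb l T : 0 <= l -> 0 <= T -> (1 < l -> T < half_period l) ->
  exists2 d, 0 < d & exists K, forall m, `|m - l| <= d -> forall t, 0 <= t -> t <= T ->
    0 <= 1 + (1 - m ^+ 2) * snl l t ^+ 2 /\
    `|cal m (snl l t) - cal l (snl l t) + (m - l) * arcK l t| <= K * (m - l) ^+ 2.
Proof.
move=> l0 T0 Th.
pose C02 := Num.min 1 (csl l T ^+ 2); pose M := snl l T ^+ 2.
have C020 : 0 < C02 by rewrite lt_min ltr01 exprn_gt0 // csl_gt0.
have M0 : 0 <= M by exact: sqr_ge0.
(* [B] bounds [|m + l| snl^2] when [|m - l| <= 1], so [|m - l| <= C02 / B] keeps the radicand of
   charge [m] nonnegative. *)
pose B := (2 * l + 1) * (M + 1).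
have B0 : 0 < B by rewrite mulr_gt0 // ltr_wpDl // mulr_ge0.
pose K1 := M / 2 + (2 * l + 1) ^+ 2 * M ^+ 2 / (2 * C02).
have K10 : 0 <= K1.
  apply: addr_ge0; first exact: divr_ge0.
  apply: divr_ge0; last by apply: mulr_ge0 => //; exact: ltW.
  by apply: mulr_ge0; exact: sqr_ge0.
exists (Num.min 1 (C02 / B)); first by rewrite lt_min ltr01 divr_gt0.
exists (K1 * T) => m; rewrite le_min => /andP[m1 mB] t t0 tT.
have S x : 0 <= x -> x <= T -> 0 <= snl l x.
  move=> x0 xT; apply: snl_ge0 => // l1; apply: le_trans xT (le_trans (ltW (Th l1)) _).
  by rewrite mulr2n lerDl ltW // half_period_gt0.
have SM x : 0 <= x -> x <= T -> snl l x ^+ 2 <= M.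
  move=> x0 xT; rewrite ler_sqr ?nnegrE ?S //; apply: snl_le => //.
  by move=> /Th /ltW.
have A0 x : 0 <= x -> x <= T -> 0 <= csl l x ^+ 2 - (m ^+ 2 - l ^+ 2) * snl l x ^+ 2.
  move=> x0 xT; rewrite subr_ge0.
  have CC : C02 <= csl l x ^+ 2 by apply: csl_lb => // /Th /ltW.
  apply: le_trans CC; apply: le_trans (ler_norm _) _.
  rewrite normrM subr_sqr normrM [X in _ * X]ger0_norm ?sqr_ge0 //.
  have h : `|m + l| <= 2 * l + 1.
    by move: m1; rewrite !ler_norml => /andP[a1 a2]; lra.
  rewrite -mulrA; apply: le_trans (_ : C02 / B * B <= _); last by rewrite divfK ?gt_eqF.
  apply: ler_pM => //; first by rewrite mulr_ge0 ?sqr_ge0.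
  apply: ler_pM => //; first exact: sqr_ge0.
  by apply: le_trans (SM _ x0 xT) _; rewrite lerDl.
split.
  have := A0 _ t0 tT; rewrite csl2 //; congr (0 <= _); ring.
pose E x := cal m (snl l x) - cal l (snl l x) + (m - l) * arcK l x.
have E0 : E 0 = 0 by rewrite /E snl0 !cal0 arcK0 mulr0 subrr addr0.
rewrite -/(E t) -[E t]subr0 -E0.
apply: (@le_trans _ _ (K1 * (m - l) ^+ 2 * (t - 0))); last first.
  by rewrite subr0 mulrAC ler_wpM2r ?sqr_ge0 // ler_wpM2l.
pose dE x := cal_slope m (snl l x) * csl l x - cal_slope l (snl l x) * csl l x + (m - l) *
    arcK_slope l x.
apply: (@mvt_lipschitz _ 0 T E dE) => // x x0 xT.
  have d1 := snl_derive x l0; have d2 := arcK_derive l0 x0.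
  have d3 := drv_comp (cal_derive m (S _ x0 xT)) d1.
  have d4 := drv_comp (cal_derive l (S _ x0 xT)) d1.
  apply: is_derive_eq (drv_add (drv_add d3 (drv_opp d4)) (drv_mul (drv_cst x (m - l)) d2)) _.
  by rewrite /dE mul0r add0r.
have c0 : 0 < csl l x by apply: csl_gt0 => // /Th; apply: le_lt_trans.
rewrite /dE (cal_slope_arc l0 (ltW c0)) cal_slope_snl // (max_idPr (A0 _ x0 xT)) /arcK_slope.
rewrite [X in `|X|](_ : _ = (csl l x * Num.sqrt (csl l x ^+ 2 - (m ^+ 2 - l ^+ 2) * snl l x ^+
    2) - csl l x ^+ 2 + (m - l) * l * snl l x ^+ 2) / (1 + snl l x ^+ 2)); last first.
  by field; rewrite gt_eqF // oneDx_gt0.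
apply: perturb_bound => //.
- by apply: csl_lb => // /Th /ltW.
- exact: sqr_ge0.
- exact: SM.
- by rewrite sqr_sqrtr // A0.
Qed.

(** * Continuity rules, and arcs with prescribed radius and argument *)

Lemma cnt_cst (x k : R) : {for x, continuous (fun=> k : R)}.
Proof. exact: cvg_cst. Qed.

Lemma cnt_id (x : R) : {for x, continuous (fun y : R => y)}.
Proof. exact: cvg_id. Qed.

Lemma cnt_add (f g : R -> R) x : {for x, continuous f} -> {for x, continuous g} ->
  {for x, continuous (fun y => f y + g y)}.
Proof. exact: cvgD. Qed.

Lemma cnt_opp (f : R -> R) x : {for x, continuous f} -> {for x, continuous (fun y => - f y)}.
Proof. exact: cvgN. Qed.

Lemma cnt_mul (f g : R -> R) x : {for x, continuous f} -> {for x, continuous g} ->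
  {for x, continuous (fun y => f y * g y)}.
Proof. exact: cvgM. Qed.

Lemma cnt_inv (f : R -> R) x : f x != 0 -> {for x, continuous f} ->
  {for x, continuous (fun y => (f y)^-1)}.
Proof. exact: cvgV. Qed.

Lemma cnt_sqr (f : R -> R) x : {for x, continuous f} ->
  {for x, continuous (fun y => f y ^+ 2)}.
Proof. move=> cf; have -> : (fun y => f y ^+ 2) = (fun y => f y * f y).
  by apply/funext => y; rewrite expr2.
exact: cnt_mul. Qed.

Lemma cnt_within (f : R -> R) a b :
  (forall x, a <= x -> x <= b -> {for x, continuous f}) -> {within `[a, b], continuous f}.
Proof.
move=> cf; apply: continuous_in_subspaceT => x; rewrite inE /= in_itv /= => /andP[].
exact: cf.
Qed.

Lemma cnt_comp (f g : R -> R) x : continuous g -> {for x, continuous f} ->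
  {for x, continuous (fun y => g (f y))}.
Proof. by move=> cg cf; apply: (continuous_comp cf); exact: cg. Qed.

Lemma cnt_near_gt (f : R -> R) (c b : R) : {for 0, continuous f} -> c < f 0 -> 0 < b ->
  exists2 x, 0 < x < b & c < f x.
Proof.
move=> cf cf0 b0.
have [e /= e0 eP] : \forall x \near (0 : R), c < f x by apply: cvgr_gt cf _ cf0.
exists (Num.min (e / 2) (b / 2)).
  by rewrite lt_min !divr_gt0 //= gt_min; apply/orP; right; lra.
apply: eP; rewrite /ball_ /= sub0r normrN ger0_norm ?le_min ?divr_ge0 ?ltW //.
by rewrite gt_min; apply/orP; left; lra.
Qed.

(** Shooting with the single parameter [x = om l * t]: the condition [sinh x / om l = r] forces
    [om l = sinh x / r] and [l = y x / r], and the argument reached becomes [h x]. Its limit at 0 is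
    [r - atan r], and it vanishes at [q], where [sinh q = r]. *)
Lemma arc_exists_lt r c : 0 < r -> 0 < c -> c < r - atan r ->
  exists l t, [/\ 0 <= l, 0 < t, l < 1, snl l t = r & arcK l t = c].
Proof.
move=> r0 c0 cr.
pose sh := snl (0 : R); pose ch := csl (0 : R).
have shc : continuous sh by exact: snl_cont.
have chc : continuous ch.
  move=> x; apply: differentiable_continuous; apply/derivable1_diffP.
  by have /@ex_derive := csl_derive x (lexx (0 : R)).
have n01 : (1 < 0 :> R) = false by rewrite ltr10.
have ch2 x : ch x ^+ 2 = 1 + sh x ^+ 2 by rewrite /ch csl2 // expr0n subr0 mul1r.
have ch0 x : 0 <= x -> 0 < ch x by move=> x0; apply: csl_gt0 => //; rewrite n01.
have sh0 x : 0 < x -> 0 < sh x by move=> x0; apply: snl_gt0 => //; rewrite n01.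
have [|q [q0 _ shq]] := @snl_onto 0 r (lexx _) (ltW r0); first by rewrite n01.
rewrite -/sh in shq.
have qp : 0 < q.
  rewrite lt_def q0 andbT; apply/eqP => qq; move: shq; rewrite qq /sh snl0 => rr.
  by move: r0; rewrite -rr ltxx.
pose y x := Num.sqrt (r ^+ 2 - sh x ^+ 2).
have yc x : {for x, continuous y}.
  apply: cnt_comp; first exact: sqrt_continuous.
  apply: cnt_add; first exact: cnt_cst.
  by apply/cnt_opp/cnt_sqr; exact: shc.
(* The factor [x / sh x] of [h] has value 0 at 0 by the convention on division. [b] has the intended
   value there, is continuous, and bounds [h] from below because [sinh x <= x cosh x]. *)
pose b x := y x / ch x - atan (y x / ch x).
have bc : {for 0, continuous b}.
  have h : {for 0, continuous (fun x => y x / ch x)}.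
    apply: cnt_mul => //; apply: cnt_inv; last exact: chc.
    by rewrite gt_eqF // ch0.
  apply: cnt_add => //; apply: cnt_opp; apply: cnt_comp => //.
  by move=> z; apply: continuous_atan.
have [|x1 /andP[x10 x1q] cx1] := @cnt_near_gt b c q bc _ qp.
  by rewrite /b /y /ch csl0 /sh snl0 expr0n subr0 sqrtr_sqr gtr0_norm // divr1.
pose h x := y x * (x / sh x) - atan (y x / ch x).
have hc x : 0 < x -> {for x, continuous h}.
  move=> x0; apply: cnt_add.
    apply: cnt_mul => //; apply: cnt_mul; first exact: cnt_id.
    by apply: cnt_inv; [rewrite gt_eqF // sh0|exact: shc].
  apply: cnt_opp; apply: cnt_comp; first by move=> z; apply: continuous_atan.
  apply: cnt_mul => //; apply: cnt_inv; last exact: chc.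
  by rewrite gt_eqF // ch0 // ltW.
have hx1 : c < h x1.
  apply: lt_le_trans cx1 _; rewrite /b /h lerD2r ler_wpM2l ?sqrtr_ge0 //.
  rewrite ler_pdivlMr ?sh0 // mulrC ler_pdivrMr ?ch0 ?(ltW x10) //.
  suff : sh 0 - 0 * ch 0 >= sh x1 - x1 * ch x1 by rewrite /sh snl0 mul0r subrr subr_le0.
  rewrite -lerN2; apply: (@derive_incr R (fun x => - (sh x - x * ch x)) (fun x => x * sh x)) =>
      [|x x0 _|x x0 _].
  - exact: ltW.
  - have d1 : is_derive x 1 sh (ch x) by apply: snl_derive.
    have d2 : is_derive x 1 ch (sh x).
      by apply: is_derive_eq (csl_derive x (lexx 0)) _; rewrite expr0n subr0 mul1r.
    by der; ring.
  - by rewrite mulr_ge0 // /sh snl_ge0 // n01.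
have hq : h q = 0 by rewrite /h /y shq subrr sqrtr0 !mul0r atan0 subrr.
have [||t] := @IVT R h x1 q c (ltW x1q).
- apply: cnt_within => x xx _; apply: hc; exact: lt_le_trans xx.
- by rewrite hq ge_min (ltW c0) orbT le_max (ltW hx1).
rewrite in_itv /= => /andP[x1t tq] ht.
have t0 : 0 < t by exact: lt_le_trans x1t.
have tq' : t < q.
  rewrite lt_neqAle tq andbT; apply/eqP => tq'; move: ht; rewrite tq' hq => /esym c0'.
  by move: c0; rewrite c0' ltxx.
have sht := sh0 t t0.
have shr : sh t < r by rewrite -shq; apply: snl_lt => //; [exact: ltW|rewrite n01].
pose l := y t / r.
have y2 : y t ^+ 2 = r ^+ 2 - sh t ^+ 2.
  by rewrite sqr_sqrtr // subr_ge0 ler_sqr ?nnegrE ?ltW.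
have y0 : 0 <= y t by exact: sqrtr_ge0.
have l0 : 0 <= l by rewrite divr_ge0 // ltW.
have l2 : 1 - l ^+ 2 = (sh t / r) ^+ 2.
  by rewrite /l !expr_div_n y2; field; rewrite gt_eqF.
have l1 : l < 1.
  rewrite -[ltRHS](expr1n _ 2) -(@ltr_pXn2r _ 2) ?nnegrE //.
  by rewrite -subr_gt0 expr1n expr1n l2 exprn_gt0 // divr_gt0.
have omE : om l = sh t / r.
  rewrite /om -normrN opprB l2 ger0_norm ?sqr_ge0 // sqrtr_sqr gtr0_norm //.
  by rewrite divr_gt0.
have n1l : (1 < l) = false by rewrite ltNge ltW.
have om0 : om 0 = 1 by rewrite /om expr0n sub0r normrN normr1 sqrtr1.
have cE : csl l (t / om l) = ch t.
  have [_ ->] := snlE_lt l1; have [_ ] := snlE_lt (ltr01 : (0 : R) < 1); rewrite /ch => ->.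
  by rewrite om0 mul1r (_ : om l * (t / om l) = t) // mulrC divfK // omE gt_eqF // divr_gt0.
have sE : snl l (t / om l) = r.
  have [-> _] := snlE_lt l1; rewrite (_ : om l * (t / om l) = t); last first.
    by rewrite mulrC divfK // omE gt_eqF // divr_gt0.
  have : sh t = (expR t - expR (- t)) / 2.
    by have [] := snlE_lt (ltr01 : (0 : R) < 1); rewrite /sh => -> _; rewrite om0 mul1r mulr1.
  move=> E; have -> : (expR t - expR (- t)) / (2 * om l) = sh t / om l.
    by rewrite E; field; rewrite omE gt_eqF // divr_gt0.
  by rewrite omE; field; rewrite !gt_eqF.
exists l, (t / om l); split => //; first by rewrite omE !divr_gt0.
rewrite arcK_atan ?n1l //; last by rewrite ltW // omE !divr_gt0.
rewrite sE cE -ht /h /l omE divfK ?gt_eqF //; congr (_ - _).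
by field; rewrite !gt_eqF.
Qed.

(** Shooting as for [l < 1], with [om l = sin x / r] and [l = y x / r] for [0 < x < pi]. The
    argument [h x] tends to [r - atan r] at 0 and is unbounded near [pi]; [- b] replaces it near 0,
    as [sin x >= x cos x]. *)
Lemma arc_exists_gt r c : 0 < r -> 0 <= c -> r - atan r < c ->
  exists l t, [/\ 1 < l, 0 < t, t <= half_period l *+ 2, snl l t = r & arcK l t = c].
Proof.
move=> r0 c0 cr; have p0 := pi_gt0 R.
pose y x := Num.sqrt (r ^+ 2 + sin x ^+ 2).
have r2 : 0 < r ^+ 2 by exact: exprn_gt0.
have yp x : r <= y x.
  by rewrite -[leLHS](gtr0_norm r0) -sqrtr_sqr ler_sqrt ?addr_ge0 ?sqr_ge0 // lerDl sqr_ge0.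
have y0 x : 0 < y x by exact: lt_le_trans (yp x).
have yc x : {for x, continuous y}.
  apply: cnt_comp; first exact: sqrt_continuous.
  apply: cnt_add; first exact: cnt_cst.
  by apply/cnt_sqr; exact: continuous_sin.
have qc x : {for x, continuous (fun x => atan (cos x / y x))}.
  apply: cnt_comp; first by move=> z; apply: continuous_atan.
  apply: cnt_mul; first exact: continuous_cos.
  by apply: cnt_inv => //; rewrite gt_eqF.
pose b x := - (y x / cos x - pi / 2 + atan (cos x / y x)).
have bc : {for 0, continuous b}.
  apply: cnt_opp; apply: cnt_add => //; apply: cnt_add; last exact: cnt_cst.
  apply: cnt_mul => //; apply: cnt_inv; last exact: continuous_cos.
  by rewrite cos0 oner_eq0.
have b0 : - c < b 0.
  rewrite /b cos0 /y sin0 expr0n addr0 sqrtr_sqr gtr0_norm // ltrN2 divr1 div1r.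
  by have := atanV_gt0 r0; lra.
have ph : 0 < (pi : R) / 2 by lra.
have [x1 /andP[x10 x1q] cx1] := cnt_near_gt bc b0 ph.
pose h x := y x * (x / sin x) - pi / 2 + atan (cos x / y x).
have hc x : 0 < x -> x < pi -> {for x, continuous h}.
  move=> x0 xp; apply: cnt_add => //; apply: cnt_add; last exact: cnt_cst.
  apply: cnt_mul => //; apply: cnt_mul; first exact: cnt_id.
  by apply: cnt_inv; [rewrite gt_eqF // sin_gt0_pi // x0|exact: continuous_sin].
have x1p : x1 < pi by lra.
have s1 : 0 < sin x1 by rewrite sin_gt0_pi // x10.
have hx1 : h x1 < c.
  rewrite -ltrN2; apply: lt_le_trans cx1 _; rewrite /b /h lerN2 !lerD2r.
  rewrite ler_wpM2l ?(ltW (y0 _)) //.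
  have co : 0 < cos x1 by rewrite cos_gt0_pihalf //; apply/andP; split; lra.
  rewrite ler_pdivrMr // mulrC ler_pdivlMr //.
  suff : sin 0 - 0 * cos 0 <= sin x1 - x1 * cos x1 by rewrite sin0 mul0r subrr subr_ge0.
  apply: (@derive_incr R (fun x => sin x - x * cos x) (fun x => x * sin x)) => [|x x0 _|x x0 xx].
  - exact: ltW.
  - by der; ring.
  - by rewrite mulr_ge0 // sin_ge0_pi // x0 /= (le_trans xx) // ltW.
(* As [pi - d >= 1] and [sin d <= d], the first term of [h (pi - d)] is at least [r / d >= c + pi],
   and the other two exceed [- pi]. *)
pose d := Num.min 1 (r / (c + pi)).
have d0 : 0 < d by rewrite lt_min ltr01 divr_gt0 // ltr_wpDl.
have d1 : d <= 1 by rewrite ge_min lexx.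
have pg := pi_ge2 R.
have dr : d <= r / (c + pi) by rewrite ge_min lexx orbT.
have x1d : x1 <= pi - d by lra.
have hd : c < h (pi - d).
  have sd : sin (pi - d) = sin d by rewrite sinB sinpi cospi mul0r mulN1r sub0r opprK.
  have sd0 : 0 < sin d by rewrite sin_gt0_pi // d0 /=; lra.
  have sdd : sin d <= d.
    suff : 0 - sin 0 <= d - sin d by rewrite sin0 subr0 subr_ge0.
    apply: (@derive_incr R (fun x => x - sin x) (fun x => 1 - cos x)); first exact: ltW.
    by move=> x _ _; rewrite subr_ge0 cos_le1.
  have a1 := atan_gtNpi2 (cos (pi - d) / y (pi - d)).
  have : c + pi <= y (pi - d) * ((pi - d) / sin (pi - d)).
    rewrite sd; apply: (@le_trans _ _ (r / d)).
      by rewrite ler_pdivlMr // mulrC -ler_pdivlMr // ltr_wpDl.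
    rewrite mulrA ler_pM ?divr_ge0 ?invr_ge0 ?(ltW d0) ?(ltW r0) //.
      rewrite -[leLHS]mulr1 ler_pM ?(ltW r0) ?yp //; lra.
    by rewrite lef_pV2 ?posrE.
  by rewrite /h; lra.
have [||t] := @IVT R h x1 (pi - d) c x1d.
- apply: cnt_within => x xx xp; apply: hc; first exact: lt_le_trans xx.
  by apply: le_lt_trans xp _; lra.
- by rewrite ge_min (ltW hx1) le_max (ltW hd) orbT.
rewrite in_itv /= => /andP[x1t td] ht.
have t0 : 0 < t by exact: lt_le_trans x1t.
have tp : t < pi by lra.
have st : 0 < sin t by rewrite sin_gt0_pi // t0.
pose l := y t / r.
have y2 : y t ^+ 2 = r ^+ 2 + sin t ^+ 2 by rewrite sqr_sqrtr // addr_ge0 ?sqr_ge0.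
have l0 : 0 < l by rewrite divr_gt0.
have l2 : l ^+ 2 - 1 = (sin t / r) ^+ 2.
  by rewrite /l !expr_div_n y2; field; rewrite gt_eqF.
have l1 : 1 < l.
  rewrite -[ltLHS](expr1n _ 2) -(@ltr_pXn2r _ 2) ?nnegrE ?(ltW l0) //.
  by rewrite -subr_gt0 expr1n expr1n l2 exprn_gt0 // divr_gt0.
have omE : om l = sin t / r.
  by rewrite /om l2 ger0_norm ?sqr_ge0 // sqrtr_sqr gtr0_norm // divr_gt0.
have om0 : 0 < om l by rewrite omE divr_gt0.
have [sE cE] : snl l (t / om l) = r /\ csl l (t / om l) = cos t.
  have [-> ->] := snlE_gt l1; rewrite (_ : om l * (t / om l) = t); last first.
    by rewrite mulrC divfK // gt_eqF.
  by split=> //; rewrite omE; field; rewrite !gt_eqF.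
have hl : half_period l *+ 2 = pi / om l by rewrite /half_period -mulr_natr; field;
    rewrite gt_eqF.
have th : t / om l < half_period l *+ 2 by rewrite hl ltr_pM2r ?invr_gt0.
exists l, (t / om l); split => //; [by rewrite divr_gt0|exact: ltW|].
rewrite arcK_atanV ?divr_gt0 // sE cE -ht /h /l omE divfK ?gt_eqF //; congr (_ - _ + _).
by field; rewrite !gt_eqF.
Qed.

Lemma arc_exists r c : 0 <= r -> 0 <= c -> (r != 0) || (c != 0) ->
  exists l t, [/\ 0 <= l, 0 < t, (1 < l -> t <= half_period l *+ 2), snl l t = r & arcK l t = c].
Proof.
move=> r0 c0; have [->|rn0] := eqVneq r 0; rewrite ?eqxx /= => cn0.
  have cp : 0 < c by rewrite lt_def cn0.
  have p0 := pi_gt0 R.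
  (* For [r = 0] the arc is a full period, with argument [pi (l / om l - 1)]. Equating this with [c]
     gives [l / om l = q], that is [l = q / sqrt (q^2 - 1)]. *)
  pose q := (c + pi) / pi.
  have q1 : 1 < q by rewrite ltr_pdivlMr // mul1r ltrDr.
  have qp : 0 < q by lra.
  have q2 : 0 < q ^+ 2 - 1 by rewrite subr_gt0 expr_gt1 // ltW.
  pose l := q / Num.sqrt (q ^+ 2 - 1).
  have sp : 0 < Num.sqrt (q ^+ 2 - 1) by rewrite sqrtr_gt0.
  have s2 : Num.sqrt (q ^+ 2 - 1) ^+ 2 = q ^+ 2 - 1 by rewrite sqr_sqrtr // ltW.
  have lp : 0 < l by rewrite divr_gt0.
  have l2 : l ^+ 2 - 1 = (Num.sqrt (q ^+ 2 - 1))^-1 ^+ 2.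
    by rewrite /l expr_div_n exprVn s2; field; rewrite gt_eqF.
  have l1 : 1 < l.
    rewrite -[ltLHS](expr1n _ 2) -(@ltr_pXn2r _ 2) ?nnegrE ?(ltW lp) //.
    by rewrite -subr_gt0 expr1n expr1n l2 exprn_gt0 // invr_gt0.
  have omE : om l = (Num.sqrt (q ^+ 2 - 1))^-1.
    by rewrite /om l2 ger0_norm ?sqr_ge0 // sqrtr_sqr gtr0_norm // invr_gt0.
  have h0 := half_period_gt0 l1.
  exists l, (half_period l *+ 2); split => //; first exact: ltW.
  - by rewrite mulr2n addr_gt0.
  - by have := snl_refl 0 l1; rewrite subr0 snl0.
  rewrite arcK_full // arcK_half // /half_period omE /l -mulr_natr.
  move: (Num.sqrt _) sp => s sp; rewrite /q; move: pi p0 => p p0; field.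
  by rewrite !gt_eqF.
have rp : 0 < r by rewrite lt_def rn0.
have [->|cn] := eqVneq c 0.
  have n01 : (1 < 0 :> R) = false by rewrite ltr10.
  have [|t [t0 _ st]] := @snl_onto 0 r (lexx _) r0; first by rewrite n01.
  exists 0, t; split; rewrite ?n01 // ?lt_def ?t0 ?andbT.
    by apply/eqP => tt; move: st; rewrite tt snl0 => /esym/eqP; rewrite (negbTE rn0).
  by rewrite arcK_atan ?n01 // !mul0r atan0 subrr.
have cp : 0 < c by rewrite lt_def cn.
have [lt|gt|e] := ltgtP c (r - atan r).
- have [l [t [l0 t0 l1 sl kl]]] := arc_exists_lt rp cp lt.
  by exists l, t; split => //; rewrite ltNge (ltW l1).
- have [l [t [l1 t0 th sl kl]]] := arc_exists_gt rp c0 gt.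
  by exists l, t; split => //; apply/ltW/lt_trans/l1.
exists 1, r; have [sE cE] := snlE_eq.
split => //; rewrite ?ltxx //; first by rewrite sE.
by rewrite arcK_atan ?ltxx // sE cE !mul1r divr1 e.
Qed.

End Arcs.

(** * Minimality of the model arcs *)

Section PlaneCurves.
Variable R : realType.
Notation mu := (@lebesgue_measure R).
Notation ac := absolutely_continuous.
Implicit Types (x y c s : R -> R) (a b t l m T : R).

(* [x + i y] is the second matrix entry of a horizontal curve, [c] the argument of the first
   one and [s] the arc length. *)
Definition plane_curve tau x y c s : Prop :=
  [/\ ac 0 tau x, ac 0 tau y, ac 0 tau c, ac 0 tau s &
   {ae mu, forall t, t \in `[0, tau] -> exists px py n,
     [/\ 0 <= n, is_derive t 1 x px, is_derive t 1 y py, is_derive t 1 s n &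
      is_derive t 1 c ((y t * px - x t * py) / (1 + (x t ^+ 2 + y t ^+ 2))) /\
      px ^+ 2 + py ^+ 2 = (1 + (x t ^+ 2 + y t ^+ 2)) * n ^+ 2]}].

Definition plane_norm x y t := Num.sqrt (x t ^+ 2 + y t ^+ 2).

Lemma plane_norm2 x y t : plane_norm x y t ^+ 2 = x t ^+ 2 + y t ^+ 2.
Proof. by rewrite sqr_sqrtr // addr_ge0 ?sqr_ge0. Qed.

Lemma plane_norm_ge0 x y t : 0 <= plane_norm x y t. Proof. exact: sqrtr_ge0. Qed.

Lemma sqr_le (u v : R) : 0 <= v -> u ^+ 2 <= v ^+ 2 -> u <= v.
Proof.
move=> v0 uv; apply: le_trans (ler_norm u) _.
by rewrite -(ger0_norm v0) -!sqrtr_sqr ler_sqrt ?sqr_ge0.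
Qed.

Lemma plane_norm_lip x y t t' : `|plane_norm x y t' - plane_norm x y t| <= `|x t' - x t| + `|y
    t' - y t|.
Proof.
have tri (u v u' v' : R) : Num.sqrt (u' ^+ 2 + v' ^+ 2) <= Num.sqrt (u ^+ 2 + v ^+ 2) + (`|u' -
    u| + `|v' - v|).
  have S0 := sqrtr_ge0 (u ^+ 2 + v ^+ 2).
  have S2 : Num.sqrt (u ^+ 2 + v ^+ 2) ^+ 2 = u ^+ 2 + v ^+ 2.
    by rewrite sqr_sqrtr // addr_ge0 ?sqr_ge0.
  have a0 := normr_ge0 (u' - u); have b0 := normr_ge0 (v' - v).
  apply: sqr_le; first by rewrite !addr_ge0.
  rewrite sqr_sqrtr ?addr_ge0 ?sqr_ge0 //.
  have uS : `|u| <= Num.sqrt (u ^+ 2 + v ^+ 2).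
    by rewrite -sqrtr_sqr ler_sqrt ?addr_ge0 ?sqr_ge0 // lerDl sqr_ge0.
  have vS : `|v| <= Num.sqrt (u ^+ 2 + v ^+ 2).
    by rewrite -sqrtr_sqr ler_sqrt ?addr_ge0 ?sqr_ge0 // lerDr sqr_ge0.
  have d1 : u' ^+ 2 = u ^+ 2 + 2 * (u * (u' - u)) + `|u' - u| ^+ 2.
    by rewrite real_normK ?num_real //; ring.
  have d2 : v' ^+ 2 = v ^+ 2 + 2 * (v * (v' - v)) + `|v' - v| ^+ 2.
    by rewrite real_normK ?num_real //; ring.
  have e1 : u * (u' - u) <= Num.sqrt (u ^+ 2 + v ^+ 2) * `|u' - u|.
    by apply: le_trans (ler_norm _) _; rewrite normrM ler_wpM2r.
  have e2 : v * (v' - v) <= Num.sqrt (u ^+ 2 + v ^+ 2) * `|v' - v|.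
    by apply: le_trans (ler_norm _) _; rewrite normrM ler_wpM2r.
  have ab := mulr_ge0 a0 b0.
  rewrite d1 d2; move: (Num.sqrt _) S2 e1 e2 => S S2 e1 e2.
  rewrite (_ : (S + _) ^+ 2 = S ^+ 2 + 2 * (S * `|u' - u| + S * `|v' - v|) + `|u' - u| ^+ 2 +
      `|v' - v| ^+ 2 + 2 * (`|u' - u| * `|v' - v|)); last by ring.
  by rewrite S2; lra.
rewrite ler_norml; apply/andP; split.
  have := tri (x t') (y t') (x t) (y t); rewrite /plane_norm (distrC (x t)) (distrC (y t)).
  lra.
by have := tri (x t) (y t) (x t') (y t'); rewrite /plane_norm; lra.
Qed.

Lemma ac_plane_norm x y a b : ac a b x -> ac a b y -> ac a b (plane_norm x y).
Proof.
move=> acx acy; apply: (ac_dominated (K := 1) acx acy) => t t' _ _ _.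
by rewrite mul1r plane_norm_lip.
Qed.

(** The radius may have a corner on the axis, but it grows there at most at the speed, which is all
    that [calibration] needs. *)
Lemma plane_norm_near0 x y t px py n : 0 <= n -> is_derive t 1 x px -> is_derive t 1 y py ->
  px ^+ 2 + py ^+ 2 = n ^+ 2 -> x t = 0 -> y t = 0 ->
  forall e, 0 < e -> exists2 r, 0 < r &
    forall z, `|z - t| < r -> plane_norm x y z <= (n + e) * `|z - t|.
Proof.
move=> n0 dx dy pn x0 y0 e e0; have e2 : 0 < e / 2 by lra.
have [r1 r10 P1] := derive_approx dx e2; have [r2 r20 P2] := derive_approx dy e2.
exists (Num.min r1 r2); first by rewrite lt_min r10.
move=> z; rewrite lt_min => /andP[/P1 h1 /P2 h2].
rewrite x0 subr0 in h1; rewrite y0 subr0 in h2.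
have N : Num.sqrt ((px * (z - t)) ^+ 2 + (py * (z - t)) ^+ 2) = n * `|z - t|.
  by rewrite !exprMn -mulrDl pn sqrtrM ?sqr_ge0 // !sqrtr_sqr (ger0_norm n0).
(* Artificial curves with the linear prediction at 0 and the actual point at 1, so that
   [plane_norm_lip] serves as the triangle inequality. *)
pose x' (q : R) := if q == 0 then px * (z - t) else x z.
pose y' (q : R) := if q == 0 then py * (z - t) else y z.
have := plane_norm_lip x' y' 0 1; rewrite /plane_norm /x' /y' eqxx oner_eq0 N => H.
have := ler_norm (Num.sqrt (x z ^+ 2 + y z ^+ 2) - n * `|z - t|).
by rewrite mulrDl; lra.
Qed.

Lemma cauchy_schwarz2 (u v p q N : R) : 0 <= N -> (u ^+ 2 + v ^+ 2) * (p ^+ 2 + q ^+ 2) <= N ^+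
    2 ->
  u * p + v * q <= N.
Proof.
move=> N0 h; apply: sqr_le => //; apply: le_trans h.
rewrite -subr_ge0 (_ : _ - _ = (u * q - v * p) ^+ 2) ?sqr_ge0 //; ring.
Qed.

(** In calibrations [true] stands for a leg going away from the axis and [false] for one coming
    back; later the same sign encodes complex conjugation. *)
Definition sgn1 (sg : bool) : R := if sg then 1 else -1.

Lemma sgn1_sub_le sg (u v B : R) : 0 <= u -> 0 <= v -> u <= B -> v <= B ->
  sgn1 sg * (v - u) <= B.
Proof. by rewrite /sgn1; case: sg => *; lra. Qed.

Lemma rigid_arith sg (D ka kb ma la mb lb m l B q : R) :
  m * D + sgn1 sg * (mb - ma) <= l * D + sgn1 sg * (lb - la) ->
  `|ma - la + (m - l) * ka| <= B * q -> `|mb - lb + (m - l) * kb| <= B * q ->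
  (m - l) * (D - sgn1 sg * (kb - ka)) <= (B + B) * q.
Proof.
rewrite !ler_norml [(B + B) * q]mulrDl; move: (B * q) => Q h /andP[a1 a2] /andP[b1 b2].
have -> : (m - l) * (D - sgn1 sg * (kb - ka)) = m * D - l * D - sgn1 sg * ((m - l) * kb - (m -
    l) * ka) by ring.
move: h a1 a2 b1 b2; move: ((m - l) * ka) ((m - l) * kb) (m * D) (l * D) => u v w z.
by rewrite /sgn1; case: sg => *; lra.
Qed.

Section Curve.
Variables (tau : R) (x y c s : R -> R).
Hypothesis pc : plane_curve tau x y c s.
Let r := plane_norm x y.

Lemma pc_ac : [/\ ac 0 tau x, ac 0 tau y, ac 0 tau c, ac 0 tau s & ac 0 tau r].
Proof. by case: pc => ? ? ? ? _; split => //; exact: ac_plane_norm. Qed.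

(** Off the axis this is Cauchy-Schwarz: [(l r, A)], up to the sign of [A], has squared norm
    [1 + r^2], and the angular and radial velocities [(Q, P)] have squared norm [(1 + r^2) n^2]. On
    the axis a straddled estimate takes over. *)
Lemma calibration sg l a b : 0 <= a -> a <= b -> b <= tau ->
  (forall t, a <= t -> t <= b -> 0 <= 1 + (1 - l ^+ 2) * r t ^+ 2) ->
  l * (c b - c a) + sgn1 sg * (cal l (r b) - cal l (r a)) <= s b - s a.
Proof.
move=> a0 ab bt valid; have [acx acy acc acs acr] := pc_ac.
pose g t := l * c t + sgn1 sg * cal l (r t) - s t.
suff : g b <= g a by rewrite /g; move: (sgn1 sg) => k; clear; lra.
have accal : ac 0 tau (fun t => cal l (r t)).
  apply: (ac_lipschitz (K := 1) acr) => t t' _ _ _.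
  by rewrite mul1r cal_lip ?plane_norm_ge0.
have acg : ac a b g.
  apply: (@acS _ 0 tau) => //.
  by apply: acB => //; apply: acD; exact: acZ.
apply: ac_straddle_le ab acg _.
case: pc => _ _ _ _; apply: ae_imply => t + /[!in_itv] /= /andP[at_ tb].
rewrite in_itv /= (le_trans a0 at_) (le_trans tb bt) => /(_ isT).
move=> [px [py [n [n0 dx dy ds [dc pn]]]]].
have A0 := valid t at_ tb; rewrite plane_norm2 in A0.
have r2 : r t ^+ 2 = x t ^+ 2 + y t ^+ 2 by exact: plane_norm2.
have q0 : 0 < 1 + (x t ^+ 2 + y t ^+ 2) by rewrite ltr_pwDl // addr_ge0 ?sqr_ge0.
have [rt|rt] := eqVneq (r t) 0.
  have xy0 : x t ^+ 2 + y t ^+ 2 = 0 by rewrite -r2 rt expr0n.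
  have [x0 y0] : x t = 0 /\ y t = 0.
    move/eqP: xy0; rewrite paddr_eq0 ?sqr_ge0 // !sqrf_eq0 => /andP[/eqP ? /eqP ?].
    by split.
  have pn' : px ^+ 2 + py ^+ 2 = n ^+ 2 by rewrite pn xy0 addr0 mul1r.
  have d1 : is_derive t 1 (fun t => l * c t - s t) (- n).
    by der; rewrite x0 y0 !mul0r subrr !mul0r mulr0 !add0r.
  (* Both values of [cal l (r _)] lie between 0 and [(n + e) * (z' - z)], hence their difference is
     bounded by the latter whatever the sign. *)
  have st2 : straddle_le a b (fun t => sgn1 sg * cal l (r t)) t n.
    move=> e e0; have [d d0 dP] := plane_norm_near0 n0 dx dy pn' x0 y0 e0.
    exists d => // z z' az zt tz z'b zd.
    have b1 : r z <= (n + e) * (z' - z).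
      apply: le_trans (dP z _) _; first by rewrite ler0_norm ?subr_le0 //; lra.
      by rewrite ler_wpM2l ?ler0_norm ?subr_le0 //; lra.
    have b2 : r z' <= (n + e) * (z' - z).
      apply: le_trans (dP z' _) _; first by rewrite ger0_norm ?subr_ge0 //; lra.
      by rewrite ler_wpM2l ?ger0_norm ?subr_ge0 //; lra.
    have c1 := cal_ge0 l (plane_norm_ge0 x y z); have c2 := cal_ge0 l (plane_norm_ge0 x y z').
    have c3 := cal_lex l (plane_norm_ge0 x y z); have c4 := cal_lex l (plane_norm_ge0 x y z').
    rewrite -mulrBr; apply: sgn1_sub_le => //; [exact: le_trans c3 b1|exact: le_trans c4 b2].
  have := straddleD (derive_straddle a b d1) st2; rewrite addNr.
  have -> // : (fun t => l * c t - s t + sgn1 sg * cal l (r t)) = g.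
  by apply/funext => z; rewrite /g; ring.
have rp : 0 < r t by rewrite lt_def rt plane_norm_ge0.
have dr : is_derive t 1 r ((x t * px + y t * py) / r t).
  have p : 0 < x t ^+ 2 + y t ^+ 2 by rewrite -r2 exprn_gt0.
  rewrite /r /plane_norm; der => //; rewrite -/(plane_norm x y t) -/r; field.
  by rewrite rt.
pose P := (x t * px + y t * py) / r t.
pose Q := (y t * px - x t * py) / r t.
pose A := Num.sqrt (1 + (1 - l ^+ 2) * r t ^+ 2).
have sl : cal_slope l (r t) = A / (1 + r t ^+ 2).
  by rewrite /cal_slope (max_idPr _) // r2.
have dcal := @drv_comp R t (cal l) r _ _ (cal_derive l (ltW rp)) dr.
have dg : is_derive t 1 g ((l * r t * Q + sgn1 sg * A * P) / (1 + r t ^+ 2) - n).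
  rewrite /g; der; rewrite sl -r2 !mul0r !add0r /P /Q; field.
  by rewrite rt /= r2 gt_eqF.
have PQ : P ^+ 2 + Q ^+ 2 = (1 + r t ^+ 2) * n ^+ 2.
  rewrite /P /Q !expr_div_n -mulrDl.
  rewrite [X in X / _](_ : _ = r t ^+ 2 * (px ^+ 2 + py ^+ 2)); last by rewrite r2; ring.
  by rewrite pn -r2 mulrC mulKf // expf_neq0.
have q0' : 0 < 1 + r t ^+ 2 by rewrite r2.
have CS : l * r t * Q + sgn1 sg * A * P <= (1 + r t ^+ 2) * n.
  apply: cauchy_schwarz2; first by rewrite mulr_ge0 // ltW.
  have A2 : A ^+ 2 = 1 + (1 - l ^+ 2) * r t ^+ 2 by rewrite sqr_sqrtr // r2.
  have sg2 : sgn1 sg ^+ 2 = 1 by rewrite /sgn1; case: (sg); rewrite ?sqrrN expr1n.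
  rewrite (addrC (Q ^+ 2)) PQ [(sgn1 sg * A) ^+ 2]exprMn sg2 mul1r A2.
  rewrite [leLHS](_ : _ = ((1 + r t ^+ 2) * n) ^+ 2) ?lexx //; ring.
have dg0 : (l * r t * Q + sgn1 sg * A * P) / (1 + r t ^+ 2) - n <= 0.
  by rewrite subr_le0 ler_pdivrMr // [leRHS]mulrC.
move=> e e0; have [d d0 dP] := derive_straddle a b dg e0.
exists d => // z z' az zt tz z'b zd; apply: le_trans (dP _ _ az zt tz z'b zd) _.
by rewrite ler_wpM2r ?lerD2r // subr_ge0 (le_trans zt).
Qed.

Lemma arclen_le a b : 0 <= a -> a <= b -> b <= tau -> s a <= s b.
Proof.
move=> a0 ab bt; have [_ _ _ acs _] := pc_ac.
rewrite -lerN2; have acN_ := acN (acS a0 bt acs).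
apply: (@ae_derive_le _ a b (fun t => - s t) (fun t => - ('D_1 s t)) ab acN_).
case: pc => _ _ _ _; apply: ae_imply => t + /[!in_itv] /= /andP[at_ tb].
rewrite in_itv /= (le_trans a0 at_) (le_trans tb bt) => /(_ isT).
move=> [px [py [n [n0 dx dy ds _]]]].
have -> : 'D_1 s t = n by apply: derive_val.
by split; [der|rewrite oppr_le0].
Qed.

(** The charges 1 and -1 are valid at every radius, and adding the outward and inward calibrations
    cancels [cal]. *)
Lemma arclen_lip a b : 0 <= a -> a <= b -> b <= tau -> `|c b - c a| <= s b - s a.
Proof.
move=> a0 ab bt.
have H (sg : bool) : sgn1 sg * (c b - c a) <= s b - s a.
  have V t : a <= t -> t <= b -> 0 <= 1 + (1 - sgn1 sg ^+ 2) * r t ^+ 2.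
    by move=> _ _; rewrite /sgn1; case: (sg); rewrite ?sqrrN expr1n subrr mul0r addr0.
  have h1 := calibration true a0 ab bt V.
  have h2 := calibration false a0 ab bt V.
  by move: h1 h2; rewrite [sgn1 true]/sgn1 [sgn1 false]/sgn1; move: (sgn1 sg) => k; clear; lra.
have := H true; have := H false; rewrite /sgn1 => h1 h2.
by rewrite ler_norml; apply/andP; split; lra.
Qed.

(** With the radius bounded by [M], each plane coordinate changes at most [sqrt (1 + M^2)] times as
    fast as [s]. This handles curves that pause. *)
Lemma arclen_const a b : 0 <= a -> a <= b -> b <= tau -> s a = s b ->
  [/\ x b = x a, y b = y a & c b = c a].
Proof.
move=> a0 ab bt sab; have [acx acy acc acs acr] := pc_ac.
have t0 : 0 <= tau by apply: le_trans a0 (le_trans ab bt).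
have [M M0 rM] := ac_bounded t0 acr.
pose K := Num.sqrt (1 + M ^+ 2).
have K2 : K ^+ 2 = 1 + M ^+ 2 by rewrite sqr_sqrtr // addr_ge0 // sqr_ge0.
have dom (f : R -> R) (sg : bool) : ac 0 tau f ->
  {ae mu, forall t, t \in `[0, tau] -> exists p n,
     [/\ 0 <= n, is_derive t 1 f p, is_derive t 1 s n & p ^+ 2 <= (1 + r t ^+ 2) * n ^+ 2]} ->
  sgn1 sg * (f b - f a) <= 0.
  move=> acf aef.
  have acg : ac a b (fun t => sgn1 sg * f t - K * s t).
    by apply: (@acS _ 0 tau) => //; apply: acB; apply: acZ.
  have : (fun t => sgn1 sg * f t - K * s t) b <= (fun t => sgn1 sg * f t - K * s t) a.
    apply: (@ae_derive_le _ a b _ (fun t => sgn1 sg * 'D_1 f t - K * 'D_1 s t) ab acg).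
    apply: ae_imply aef => t + /[!in_itv] /= /andP[at_ tb].
    rewrite in_itv /= (le_trans a0 at_) (le_trans tb bt) => /(_ isT).
    move=> [p [n [n0 df ds pn]]].
    have -> : 'D_1 f t = p by apply: derive_val.
    have -> : 'D_1 s t = n by apply: derive_val.
    split; first by der; rewrite !mul0r !add0r.
    rewrite subr_le0; apply: sqr_le; first by rewrite mulr_ge0 // sqrtr_ge0.
    have -> : (sgn1 sg * p) ^+ 2 = p ^+ 2.
      by rewrite exprMn /sgn1; case: (sg); rewrite ?sqrrN expr1n mul1r.
    apply: le_trans pn _; rewrite exprMn K2.
    rewrite ler_wpM2r ?sqr_ge0 // lerD2l ler_sqr ?nnegrE ?plane_norm_ge0 ?(ltW M0) //.
    by apply: le_trans (ler_norm _) (rM _ _ _); [exact: le_trans at_|exact: le_trans bt].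
  by rewrite sab mulrBr; lra.
have eq0 (f : R -> R) : (forall sg, sgn1 sg * (f b - f a) <= 0) -> f b = f a.
  by move=> H; have := H true; have := H false; rewrite /sgn1; lra.
case: pc => _ _ _ _ ae; split.
- apply: eq0 => sg; apply: dom => //; apply: ae_imply ae => t h /h [px [py [n [n0 dx dy ds [_
    pn]]]]].
  by exists px, n; split => //; rewrite plane_norm2 -pn lerDl sqr_ge0.
- apply: eq0 => sg; apply: dom => //; apply: ae_imply ae => t h /h [px [py [n [n0 dx dy ds [_
    pn]]]]].
  by exists py, n; split => //; rewrite plane_norm2 -pn lerDr sqr_ge0.
- apply/eqP; rewrite -subr_eq0 -normr_eq0 eq_le normr_ge0 andbT.
  by have := arclen_lip a0 ab bt; rewrite sab subrr.
Qed.

(** [m] may lie on either side of [l]: dividing by [|m - l|] and shrinking it bounds [X] from both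
    sides. *)
Lemma linear_perturbation (l d K X : R) : 0 < d ->
  (forall m, `|m - l| <= d -> (m - l) * X <= K * (m - l) ^+ 2) -> X = 0.
Proof.
move=> d0 H.
have K0 : 0 < `|K| + 1 by rewrite ltr_wpDl.
have h e : 0 < e -> e <= d -> `|X| <= (`|K| + 1) * e.
  move=> e0 ed.
  have h1 := H (l + e); have h2 := H (l - e).
  have i1 : l + e - l = e by ring.
  have i2 : l - e - l = - e by ring.
  rewrite i1 (ger0_norm (ltW e0)) in h1; rewrite i2 normrN (ger0_norm (ltW e0)) in h2.
  have {}h1 := h1 ed; have {}h2 := h2 ed.
  have KK : K * e ^+ 2 <= (`|K| + 1) * e * e.
    by rewrite -mulrA -expr2 ler_wpM2r ?sqr_ge0 // (le_trans (ler_norm _)) // lerDl.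
  rewrite sqrrN in h2; rewrite ler_norml; apply/andP; split.
    by rewrite -(ler_pM2r e0); lra.
  by rewrite -(ler_pM2r e0); lra.
apply/eqP; rewrite -normr_eq0; apply/negPn/negP => X0.
have Xp : 0 < `|X| by rewrite lt_def X0 normr_ge0.
pose e := Num.min d (`|X| / (2 * (`|K| + 1))).
have e0 : 0 < e by rewrite lt_min d0 divr_gt0 // mulr_gt0.
have ed : e <= d by rewrite ge_min lexx.
have := h e e0 ed; apply/negP; rewrite -ltNge.
apply: (@le_lt_trans _ _ ((`|K| + 1) * (`|X| / (2 * (`|K| + 1))))).
  by rewrite ler_pM2l // ge_min lexx orbT.
rewrite (_ : _ * _ = `|X| / 2); first by lra.
by field; rewrite gt_eqF.
Qed.

(* Differentiating the calibration inequality with respect to the charge, as in Jacobi's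
   theorem on complete integrals. *)
Lemma calibrated_rigid sg l T a b (ta tb : R) : 0 <= l -> 0 <= T -> (1 < l -> T < half_period l)
    ->
  0 <= a -> a <= b -> b <= tau -> (forall t, a <= t -> t <= b -> r t <= snl l T) ->
  0 <= ta -> ta <= T -> 0 <= tb -> tb <= T -> r a = snl l ta -> r b = snl l tb ->
  s b - s a = l * (c b - c a) + sgn1 sg * (cal l (r b) - cal l (r a)) ->
  c b - c a = sgn1 sg * (arcK l tb - arcK l ta) /\ s b - s a = sgn1 sg * (tb - ta).
Proof.
move=> l0 T0 Th a0 ab bt rT ta0 taT tb0 tbT ra rb eqs.
have [d d0 [K dK]] := cal_perturb l0 T0 Th.
have ceq : c b - c a = sgn1 sg * (arcK l tb - arcK l ta).
  apply/eqP; rewrite -subr_eq0; apply/eqP.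
  apply: (@linear_perturbation l d (K + K)) => // m md.
  have V t : a <= t -> t <= b -> 0 <= 1 + (1 - m ^+ 2) * r t ^+ 2.
    move=> at_ tb_; have [V1 _] := dK m md T T0 (lexx T).
    have [m1|m1] := leP (m ^+ 2) 1.
      by rewrite addr_ge0 // mulr_ge0 ?sqr_ge0 // subr_ge0.
    apply: le_trans V1 _; rewrite lerD2l ler_wnM2l ?subr_le0 ?(ltW m1) //.
    rewrite ler_sqr ?nnegrE ?plane_norm_ge0 //; first exact: rT.
    by apply: le_trans (rT t at_ tb_); exact: plane_norm_ge0.
  have h := calibration sg a0 ab bt V; rewrite eqs in h.
  have [_ ha] := dK m md ta ta0 taT; have [_ hb] := dK m md tb tb0 tbT.
  rewrite -ra in ha; rewrite -rb in hb; exact: rigid_arith h ha hb.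
split => //; rewrite eqs ceq ra rb !cal_arc //; first ring.
- by move=> /Th/ltW; apply: le_trans.
- by move=> /Th/ltW; apply: le_trans.
Qed.

(** The outward calibration up to [tm] and the inward one afterwards are added; if the sum is tight,
    so is each leg. *)
Lemma two_legs m tm : 0 <= tm -> tm <= tau -> x 0 = 0 -> y 0 = 0 -> c 0 = 0 -> s 0 = 0 ->
  (forall t, 0 <= t -> t <= tau -> 0 <= 1 + (1 - m ^+ 2) * r t ^+ 2) ->
  m * c tau + 2 * cal m (r tm) - cal m (r tau) <= s tau /\
  (s tau <= m * c tau + 2 * cal m (r tm) - cal m (r tau) ->
   s tm - s 0 = m * (c tm - c 0) + sgn1 true * (cal m (r tm) - cal m (r 0)) /\
   s tau - s tm = m * (c tau - c tm) + sgn1 false * (cal m (r tau) - cal m (r tm))).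
Proof.
move=> tm0 tmt x0 y0 c0 s0 V.
have r0 : r 0 = 0 by rewrite /r /plane_norm x0 y0 expr0n addr0 sqrtr0.
have h1 := @calibration true m 0 tm (lexx _) tm0 tmt.
have h2 := @calibration false m tm tau tm0 tmt (lexx _).
have {}h1 : m * (c tm - c 0) + sgn1 true * (cal m (r tm) - cal m (r 0)) <= s tm - s 0.
  by apply: h1 => t t0 ttm; apply: V => //; apply: le_trans tmt.
have {}h2 : m * (c tau - c tm) + sgn1 false * (cal m (r tau) - cal m (r tm)) <= s tau - s tm.
  by apply: h2 => t t0 ttm; apply: V => //; apply: le_trans t0.
move: h1 h2; rewrite c0 s0 r0 cal0 !subr0 /sgn1 mulrBr.
move: (m * c tau) (m * c tm) (cal m (r tm)) (cal m (r tau)) (s tau) (s tm) => A B C D E F.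
by move=> h1 h2; split; first lra; move=> h; split; lra.
Qed.

End Curve.

Lemma charge_valid l (q : R) : 0 <= l -> 0 <= q -> (1 < l -> q <= (om l)^-1) ->
  0 <= 1 + (1 - l ^+ 2) * q ^+ 2.
Proof.
move=> l0 q0 ql; have [l1|l1] := leP l 1.
  by rewrite addr_ge0 // mulr_ge0 ?sqr_ge0 // subr_ge0 expr_le1.
have [w0 w2] := om_gt1 l1; rewrite -opprB -w2 mulNr subr_ge0 -exprMn expr_le1 //.
  by rewrite mulrC -ler_pdivlMr // div1r; exact: ql.
by rewrite mulr_ge0 // ltW.
Qed.

(** The calibration of charge [m] tested on the arc of charge [l], by Cauchy-Schwarz for
    [(m snl, A)] and [(l snl, csl)]. It survives the turning point, where [csl] changes sign. *)
Lemma arc_cal_le l m T : 0 <= l -> 0 <= T -> (1 < l -> T <= half_period l *+ 2) ->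
  (forall t, 0 <= t -> t <= T -> 0 <= 1 + (1 - m ^+ 2) * snl l t ^+ 2) ->
  cal m (snl l T) <= T - m * arcK l T.
Proof.
move=> l0 T0 Th V.
pose g t := t - m * arcK l t - cal m (snl l t).
pose dg t := 1 - m * arcK_slope l t - cal_slope m (snl l t) * csl l t.
suff : g 0 <= g T by rewrite /g snl0 arcK0 cal0 mulr0 !subr0 subr_ge0.
apply: (@derive_incr R g dg) => [//|t t0 tT|t t0 tT].
  have S0 : 0 <= snl l t by apply: snl_ge0 => // /Th; apply: le_trans.
  have d1 := drv_comp (cal_derive m S0) (snl_derive t l0).
  have d2 := arcK_derive l0 t0.
  by rewrite /g /dg; der; rewrite mul0r add0r.
have q0 := oneDx_gt0 (snl l t).
rewrite /dg /arcK_slope /cal_slope (max_idPr (V t t0 tT)).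
set A := Num.sqrt _; have A2 : A ^+ 2 = 1 + (1 - m ^+ 2) * snl l t ^+ 2 by rewrite sqr_sqrtr // V.
have CS : m * snl l t * (l * snl l t) + A * csl l t <= 1 + snl l t ^+ 2.
  apply: cauchy_schwarz2; first exact: ltW.
  by rewrite A2 [(l * _) ^+ 2]exprMn csl2 // [leLHS](_ : _ = (1 + snl l t ^+ 2) ^+ 2) ?lexx //;
      ring.
rewrite (_ : _ - _ = (1 + snl l t ^+ 2 - (m * snl l t * (l * snl l t) + A * csl l t)) / (1 + snl
    l t ^+ 2)).
  by rewrite divr_ge0 ?(ltW q0) // subr_ge0.
by field; rewrite gt_eqF.
Qed.

Lemma om_charge (rm : R) : 0 < rm ->
  exists m, [/\ 1 < m, om m = rm^-1 & 0 <= 1 + (1 - m ^+ 2) * rm ^+ 2].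
Proof.
move=> r0; exists (Num.sqrt (1 + rm^-1 ^+ 2)).
have p : 0 < rm^-1 ^+ 2 by rewrite exprn_gt0 // invr_gt0.
have e : Num.sqrt (1 + rm^-1 ^+ 2) ^+ 2 = 1 + rm^-1 ^+ 2.
  by rewrite sqr_sqrtr // addr_ge0 // ltW.
split.
- by rewrite -[ltLHS]sqrtr1 ltr_sqrt ?addr_gt0 // ltrDl.
- by rewrite /om e addrC addKr ger0_norm ?(ltW p) // sqrtr_sqr gtr0_norm // invr_gt0.
- by rewrite e opprD addrA subrr sub0r mulNr -exprMn mulVf ?gt_eqF // expr1n subrr.
Qed.

(** Reversed Cauchy-Schwarz on the hyperbola [l^2 - om^2 = 1]: the squares of the two sides differ
    by [(om l - om m)^2]. *)
Lemma om_le l m : 1 < l -> 1 < m -> 1 + om l * om m <= l * m /\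
  (l * m <= 1 + om l * om m -> l = m).
Proof.
move=> l1 m1; have [wl wl2] := om_gt1 l1; have [wm wm2] := om_gt1 m1.
have lp : 0 < l by apply: lt_trans l1.
have mp : 0 < m by apply: lt_trans m1.
have e : (l * m) ^+ 2 - (1 + om l * om m) ^+ 2 = (om l - om m) ^+ 2.
  have -> : (om l - om m) ^+ 2 = om l ^+ 2 + om m ^+ 2 - 2 * (om l * om m) by ring.
  have -> : (1 + om l * om m) ^+ 2 = 1 + om l ^+ 2 * om m ^+ 2 + 2 * (om l * om m) by ring.
  by rewrite wl2 wm2; ring.
split.
  by apply: sqr_le; [rewrite mulr_ge0 // ltW|rewrite -subr_ge0 e sqr_ge0].
move=> h; have : (l * m) ^+ 2 - (1 + om l * om m) ^+ 2 <= 0.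
  have a1 : 0 <= l * m by rewrite mulr_ge0 // ltW.
  have a2 : 0 <= 1 + om l * om m by rewrite addr_ge0 // mulr_ge0 // ltW.
  by rewrite subr_le0 ler_sqr.
rewrite e => h'; have : (om l - om m) ^+ 2 = 0 by apply/eqP; rewrite eq_le h' sqr_ge0.
move/eqP; rewrite sqrf_eq0 subr_eq0 => /eqP E.
have : l ^+ 2 = m ^+ 2 by move: wl2 wm2; rewrite E => -> /(congr1 (fun z => z + 1));
    rewrite !subrK.
by move/eqP; rewrite eqrXn2 ?(ltW lp) ?(ltW mp) // => /eqP.
Qed.

Lemma arcK_sum l T : 1 < l -> 0 <= T -> T <= half_period l *+ 2 ->
  arcK l T + arcK l (half_period l *+ 2 - T) = 2 * l * half_period l - pi.
Proof.
move=> l1 T0 Th; rewrite arcK_refl // arcK_half // addrC subrK mulr2n.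
by field.
Qed.

Lemma first_hit (f : R -> R) a b (v : R) : ac a b f -> a <= b -> f b = v ->
  exists t1, [/\ a <= t1, t1 <= b, f t1 = v & forall t, a <= t -> t < t1 -> f t != v].
Proof.
move=> acf ab fb; pose E := [set t | a <= t <= b /\ f t = v].
have Eb : E b by split => //; rewrite ab lexx.
have lbE : lbound E a by move=> t [/andP[]].
have infE : has_inf E by split; [exists b|exists a].
have a1 : a <= inf E by apply: lb_le_inf => //; exists b.
have b1 : inf E <= b by apply: ge_inf => //; exists a.
exists (inf E); split => //; last first.
  move=> t at_ tE; have tb : t <= b by apply: ltW; apply: lt_le_trans b1.
  apply/eqP => ft; move: tE; apply/negP; rewrite -leNgt.
  by apply: ge_inf; [exists a|split => //; rewrite at_].
apply/eqP; rewrite -subr_eq0 -normr_eq0; apply/negPn/negP => e.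
have e0 : 0 < `|f (inf E) - v| by rewrite lt_def e normr_ge0.
have [d d0 dP] := ac_uniform acf e0.
have [t [/andP[at_ tb] ft] td] := inf_adherent d0 infE.
have tE : inf E <= t by apply: ge_inf; [exists a|split => //; rewrite at_].
have := dP _ _ a1 tE tb; rewrite ft distrC ltxx => H.
suff : false by []. by apply: H; rewrite ltrBlDl.
Qed.

Lemma last_hit (f : R -> R) a b (v : R) : ac a b f -> a <= b -> f a = v ->
  exists t2, [/\ a <= t2, t2 <= b, f t2 = v & forall t, t2 < t -> t <= b -> f t != v].
Proof.
move=> acf ab fa; pose E := [set t | a <= t <= b /\ f t = v].
have Ea : E a by split => //; rewrite ab lexx.
have ubE : ubound E b by move=> t [/andP[]].
have supE : has_sup E by split; [exists a|exists b].
have a1 : a <= sup E by apply: ub_le_sup => //; exists b.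
have b1 : sup E <= b by apply: ge_sup => //; exists a.
exists (sup E); split => //; last first.
  move=> t Et tb; have at_ : a <= t by apply: ltW; apply: le_lt_trans Et.
  apply/eqP => ft; move: Et; apply/negP; rewrite -leNgt.
  by apply: ub_le_sup; [exists b|split => //; rewrite at_].
apply/eqP; rewrite -subr_eq0 -normr_eq0; apply/negPn/negP => e.
have e0 : 0 < `|f (sup E) - v| by rewrite lt_def e normr_ge0.
have [d d0 dP] := ac_uniform acf e0.
have [t [/andP[at_ tb] ft] td] := sup_adherent d0 supE.
have tE : t <= sup E by apply: ub_le_sup; [exists b|split => //; rewrite at_].
have := dP _ _ at_ tE b1; rewrite ft ltxx => H.
suff : false by []. by apply: H; rewrite ltrBlDl -ltrBlDr.
Qed.

Lemma left_lim_ge0 (f : R -> R) a b : ac a b f -> a < b ->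
  (forall t, a <= t -> t < b -> 0 <= f t) -> 0 <= f b.
Proof.
move=> acf ab H; rewrite leNgt; apply/negP => fb.
have e0 : 0 < - f b by rewrite oppr_gt0.
have [d d0 dP] := ac_uniform acf e0.
pose t := Num.max a (b - d / 2).
have at_ : a <= t by rewrite le_max lexx.
have tb : t < b by rewrite gt_max ab /=; lra.
have td : b - t < d.
  have : b - d / 2 <= t by rewrite le_max lexx orbT.
  lra.
have := dP _ _ at_ (ltW tb) (lexx _) td; have := H _ at_ tb.
by rewrite ltr_norml => h /andP[h1 h2]; lra.
Qed.

Lemma right_lim_ge0 (f : R -> R) a b : ac a b f -> a < b ->
  (forall t, a < t -> t <= b -> 0 <= f t) -> 0 <= f a.
Proof.
move=> acf ab H; rewrite leNgt; apply/negP => fa.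
have e0 : 0 < - f a by rewrite oppr_gt0.
have [d d0 dP] := ac_uniform acf e0.
pose t := Num.min b (a + d / 2).
have tb : t <= b by rewrite ge_min lexx.
have at_ : a < t by rewrite lt_min ab /=; lra.
have td : t - a < d.
  have : t <= a + d / 2 by rewrite ge_min lexx orbT.
  lra.
have := dP _ _ (lexx _) (ltW at_) tb td; have := H _ at_ tb.
by rewrite ltr_norml => h /andP[h1 h2]; lra.
Qed.

(** The functions agree on [[a, b]] only, so increments to the right of [t] are compared. *)
Lemma derive_uniq (f g : R -> R) a b t df dg : a < t -> t < b ->
  (forall z, a <= z -> z <= b -> f z = g z) -> is_derive t 1 f df -> is_derive t 1 g dg ->
  df = dg.
Proof.
move=> at_ tb fg fd gd; apply/eqP; rewrite -subr_eq0 -normr_eq0; apply/negPn/negP => e.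
have e0 : 0 < `|df - dg| / 2 by rewrite divr_gt0 // lt_def e normr_ge0.
have [d d0 dP] := derive_approx (drv_add fd (drv_opp gd)) e0.
pose h := Num.min (d / 2) (b - t).
have h0 : 0 < h by rewrite lt_min divr_gt0 //= subr_gt0.
have hd : h <= d / 2 by rewrite ge_min lexx.
have hb : h <= b - t by rewrite ge_min lexx orbT.
have zt : t + h - t = h by ring.
have := dP (t + h); rewrite zt (gtr0_norm h0) => H.
have {}H : `|f (t + h) - g (t + h) - (f t - g t) - (df - dg) * h| <= `|df - dg| / 2 * h.
  by apply: H; lra.
move: H; rewrite !fg ?subrr ?sub0r ?normrN ?normrM ?(gtr0_norm h0); try lra.
by rewrite ler_pM2r //; lra.
Qed.

Lemma ac_inv f a b (d : R) : 0 < d -> ac a b f -> (forall t, a <= t -> t <= b -> d <= f t) ->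
  ac a b (fun t => (f t)^-1).
Proof.
move=> d0 acf fd; apply: (ac_lipschitz (K := (d ^+ 2)^-1) acf) => t t' at_ tt t'b.
have f1 := fd t at_ (le_trans tt t'b); have f2 := fd t' (le_trans at_ tt) t'b.
have p1 : 0 < f t by apply: lt_le_trans f1.
have p2 : 0 < f t' by apply: lt_le_trans f2.
have -> : (f t')^-1 - (f t)^-1 = - ((f t' * f t)^-1 * (f t' - f t)) by field; rewrite !gt_eqF.
rewrite normrN normrM ler_wpM2r // ger0_norm ?invr_ge0 ?mulr_ge0 ?(ltW p1) ?(ltW p2) //.
rewrite lef_pV2 ?posrE ?exprn_gt0 ?mulr_gt0 // expr2.
by rewrite ler_pM // ltW.
Qed.

Lemma lip_total (f df : R -> R) : (forall t, is_derive t 1 f (df t)) ->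
  (forall t, `|df t| <= 1) -> forall u v, `|f v - f u| <= `|v - u|.
Proof.
move=> fd df1 u v; wlog uv : u v / u <= v.
  by move=> H; have [/H//|/ltW /H] := leP u v; rewrite distrC (distrC u).
rewrite (ger0_norm (_ : 0 <= v - u)) ?subr_ge0 // -[leRHS]mul1r.
exact: (@mvt_lipschitz _ u v f df).
Qed.

Lemma ac_cos f a b l : ac a b f -> ac a b (fun t => cos (l * f t)).
Proof.
move=> acf; apply: (ac_lipschitz (K := 1) (acZ l acf)) => t t' _ _ _; rewrite mul1r.
by apply: (@lip_total cos (fun t => - sin t)) => z; rewrite normrN sin_max.
Qed.

Lemma ac_sin f a b l : ac a b f -> ac a b (fun t => sin (l * f t)).
Proof.
move=> acf; apply: (ac_lipschitz (K := 1) (acZ l acf)) => t t' _ _ _; rewrite mul1r.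
by apply: (@lip_total sin cos) => z; exact: cos_max.
Qed.

(** [arcX + i arcY = snl l t exp (- i l t) (a + i b)]: on the arc [z2] rotates at constant rate, and
    [a + i b] is the initial direction. *)
Definition arcX l a b t := snl l t * (cos (l * t) * a + sin (l * t) * b).
Definition arcY l a b t := snl l t * (cos (l * t) * b - sin (l * t) * a).

(** * Model arcs minimize, and minimizers off the axis follow them *)

Section Minimality.
Variables (tau : R) (x y c s : R -> R) (l T : R).
Hypotheses (pc : plane_curve tau x y c s) (tau0 : 0 <= tau).
Hypotheses (x0 : x 0 = 0) (y0 : y 0 = 0) (c0 : c 0 = 0) (s0 : s 0 = 0).
Hypotheses (l0 : 0 <= l) (T0 : 0 < T) (Th : 1 < l -> T <= half_period l *+ 2).
Let r := plane_norm x y.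
Hypotheses (rT : snl l T = r tau) (cT : arcK l T <= c tau).

(** The case settled by charge [l] alone: the arc is not past its turning point and the curve stays
    where this charge is valid. *)
Let direct := (1 < l -> T <= half_period l) /\
  (forall t, 0 <= t -> t <= tau -> 1 < l -> r t <= (om l)^-1).

Let legs tm := [/\ 0 <= tm, tm <= tau, r tm = (om l)^-1,
  s tm - s 0 = l * (c tm - c 0) + sgn1 true * (cal l (r tm) - cal l (r 0)) &
  s tau - s tm = l * (c tau - c tm) + sgn1 false * (cal l (r tau) - cal l (r tm))].

Let r0 : r 0 = 0.
Proof. by rewrite /r /plane_norm x0 y0 expr0n addr0 sqrtr0. Qed.

Lemma direct_min : direct -> T <= s tau /\
  (s tau = T -> s tau - s 0 = l * (c tau - c 0) + sgn1 true * (cal l (r tau) - cal l (r 0))).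
Proof.
move=> [Thl V].
have := @calibration tau x y c s pc true l 0 tau (lexx _) tau0 (lexx _).
rewrite c0 s0 -/r r0 cal0 !subr0 /sgn1 mul1r => H.
have {}H : l * c tau + cal l (r tau) <= s tau.
  by apply: H => t t0 tt; apply: charge_valid => //; [exact: plane_norm_ge0|exact: V].
have e : cal l (r tau) = T - l * arcK l T by rewrite -rT cal_arc // ltW.
have := ler_wpM2l l0 cT; rewrite e in H *.
move: H; move: (l * c tau) (l * arcK l T) => u v H h.
by split; [lra|move=> sT; lra].
Qed.

(* Outside the direct case the curve is calibrated, on its way out and on its way back, by
   the charge [m] whose arcs turn back at the maximal radius.  As in the isoperimetric
   problem, the defect is paid for by the arc of length [T'] completing the model arc to a
   full period: calibrating it by [m] bounds [cal m (r tau)] from above. *)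
Lemma indirect_min : ~ direct -> T <= s tau /\
  (s tau = T -> 0 < r tau -> [/\ 1 < l, half_period l <= T, c tau = arcK l T,
    forall t, 0 <= t -> t <= tau -> r t <= (om l)^-1 & exists tm, legs tm]).
Proof.
move=> ndir.
have l1 : 1 < l.
  rewrite ltNge; apply/negP => l1; apply: ndir; split; first by rewrite ltNge l1.
  by move=> t _ _; rewrite ltNge l1.
have [w0 w2] := om_gt1 l1; have lp : 0 < l by apply: lt_trans l1.
have h0 := half_period_gt0 l1; have Th2 := Th l1.
have [_ _ _ _ acr] := pc_ac pc.
have [tm] := EVT_max tau0 (ac_within acr); rewrite in_itv /= -/r => /andP[tm0 tmt] rmax.
have {}rmax t : 0 <= t -> t <= tau -> r t <= r tm.
  by move=> t0 tt; apply: rmax; rewrite in_itv /= t0.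
(* A curve that stays on the axis admits every charge; [T / arcK l T] is the one that yields the
   bound at once. *)
have [rm0|rm0] := eqVneq (r tm) 0.
  have rt : r tau = 0.
    by apply/eqP; rewrite eq_le plane_norm_ge0 andbT -rm0 rmax.
  have TT : T = half_period l *+ 2.
    apply/eqP; rewrite eq_le Th2 /= leNgt; apply/negP => h.
    by have := snl_gt0 l0 T0 (fun=> h); rewrite rT rt ltxx.
  have cp : 0 < arcK l T.
    have hK : pi / 2 < l * half_period l.
      rewrite -(half_om l1) ltr_pM2r // -ltr_sqr ?nnegrE ?(ltW w0) ?(ltW lp) //.
      by rewrite w2 ltrBlDr ltrDl.
    by rewrite TT arcK_full // mulr2n addr_gt0 // arcK_half // subr_gt0.
  have := @calibration tau x y c s pc true (T / arcK l T) 0 tau (lexx _) tau0 (lexx _).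
  rewrite c0 s0 -/r r0 rt cal0 !subr0 mulr0 addr0 => H.
  have {}H : T / arcK l T * c tau <= s tau.
    apply: H => t t0 tt; have -> : r t = 0.
      by apply/eqP; rewrite eq_le plane_norm_ge0 andbT -rm0 rmax.
    by rewrite expr0n mulr0 addr0.
  split; last by rewrite ltxx.
  apply: le_trans H; rewrite -[leLHS](divfK (lt0r_neq0 cp)).
  by rewrite ler_wpM2l // divr_ge0 // ltW.
have rmp : 0 < r tm by rewrite lt_def rm0 plane_norm_ge0.
have [m [m1 wm Vm]] := om_charge rmp.
have mp : 0 < m by apply: lt_trans m1.
have Vm' (q : R) : 0 <= q -> q <= r tm -> 0 <= 1 + (1 - m ^+ 2) * q ^+ 2.
  by move=> q0 qm; apply: charge_valid; [exact: ltW|exact: q0|rewrite wm invrK].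
have [leg legeq] := two_legs pc tm0 tmt x0 y0 c0 s0
  (fun t h h' => Vm' _ (plane_norm_ge0 x y t) (rmax t h h')).
rewrite -/r in leg legeq.
have calm : cal m (r tm) = pi / 2 * (m - om m) by rewrite -[r tm]invrK -wm cal_top.
pose T' := half_period l *+ 2 - T.
have T'0 : 0 <= T' by rewrite subr_ge0.
have T'h : T' <= half_period l *+ 2 by rewrite lerBlDr lerDl ltW.
have rT' : snl l T' = r tau by rewrite /T' snl_refl.
(* Either alternative keeps the completing arc within the radius [r tm], where [m] is valid: it is
   at most [half_period l] long and its radii are at most [r tau], or all its radii are at most
   [(om l)^-1]. *)
have big : half_period l <= T \/ (om l)^-1 < r tm.
  have [hT|hT] := leP (half_period l) T; first by left.
  right; rewrite ltNge; apply/negP => rmo; apply: ndir; split=> [_|t t0 tt _]; first exact: ltW.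
  by apply: le_trans (rmax t t0 tt) rmo.
have rest : cal m (r tau) <= T' - m * arcK l T'.
  rewrite -rT'; apply: arc_cal_le => // t t0 tT'.
  apply: Vm'; first by apply: snl_ge0 => // _; apply: le_trans T'h.
  case: big => [hT|om_r].
    have T'h' : T' <= half_period l by rewrite /T' mulr2n lerBlDr lerD2l.
    apply: (@le_trans _ _ (snl l T')); first by apply: snl_le.
    by rewrite rT' rmax.
  apply: le_trans (ltW om_r); rewrite /snl l1 -[leRHS]mul1r ler_wpM2r ?sin_le1 //.
  by rewrite invr_ge0 ltW.
have sumK := arcK_sum l1 (ltW T0) Th2; rewrite -/T' in sumK.
have [om1 om2] := om_le l1 m1.
have cTm := ler_wpM2l (ltW mp) cT.
have hw : 2 * half_period l * om l = pi by rewrite -mulrA (mulrC (half_period l)) half_om //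
    mulrC divfK ?pnatr_eq0.
(* The completed arc has length [2 * half_period l] and argument [2 * l * half_period l - pi].
   Substituting these isolates two nonnegative defects, the last one by [om_le]. *)
have key : m * c tau + 2 * cal m (r tm) - cal m (r tau) >=
    T + m * (c tau - arcK l T) + 2 * half_period l * (l * m - (1 + om l * om m)).
  rewrite calm.
  have -> : 2 * half_period l * (l * m - (1 + om l * om m)) =
     m * (2 * l * half_period l - pi) + m * pi - 2 * half_period l - 2 * half_period l * om l *
         om m by ring.
  rewrite hw -sumK.
  have -> : 2 * (pi / 2 * (m - om m)) = pi * m - pi * om m by field.
  move: rest; rewrite {1}/T' -mulr_natr.
  move: (cal m (r tau)) (arcK l T') (arcK l T) (om m) (pi : R) (half_period l) (c tau).
  by move=> k1 k2 k3 k4 k5 k6 k7; rewrite !mulrBr !mulrDr; lra.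
have p1 : 0 <= m * (c tau - arcK l T) by rewrite mulr_ge0 ?subr_ge0 // ltW.
have p2 : 0 <= 2 * half_period l * (l * m - (1 + om l * om m)).
  by rewrite mulr_ge0 ?subr_ge0 // mulr_ge0 // ltW.
split; first by lra.
move=> sT rp.
have e2 : 2 * half_period l * (l * m - (1 + om l * om m)) = 0 by lra.
have e1 : m * (c tau - arcK l T) = 0 by lra.
have lm : l = m.
  have hp : 0 < 2 * half_period l by rewrite mulr_gt0.
  apply: om2; rewrite -subr_le0; move/eqP: e2; rewrite mulf_eq0 (gt_eqF hp) /=.
  by move/eqP => ->.
have cE : c tau = arcK l T.
  by move/eqP: e1; rewrite mulf_eq0 (gt_eqF mp) /= subr_eq0 => /eqP.
have rmE : r tm = (om l)^-1 by rewrite lm wm invrK.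
split => //.
- by case: big => //; rewrite rmE ltxx.
- by move=> t t0 tt; rewrite -rmE rmax.
exists tm; rewrite lm in rmE *.
have [|q1 q2] := legeq; first by lra.
by rewrite /legs lm.
Qed.

Lemma minimality : T <= s tau.
Proof.
have [d|nd] := pselect direct; first by have [] := direct_min d.
by have [] := indirect_min nd.
Qed.

Let calibrated sg a b :=
  s b - s a = l * (c b - c a) + sgn1 sg * (cal l (r b) - cal l (r a)).

Let on_arc t := r t = snl l (s t) /\ c t = arcK l (s t).

(** Both parts satisfy the calibration inequality, and the sum of the two is an equality. *)
Lemma calibrated_split sg a t b : 0 <= a -> a <= t -> t <= b -> b <= tau ->
  (forall z, a <= z -> z <= b -> 1 < l -> r z <= (om l)^-1) ->
  calibrated sg a b -> calibrated sg a t /\ calibrated sg t b.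
Proof.
move=> a0 at_ tb bt V.
have V' z : a <= z -> z <= b -> 0 <= 1 + (1 - l ^+ 2) * r z ^+ 2.
  by move=> az zb; apply: charge_valid; [exact: l0|exact: plane_norm_ge0|exact: V].
have h1 := @calibration tau x y c s pc sg l a t a0 at_ (le_trans tb bt).
have h2 := @calibration tau x y c s pc sg l t b (le_trans a0 at_) tb bt.
have {}h1 : l * (c t - c a) + sgn1 sg * (cal l (r t) - cal l (r a)) <= s t - s a.
  by apply: h1 => z az zt; apply: V' => //; apply: le_trans tb.
have {}h2 : l * (c b - c t) + sgn1 sg * (cal l (r b) - cal l (r t)) <= s b - s t.
  by apply: h2 => z az zt; apply: V' => //; apply: le_trans az.
rewrite /calibrated; move: h1 h2; rewrite !mulrBr.
move: (l * c t) (l * c a) (l * c b) (sgn1 sg * cal l (r t)) (sgn1 sg * cal l (r a)) (sgn1 sg *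
    cal l (r b)) (s t) (s a) (s b).
by move=> u1 u2 u3 u4 u5 u6 u7 u8 u9 h1 h2 h3; split; lra.
Qed.

(** By compactness the largest radius on [[a, b]] is [snl l Tm] with [Tm] before the turning time;
    this is the uniform margin that [calibrated_rigid] requires. *)
Lemma rigid_on sg a b : 0 <= a -> a <= b -> b <= tau ->
  (forall z, a <= z -> z <= b -> 1 < l -> r z < (om l)^-1) -> calibrated sg a b ->
  exists ta tb, [/\ 0 <= ta /\ 0 <= tb, (1 < l -> ta < half_period l) /\ (1 < l -> tb <
      half_period l),
    r a = snl l ta /\ r b = snl l tb, c b - c a = sgn1 sg * (arcK l tb - arcK l ta) &
    s b - s a = sgn1 sg * (tb - ta)].
Proof.
move=> a0 ab bt V eq_.
have rise z : a <= z -> z <= b -> exists tz, [/\ 0 <= tz,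
    (1 < l -> tz < half_period l) & snl l tz = r z].
  move=> az zb; have [|tz [tz0 tzh tzr]] := @snl_onto R l (r z) l0 (plane_norm_ge0 x y z).
    by move=> l1; apply: ltW; apply: V.
  exists tz; split => // l1; rewrite lt_neqAle tzh // andbT; apply/eqP => e.
  by have := V z az zb l1; rewrite -tzr e snl_half // ltxx.
have [_ _ _ _ acr] := pc_ac pc.
have [zm] := EVT_max ab (ac_within (acS a0 bt acr)); rewrite in_itv /= -/r => /andP[am mb] rmax.
have [Tm [Tm0 Tmh Tmr]] := rise zm am mb.
have [ta [ta0 tah tar]] := rise a (lexx _) ab.
have [tb [tb0 tbh tbr]] := rise b ab (lexx _).
have leT z tz : a <= z -> z <= b -> 0 <= tz -> (1 < l -> tz < half_period l) -> snl l tz = r z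
    -> tz <= Tm.
  move=> az zb tz0 tzh tzr; rewrite leNgt; apply/negP => Ttz.
  have : snl l Tm < snl l tz by apply: snl_lt => // /tzh /ltW.
  by rewrite tzr Tmr ltNge rmax // in_itv /= az.
have Hr z : a <= z -> z <= b -> r z <= snl l Tm.
  by move=> az zb; rewrite Tmr; apply: rmax; rewrite in_itv /= az.
have [] := @calibrated_rigid tau x y c s pc sg l Tm a b ta tb l0 Tm0 Tmh a0 ab bt Hr ta0
  (leT a ta (lexx _) ab ta0 tah tar) tb0 (leT b tb ab (lexx _) tb0 tbh tbr) (esym tar) (esym
      tbr) eq_.
by exists ta, tb.
Qed.

Lemma rising_leg b t : b <= tau -> (forall z, 0 <= z -> z <= b -> 1 < l -> r z <= (om l)^-1) ->
  calibrated true 0 b -> 0 <= t -> t <= b ->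
  (forall z, 0 <= z -> z <= t -> 1 < l -> r z < (om l)^-1) ->
  on_arc t /\ (1 < l -> s t < half_period l).
Proof.
move=> bt V eq_ t0 tb Vt.
have [eq_t _] := calibrated_split (lexx _) t0 tb bt V eq_.
have [ta [tb' [[ta0 tb0] [tah tbh] [ra rb] ec es]]] := rigid_on (lexx _) t0 (le_trans tb bt) Vt
    eq_t.
have ta_0 : ta = 0.
  apply: (snl_inj l0 ta0 (lexx _)); first by move=> /tah /ltW.
    by move=> /half_period_gt0 /ltW.
  by rewrite -ra r0 snl0.
move: ec es; rewrite ta_0 arcK0 /sgn1 !mul1r c0 s0 !subr0 => ec es.
by rewrite /on_arc es.
Qed.

Let slen t : 0 <= t -> t <= tau -> 0 <= s t.
Proof. by move=> t0 tt; rewrite -s0; apply: (arclen_le pc). Qed.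

Let ac_snl_s : 1 < l -> ac 0 tau (fun t => snl l (s t)).
Proof.
move=> l1; have [_ _ _ acs _] := pc_ac pc.
apply: (ac_lipschitz (K := 1) acs) => t t' t0 tt t'_.
have st : s t <= s t' by apply: (arclen_le pc).
rewrite [X in _ * X]ger0_norm ?subr_ge0 //.
apply: (@mvt_lipschitz _ (s t) (s t') _ (csl l)) => // z _ _; first exact: snl_derive.
by have [_ ->] := snlE_gt l1; exact: cos_max.
Qed.

Let ac_arcK_s : ac 0 tau (fun t => arcK l (s t)).
Proof.
have [_ _ _ acs _] := pc_ac pc.
apply: (ac_lipschitz (K := l) acs) => t t' t0 tt t'_.
have st : s t <= s t' by apply: (arclen_le pc).
have st0 : 0 <= s t by apply: slen => //; apply: le_trans t'_.
rewrite [X in _ * X]ger0_norm ?subr_ge0 //.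
apply: (@mvt_lipschitz _ (s t) (s t') _ (arcK_slope l)) => // z zs _.
  by apply: arcK_derive => //; apply: le_trans zs.
rewrite ger0_norm ?arcK_slope_ge0 // /arcK_slope -mulrA -[leRHS]mulr1 ler_wpM2l //.
by rewrite ler_pdivrMr ?oneDx_gt0 // mul1r lerDr.
Qed.

Let r_lt (t : R) : (1 < l -> r t <= (om l)^-1) -> r t != (om l)^-1 -> 1 < l -> r t < (om l)^-1.
Proof. by move=> h n l1; rewrite lt_neqAle n h. Qed.

(** Rigidity holds only while the radius is strictly below [(om l)^-1]; the first hitting time [t1]
    is reached by a limit from the left. *)
Lemma rising_hit b : 1 < l -> 0 <= b -> b <= tau ->
  (forall z, 0 <= z -> z <= b -> 1 < l -> r z <= (om l)^-1) ->
  calibrated true 0 b -> r b = (om l)^-1 ->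
  exists t1, [/\ 0 <= t1, t1 <= b, s t1 = half_period l &
    forall t, 0 <= t -> t <= t1 -> on_arc t].
Proof.
move=> l1 b0 bt V eq_ rb; have [w0 w2] := om_gt1 l1; have h0 := half_period_gt0 l1.
have [_ _ acc acs acr] := pc_ac pc.
have [t1 [t10 t1b rt1 t1P]] := first_hit (acS (lexx _) bt acr) b0 rb.
have t1t : t1 <= tau by apply: le_trans bt.
have t1p : 0 < t1.
  rewrite lt_def t10 andbT; apply/eqP => e.
  by move: rt1; rewrite e -/r r0 => /esym/eqP; rewrite invr_eq0 gt_eqF.
have P t : 0 <= t -> t < t1 -> on_arc t /\ (1 < l -> s t < half_period l).
  move=> t0 tt1; apply: (rising_leg bt V eq_ t0); first exact: (le_trans (ltW tt1)).
  move=> z z0 zt l1'; apply: r_lt => //; first by apply: V => //;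
      apply: le_trans (le_trans (ltW tt1) t1b).
  by apply: t1P => //; apply: le_lt_trans tt1.
have lim (f : R -> R) : ac 0 tau f -> (forall t, 0 <= t -> t < t1 -> 0 <= f t) -> 0 <= f t1.
  by move=> acf; apply: left_lim_ge0 => //; apply: acS acf.
have rE : r t1 = snl l (s t1).
  apply/eqP; rewrite eq_le -subr_ge0 -[X in _ && X]subr_ge0; apply/andP; split.
    apply: (lim (fun t => snl l (s t) - r t)); first by apply: acB => //; exact: ac_snl_s.
    by move=> t t0 tt1; have [[-> _] _] := P t t0 tt1; rewrite subrr.
  apply: (lim (fun t => r t - snl l (s t))); first by apply: acB => //; exact: ac_snl_s.
  by move=> t t0 tt1; have [[-> _] _] := P t t0 tt1; rewrite subrr.
have cE : c t1 = arcK l (s t1).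
  apply/eqP; rewrite eq_le -subr_ge0 -[X in _ && X]subr_ge0; apply/andP; split.
    apply: (lim (fun t => arcK l (s t) - c t)); first by apply: acB => //; exact: ac_arcK_s.
    by move=> t t0 tt1; have [[_ ->] _] := P t t0 tt1; rewrite subrr.
  apply: (lim (fun t => c t - arcK l (s t))); first by apply: acB => //; exact: ac_arcK_s.
  by move=> t t0 tt1; have [[_ ->] _] := P t t0 tt1; rewrite subrr.
have sh : s t1 <= half_period l.
  rewrite -subr_ge0; apply: (lim (fun t => half_period l - s t)).
    by apply: acB => //; exact: ac_const.
  by move=> t t0 tt1; have [_ /(_ l1) h] := P t t0 tt1; rewrite subr_ge0 ltW.
exists t1; split => //.
  apply: (snl_inj l0) => //; [exact: slen|exact: ltW|].
  by rewrite -rE (rt1 : r t1 = _) snl_half.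
move=> t t0; rewrite le_eqVlt => /predU1P[->|tt1]; first by split.
by have [] := P t t0 tt1.
Qed.

(** The mirror image of [rising_hit]: the returning leg is read through the reflection of the arc at
    its turning time, starting from the end point, and the last hitting time is a limit from the
    right. *)
Lemma falling_hit a : 1 < l -> 0 <= a -> a <= tau ->
  (forall z, a <= z -> z <= tau -> 1 < l -> r z <= (om l)^-1) ->
  calibrated false a tau -> r a = (om l)^-1 -> half_period l <= T ->
  s tau = T -> c tau = arcK l T ->
  exists t2, [/\ a <= t2, t2 <= tau, s t2 = half_period l &
    forall t, t2 <= t -> t <= tau -> on_arc t].
Proof.
move=> l1 a0 at_ V eq_ ra hT sT cT'; have [w0 w2] := om_gt1 l1; have h0 := half_period_gt0 l1.
have [_ _ acc acs acr] := pc_ac pc.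
have [t2 [t2a t2t rt2 t2P]] := last_hit (acS a0 (lexx _) acr) at_ ra.
have t20 : 0 <= t2 by apply: le_trans t2a.
have Th2 := Th l1.
have T'0 : 0 <= half_period l *+ 2 - T by rewrite subr_ge0.
have T'h : half_period l *+ 2 - T <= half_period l by rewrite mulr2n lerBlDr lerD2l.
have P t : t2 < t -> t <= tau -> on_arc t /\ half_period l <= s t.
  move=> t2t' tt; have at' : a <= t by apply: le_trans t2a (ltW t2t').
  have t0 : 0 <= t by apply: le_trans at'.
  have [_ eq_t] := calibrated_split a0 at' tt (lexx _) V eq_.
  have Vt z : t <= z -> z <= tau -> 1 < l -> r z < (om l)^-1.
    move=> tz zt l1'; apply: r_lt => //; first by apply: V => //; apply: le_trans tz.
    by apply: t2P => //; apply: lt_le_trans tz.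
  have [ta [tb [[ta0 tb0] [tah tbh] [ra' rb] ec es]]] := rigid_on t0 tt (lexx _) Vt eq_t.
  have tbE : tb = half_period l *+ 2 - T.
    apply: (snl_inj l0 tb0 T'0) => //; first by move=> /tbh /ltW.
    by rewrite -rb -rT snl_refl.
  have ta_h := ltW (tah l1).
  have tah2 : ta <= half_period l *+ 2 by apply: le_trans ta_h _; rewrite mulr2n lerDl ltW.
  have sE : s t = half_period l *+ 2 - ta.
    by move: es; rewrite sT tbE /sgn1; move: (s t) (half_period l *+ 2) => u v; lra.
  have sumK := arcK_refl l1 (ltW T0) Th2.
  split; last by rewrite sE mulr2n; lra.
  split; first by rewrite ra' sE snl_refl.
  rewrite sE arcK_refl //; move: ec sumK; rewrite cT' tbE /sgn1.
  by move: (arcK l _) (arcK l T) (arcK l ta) (c t) (arcK l (half_period l) *+ 2) => u v w z q;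
      lra.
have lim (f : R -> R) : ac 0 tau f -> 0 <= f tau -> (forall t,
    t2 < t -> t <= tau -> 0 <= f t) -> 0 <= f t2.
  move=> acf ft; have [->//|t2n H] := eqVneq t2 tau.
  apply: (@right_lim_ge0 f t2 tau); [exact: acS acf| |exact: H].
  by rewrite lt_neqAle t2n.
have rtau : r tau = snl l (s tau) by rewrite sT rT.
have ctau : c tau = arcK l (s tau) by rewrite sT cT'.
have rE : r t2 = snl l (s t2).
  apply/eqP; rewrite eq_le -subr_ge0 -[X in _ && X]subr_ge0; apply/andP; split.
    apply: (lim (fun t => snl l (s t) - r t)); [by apply: acB => //;
        exact: ac_snl_s|by rewrite rtau subrr|].
    by move=> t t0 tt1; have [[-> _] _] := P t t0 tt1; rewrite subrr.
  apply: (lim (fun t => r t - snl l (s t))); [by apply: acB => //;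
      exact: ac_snl_s|by rewrite rtau subrr|].
  by move=> t t0 tt1; have [[-> _] _] := P t t0 tt1; rewrite subrr.
have cE : c t2 = arcK l (s t2).
  apply/eqP; rewrite eq_le -subr_ge0 -[X in _ && X]subr_ge0; apply/andP; split.
    apply: (lim (fun t => arcK l (s t) - c t)); [by apply: acB => //;
        exact: ac_arcK_s|by rewrite ctau subrr|].
    by move=> t t0 tt1; have [[_ ->] _] := P t t0 tt1; rewrite subrr.
  apply: (lim (fun t => c t - arcK l (s t))); [by apply: acB => //;
      exact: ac_arcK_s|by rewrite ctau subrr|].
  by move=> t t0 tt1; have [[_ ->] _] := P t t0 tt1; rewrite subrr.
have sh : half_period l <= s t2.
  rewrite -subr_ge0; apply: (lim (fun t => s t - half_period l)).
  - by apply: acB => //; exact: ac_const.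
  - by rewrite sT subr_ge0.
  - by move=> t t0 tt1; have [_ h] := P t t0 tt1; rewrite subr_ge0.
have sT2 : s t2 <= T by rewrite -sT; apply: (arclen_le pc).
exists t2; split => //.
  have e : half_period l *+ 2 - s t2 = half_period l.
    apply: (snl_inj l0) => //; first by rewrite subr_ge0 (le_trans sT2).
    - exact: ltW.
    - by move=> _; rewrite mulr2n lerBlDr lerD2l.
    - by rewrite snl_refl // -rE (rt2 : r t2 = _) snl_half.
  by move: e; rewrite mulr2n; move: (half_period l) (s t2) => u v; lra.
move=> t; rewrite le_eqVlt => /predU1P[<-|t2t']; first by move=> _; split.
by move=> tt; have [] := P t t2t' tt.
Qed.

Lemma on_arc_const t t' : 0 <= t -> t <= t' -> t' <= tau -> s t = s t' -> on_arc t -> on_arc t'.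
Proof.
move=> t0 tt t't ss [h1 h2]; have [e1 e2 e3] := arclen_const pc t0 tt t't ss.
by rewrite /on_arc /r /plane_norm e1 e2 e3 -ss -h1 -h2.
Qed.

(** Besides the two legs only a pause at the turning point is possible: there [s] is constant, hence
    so is the curve. In the direct case such a pause can only come at the end, since
    [T <= half_period l]. *)
Lemma minimal_on_arc : s tau = T -> 0 < r tau -> forall t, 0 <= t -> t <= tau -> on_arc t.
Proof.
move=> sT rp t t0 tt; have [d|nd] := pselect direct.
  have [_ /(_ sT) eq_] := direct_min d; case: d => Thl V.
  have [allt|] := pselect (forall z, 0 <= z -> z <= t -> 1 < l -> r z < (om l)^-1).
    by have [] := rising_leg (lexx _) V eq_ t0 tt allt.
  move=> nall.
  have [z [z0 zt l1 rz]] : exists z, [/\ 0 <= z, z <= t, 1 < l & r z = (om l)^-1].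
    apply: contrapT => nz; apply: nall => z z0 zt l1.
    apply: r_lt => //; first exact: (V z z0 (le_trans zt tt)).
    by apply/eqP => rz; apply: nz; exists z.
  have zT : z <= tau by apply: le_trans tt.
  have Vz q : 0 <= q -> q <= z -> 1 < l -> r q <= (om l)^-1.
    by move=> q0 qz; apply: V => //; apply: le_trans zT.
  have [eqz _] := calibrated_split (lexx _) z0 zT (lexx _) V eq_.
  have [t1 [t10 t1z st1 t1P]] := rising_hit l1 z0 zT Vz eqz rz.
  have [tt1|/ltW t1t] := leP t t1; first exact: t1P.
  apply: (on_arc_const t10 t1t tt) (t1P _ t10 (lexx _)).
  apply/eqP; rewrite eq_le (arclen_le pc t10 t1t tt) st1 /=.
  by apply: le_trans (Thl l1); rewrite -sT; apply: (arclen_le pc).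
have [_ /(_ sT rp) [l1 hT cE V [tm [tm0 tmt rm e1 e2]]]] := indirect_min nd.
have [|t1 [t10 t1m st1 t1P]] := rising_hit l1 tm0 tmt _ e1 rm.
  by move=> z z0 zt _; apply: V => //; apply: le_trans tmt.
have [|t2 [t2m t2t st2 t2P]] := falling_hit l1 tm0 tmt _ e2 rm hT sT cE.
  by move=> z z0 zt _; apply: V => //; apply: le_trans z0.
have [tt1|/ltW t1t] := leP t t1; first exact: t1P.
have [tt2|/ltW t2t'] := leP t t2; last exact: t2P.
apply: (on_arc_const t10 t1t tt) (t1P _ t10 (lexx _)).
apply/eqP; rewrite eq_le (arclen_le pc t10 t1t tt) st1 -st2 /=.
by apply: (arclen_le pc) => //; apply: le_trans t1t.
Qed.

Variables (a b : R).
Hypotheses (xT : x tau = arcX l a b T) (yT : y tau = arcY l a b T).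

(** Radius and argument determine the velocity of [x + i y]. Hence
    [P + i Q = (x + i y) exp (i l s)], divided by the radius, has zero derivative almost everywhere;
    its value at [tau] is [a + i b]. *)
Lemma minimal_unique : s tau = T -> 0 < r tau -> forall t, 0 <= t -> t <= tau ->
  [/\ x t = arcX l a b (s t), y t = arcY l a b (s t) & c t = arcK l (s t)].
Proof.
move=> sT rp t t0 tt; have arcP := minimal_on_arc sT rp.
have [rt ct] := arcP t t0 tt.
have r2 z : r z ^+ 2 = x z ^+ 2 + y z ^+ 2 by exact: plane_norm2.
have st0 : 0 <= s t by apply: slen.
have [s_0|sn0] := eqVneq (s t) 0.
  rewrite /arcX /arcY s_0 snl0 !mul0r -s_0; split => //.
    by move/eqP: (r2 t); rewrite rt s_0 snl0 expr0n eq_sym paddr_eq0 ?sqr_ge0 // !sqrf_eq0 =>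
        /andP[/eqP].
  by move/eqP: (r2 t); rewrite rt s_0 snl0 expr0n eq_sym paddr_eq0 ?sqr_ge0 // !sqrf_eq0 =>
      /andP[_ /eqP].
have sp : 0 < s t by rewrite lt_def sn0.
have Tlt : 1 < l -> T < half_period l *+ 2.
  move=> l1; rewrite lt_neqAle Th // andbT; apply/eqP => e.
  by move: rp; rewrite -rT e -[half_period l *+ 2]subr0 snl_refl // snl0 ltxx.
have rpos z : t <= z -> z <= tau -> 0 < r z.
  move=> tz zt; have [-> _] := arcP z (le_trans t0 tz) zt.
  apply: snl_gt0 => //; first by apply: lt_le_trans sp _; apply: (arclen_le pc).
  by move=> /Tlt; apply: le_lt_trans; rewrite -sT; apply: (arclen_le pc) => //;
      apply: le_trans tz.
have [acx acy acc acs acr] := pc_ac pc.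
have acr' := acS t0 (lexx _) acr.
have [zm] := EVT_min tt (ac_within acr'); rewrite in_itv /= => /andP[tzm zmt] rmin.
have acrV : ac t tau (fun z => (r z)^-1).
  apply: (ac_inv (d := r zm)) => //; first exact: rpos.
  by move=> z tz zt; apply: rmin; rewrite in_itv /= tz.
have accos : ac t tau (fun z => cos (l * s z)) by apply: acS (ac_cos l acs).
have acsin : ac t tau (fun z => sin (l * s z)) by apply: acS (ac_sin l acs).
have acx' := acS t0 (lexx _) acx; have acy' := acS t0 (lexx _) acy.
pose P z := x z * cos (l * s z) - y z * sin (l * s z).
pose Q z := x z * sin (l * s z) + y z * cos (l * s z).
have acP : ac t tau (fun z => P z * (r z)^-1).
  by apply: acM => //; apply: acB; apply: acM.
have acQ : ac t tau (fun z => Q z * (r z)^-1).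
  by apply: acM => //; apply: acD; apply: acM.
have derivs : {ae mu, forall z, z \in `[t, tau] ->
    is_derive z 1 (fun z => P z * (r z)^-1) 0 /\ is_derive z 1 (fun z => Q z * (r z)^-1) 0}.
  case: pc => _ _ _ _ ae; have ae' := ae_and ae (ae_and (@ae_neq R 0) (@ae_neq R tau)).
  apply: ae_imply ae' => z [+ [zn0 znt]]; rewrite !in_itv /= => H /andP[tz zt].
  have z0 : 0 <= z by apply: le_trans tz.
  have [px [py [n [n0 dx dy ds [dc pn]]]]] : exists px py n,
     [/\ 0 <= n, is_derive z 1 x px, is_derive z 1 y py, is_derive z 1 s n &
      is_derive z 1 c ((y z * px - x z * py) / (1 + (x z ^+ 2 + y z ^+ 2))) /\
      px ^+ 2 + py ^+ 2 = (1 + (x z ^+ 2 + y z ^+ 2)) * n ^+ 2].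
    by apply: H; rewrite z0.
  have zp : 0 < z by rewrite lt_def zn0.
  have zlt : z < tau by rewrite lt_neqAle znt.
  have rz := rpos z tz zt; have [rzE czE] := arcP z z0 zt.
  have dr : is_derive z 1 r ((x z * px + y z * py) / r z).
    have p : 0 < x z ^+ 2 + y z ^+ 2 by rewrite -r2 exprn_gt0.
    rewrite /r /plane_norm; der => //; rewrite -/(plane_norm x y z) -/r; field.
    by rewrite gt_eqF.
  have dS := drv_comp (snl_derive (s z) l0) ds.
  have dK := drv_comp (arcK_derive l0 (slen z0 zt)) ds.
  (* The radial and angular velocities, obtained by differentiating the two identities of
     [on_arc]. *)
  have E1 : x z * px + y z * py = r z * csl l (s z) * n.
    have := @derive_uniq r _ 0 tau z _ _ zp zlt (fun q q0 qt => (arcP q q0 qt).1) dr dS.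
    by move=> /(congr1 (fun q => q * r z)); rewrite divfK ?gt_eqF // => ->; ring.
  have E2 : y z * px - x z * py = l * r z ^+ 2 * n.
    have := @derive_uniq c _ 0 tau z _ _ zp zlt (fun q q0 qt => (arcP q q0 qt).2) dc dK.
    rewrite -r2 /arcK_slope -rzE => /(congr1 (fun q => q * (1 + r z ^+ 2))).
    have q0 : 1 + r z ^+ 2 != 0 by rewrite gt_eqF // oneDx_gt0.
    by rewrite divfK // => ->; field.
  have rn : r z != 0 by rewrite gt_eqF.
  have pxE : px = (x z * (r z * csl l (s z) * n) + y z * (l * r z ^+ 2 * n)) / r z ^+ 2.
    by apply: (mulIf (expf_neq0 2 rn)); rewrite divfK ?expf_neq0 // -E1 -E2 r2; ring.
  have pyE : py = (y z * (r z * csl l (s z) * n) - x z * (l * r z ^+ 2 * n)) / r z ^+ 2.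
    by apply: (mulIf (expf_neq0 2 rn)); rewrite divfK ?expf_neq0 // -E1 -E2 r2; ring.
  split; rewrite /P /Q; der; rewrite E1 pxE pyE; field; exact: rn.
have eP : P tau / r tau = P t / r t.
  by apply: ae_derive0 tt acP _; apply: ae_imply derivs => z h zt; have [] := h zt.
have eQ : Q tau / r tau = Q t / r t.
  by apply: ae_derive0 tt acQ _; apply: ae_imply derivs => z h zt; have [] := h zt.
have rt0 : r t != 0 by rewrite gt_eqF // rpos.
have rT0 : r tau != 0 by rewrite gt_eqF.
have cs := cos2Dsin2 (l * T).
have aE : P tau / r tau = a.
  rewrite /P sT xT yT /arcX /arcY rT.
  have -> : r tau * (cos (l * T) * a + sin (l * T) * b) * cos (l * T) -
     r tau * (cos (l * T) * b - sin (l * T) * a) * sin (l * T) =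
     r tau * a * (cos (l * T) ^+ 2 + sin (l * T) ^+ 2) by ring.
  by rewrite cs; field.
have bE : Q tau / r tau = b.
  rewrite /Q sT xT yT /arcX /arcY rT.
  have -> : r tau * (cos (l * T) * a + sin (l * T) * b) * sin (l * T) +
     r tau * (cos (l * T) * b - sin (l * T) * a) * cos (l * T) =
     r tau * b * (cos (l * T) ^+ 2 + sin (l * T) ^+ 2) by ring.
  by rewrite cs; field.
have Pt : P t = r t * a by rewrite -aE eP mulrC divfK.
have Qt : Q t = r t * b by rewrite -bE eQ mulrC divfK.
have cst := cos2Dsin2 (l * s t).
split => //; rewrite /arcX /arcY -rt.
- rewrite (_ : r t * _ = r t * a * cos (l * s t) + r t * b * sin (l * s t)); last by ring.
  rewrite -Pt -Qt /P /Q [RHS](_ : _ = x t * (cos (l * s t) ^+ 2 + sin (l * s t) ^+ 2));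
      last by ring.
  by rewrite cst mulr1.
- rewrite (_ : r t * _ = r t * b * cos (l * s t) - r t * a * sin (l * s t)); last by ring.
  rewrite -Pt -Qt /P /Q [RHS](_ : _ = y t * (cos (l * s t) ^+ 2 + sin (l * s t) ^+ 2));
      last by ring.
  by rewrite cst mulr1.
Qed.

End Minimality.
End PlaneCurves.

(** * Reflection and model geodesics to all end points *)

Section Geodesics.
Variable R : realType.
Implicit Types (x y c s X Y K : R -> R) (a b t l T : R).

Lemma sgn1_sq sg : sgn1 R sg ^+ 2 = 1.
Proof. by case: sg; rewrite /sgn1 ?sqrrN expr1n. Qed.

Lemma sgn1K sg (u : R) : sgn1 R sg * (sgn1 R sg * u) = u.
Proof. by rewrite mulrA -expr2 sgn1_sq mul1r. Qed.

Lemma sgn1_norm (u : R) : sgn1 R (0 <= u) * u = `|u|.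
Proof.
by case: (leP 0 u) => h; rewrite /sgn1 ?mul1r ?mulN1r; [rewrite ger0_norm|rewrite ltr0_norm].
Qed.

(** Conjugating both matrix entries reverses the argument and keeps lengths, which reduces
    everything to nonnegative arguments. *)
Lemma plane_curve_reflect sg tau x y c s : plane_curve tau x y c s ->
  plane_curve tau x (fun t => sgn1 R sg * y t) (fun t => sgn1 R sg * c t) s.
Proof.
move=> [acx acy acc acs ae]; split => //; try exact: acZ.
apply: ae_imply ae => t h /h [px [py [n [n0 dx dy ds [dc pn]]]]].
exists px, (sgn1 R sg * py), n; rewrite !exprMn sgn1_sq !mul1r.
split => //; first by der; rewrite mul0r add0r.
split => //; der; rewrite mul0r add0r; ring.
Qed.

Lemma plane_norm_reflect sg x y t : plane_norm x (fun t => sgn1 R sg * y t) t = plane_norm x y t.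
Proof. by rewrite /plane_norm exprMn sgn1_sq mul1r. Qed.

(** Competitors may have a larger argument of either sign, because on SU(1,1) the argument is known
    only modulo [2 pi]. [mg_range] serves to tell the geodesics with arguments [pi] and [- pi]
    apart, and [mg_axis], through a radius attained only once, a geodesic back to the axis from its
    rotated copy. *)
Record model_geodesic (x1 y1 c1 T : R) (X Y K dX dY : R -> R) : Prop := {
  mg_gt0 : 0 < T;
  mg_start : [/\ X 0 = 0, Y 0 = 0 & K 0 = 0];
  mg_end : [/\ X T = x1, Y T = y1 & K T = c1];
  mg_cont : continuous dX /\ continuous dY;
  mg_der : forall t, 0 <= t -> t <= T ->
    [/\ is_derive t 1 X (dX t), is_derive t 1 Y (dY t),
        is_derive t 1 K ((Y t * dX t - X t * dY t) / (1 + (X t ^+ 2 + Y t ^+ 2))) &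
        dX t ^+ 2 + dY t ^+ 2 = 1 + (X t ^+ 2 + Y t ^+ 2)];
  mg_range : forall t, 0 <= t -> t <= T ->
    (0 <= c1 -> 0 <= K t <= c1) /\ (c1 <= 0 -> c1 <= K t <= 0);
  mg_min : forall tau x y c s, 0 <= tau -> plane_curve tau x y c s ->
    x 0 = 0 -> y 0 = 0 -> c 0 = 0 -> s 0 = 0 -> x tau = x1 -> y tau = y1 ->
    `|c1| <= `|c tau| -> T <= s tau;
  mg_unique : forall tau x y c s, 0 <= tau -> plane_curve tau x y c s ->
    x 0 = 0 -> y 0 = 0 -> c 0 = 0 -> s 0 = 0 -> x tau = x1 -> y tau = y1 ->
    `|c1| <= `|c tau| -> s tau = T -> x1 ^+ 2 + y1 ^+ 2 != 0 ->
    `|c tau| = `|c1| /\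
    (c tau = c1 -> forall t, 0 <= t -> t <= tau ->
       [/\ x t = X (s t), y t = Y (s t) & c t = K (s t)]);
  mg_axis : x1 ^+ 2 + y1 ^+ 2 = 0 -> exists t0,
    [/\ 0 < t0, t0 < T, X t0 ^+ 2 + Y t0 ^+ 2 != 0 &
     forall t, 0 <= t -> t <= T -> X t ^+ 2 + Y t ^+ 2 = X t0 ^+ 2 + Y t0 ^+ 2 -> t = t0] }.

Definition darcX l a b t :=
  csl l t * (cos (l * t) * a + sin (l * t) * b) +
  l * snl l t * (cos (l * t) * b - sin (l * t) * a).
Definition darcY l a b t :=
  csl l t * (cos (l * t) * b - sin (l * t) * a) -
  l * snl l t * (cos (l * t) * a + sin (l * t) * b).

Lemma arcX_derive l a b t : 0 <= l -> is_derive t 1 (arcX l a b) (darcX l a b t).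
Proof.
by move=> l0; have d := snl_derive t l0; rewrite /arcX /darcX; der; ring.
Qed.

Lemma arcY_derive l a b t : 0 <= l -> is_derive t 1 (arcY l a b) (darcY l a b t).
Proof.
by move=> l0; have d := snl_derive t l0; rewrite /arcY /darcY; der; ring.
Qed.

Lemma darc_cont l a b : 0 <= l -> continuous (darcX l a b) /\ continuous (darcY l a b).
Proof.
move=> l0.
have D f (df : R -> R) : (forall t, is_derive t 1 f (df t)) -> continuous f.
  move=> fd t; apply: differentiable_continuous; apply/derivable1_diffP.
  by have /@ex_derive := fd t.
split; apply: D => t; have d1 := snl_derive t l0; have d2 := csl_derive t l0;
  rewrite /darcX /darcY; der; reflexivity.
Qed.

Lemma unit_rot a b (z : R) : a ^+ 2 + b ^+ 2 = 1 ->
  (cos z * a + sin z * b) ^+ 2 + (cos z * b - sin z * a) ^+ 2 = 1.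
Proof.
move=> ab; have := cos2Dsin2 z => cs.
rewrite (_ : _ + _ = (cos z ^+ 2 + sin z ^+ 2) * (a ^+ 2 + b ^+ 2)); last by ring.
by rewrite cs ab mulr1.
Qed.

Lemma arc_sq l a b t : a ^+ 2 + b ^+ 2 = 1 ->
  arcX l a b t ^+ 2 + arcY l a b t ^+ 2 = snl l t ^+ 2.
Proof. by move=> ab; rewrite !exprMn -mulrDr unit_rot // mulr1. Qed.

Lemma darc_sq l a b t : 0 <= l -> a ^+ 2 + b ^+ 2 = 1 ->
  darcX l a b t ^+ 2 + darcY l a b t ^+ 2 = 1 + snl l t ^+ 2.
Proof.
move=> l0 ab; have := unit_rot (l * t) ab; rewrite /darcX /darcY.
move: (cos _ * a + _) (cos _ * b - _) => u v uv.
rewrite (_ : _ + _ = (csl l t ^+ 2 + l ^+ 2 * snl l t ^+ 2) * (u ^+ 2 + v ^+ 2)); last by ring.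
by rewrite uv csl2 //; ring.
Qed.

Lemma arc_area l a b t : a ^+ 2 + b ^+ 2 = 1 ->
  arcY l a b t * darcX l a b t - arcX l a b t * darcY l a b t = l * snl l t ^+ 2.
Proof.
move=> ab; have := unit_rot (l * t) ab; rewrite /darcX /darcY /arcX /arcY.
move: (cos _ * a + _) (cos _ * b - _) => u v uv.
rewrite (_ : _ - _ = l * snl l t ^+ 2 * (u ^+ 2 + v ^+ 2)); last by ring.
by rewrite uv mulr1.
Qed.

Lemma model_geodesic_exists (x1 y1 c1 : R) : (x1 ^+ 2 + y1 ^+ 2 != 0) || (c1 != 0) ->
  exists T X Y K dX dY, model_geodesic x1 y1 c1 T X Y K dX dY.
Proof.
move=> ne; pose r1 := Num.sqrt (x1 ^+ 2 + y1 ^+ 2); pose sg := 0 <= c1; pose e := sgn1 R sg.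
have q0 : 0 <= x1 ^+ 2 + y1 ^+ 2 by rewrite addr_ge0 ?sqr_ge0.
have r12 : r1 ^+ 2 = x1 ^+ 2 + y1 ^+ 2 by rewrite sqr_sqrtr.
have r10 : 0 <= r1 by exact: sqrtr_ge0.
have [|l [T [l0 T0 Th rT cT]]] := @arc_exists R r1 `|c1| r10 (normr_ge0 _).
  by rewrite normr_eq0 -(sqrf_eq0 r1) r12.
have e2 : e ^+ 2 = 1 by exact: sgn1_sq.
have ec : e * c1 = `|c1| by exact: sgn1_norm.
have [a [b [ab xT yT]]] : exists a b, [/\ a ^+ 2 + b ^+ 2 = 1,
    x1 = arcX l a b T & e * y1 = arcY l a b T].
  have [r1z|r1n] := eqVneq r1 0.
    (* For an end point on the axis the initial direction is free; this freedom is the source of the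
       cut locus there. *)
    exists 1, 0; rewrite expr1n expr0n addr0 /arcX /arcY rT r1z !mul0r; split => //.
      by move/eqP: r12; rewrite r1z expr0n eq_sym paddr_eq0 ?sqr_ge0 // !sqrf_eq0 => /andP[/eqP].
    move/eqP: r12; rewrite r1z expr0n eq_sym paddr_eq0 ?sqr_ge0 // !sqrf_eq0 => /andP[_ /eqP ->].
    by rewrite mulr0.
  have cs := cos2Dsin2 (l * T).
  pose w := e * y1; have w2 : w ^+ 2 = y1 ^+ 2 by rewrite exprMn e2 mul1r.
  exists ((x1 * cos (l * T) - w * sin (l * T)) / r1), ((x1 * sin (l * T) + w * cos (l * T)) / r1).
  rewrite /arcX /arcY rT -/w; split.
  - rewrite !expr_div_n -mulrDl r12 -w2.
    rewrite [X in X / _](_ : _ = (x1 ^+ 2 + w ^+ 2) * (cos (l * T) ^+ 2 + sin (l * T) ^+ 2));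
        last by ring.
    by rewrite cs mulr1 divff // w2 -r12 expf_neq0.
  - rewrite -[LHS]mulr1 -cs; field; exact: r1n.
  - rewrite -[LHS]mulr1 -cs; field; exact: r1n.
pose X := arcX l a b; pose Y t := e * arcY l a b t; pose K t := e * arcK l t.
pose dX := darcX l a b; pose dY t := e * darcY l a b t.
have XY t : X t ^+ 2 + Y t ^+ 2 = snl l t ^+ 2.
  by rewrite /Y [(e * _) ^+ 2]exprMn e2 mul1r arc_sq.
have radE (x y : R -> R) tau : x tau = x1 -> y tau = y1 -> snl l T = plane_norm x y tau.
  by move=> xE yE; rewrite rT /r1 /plane_norm xE yE.
have yE : Y T = y1 by rewrite /Y -yT /e sgn1K.
have cE : K T = c1 by rewrite /K cT -ec /e sgn1K.
exists T, X, Y, K, dX, dY; split.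
- exact: T0.
- by rewrite /X /Y /K /arcX /arcY snl0 arcK0 !mul0r mulr0.
- by [].
- have [c_X c_Y] := darc_cont a b l0; split => //.
  by move=> t; apply: cnt_mul; [exact: cnt_cst|exact: c_Y].
- move=> t t0 tT; rewrite XY; split.
  + exact: arcX_derive.
  + by have d := arcY_derive a b t l0; rewrite /Y /dY; der; rewrite mul0r add0r.
  + have d := arcK_derive l0 t0; rewrite /K; der; rewrite mul0r add0r /arcK_slope -(arc_area l t
      ab).
    by rewrite /X /Y /dX /dY; ring.
  + by rewrite /dY [(e * _) ^+ 2]exprMn e2 mul1r darc_sq.
- move=> t t0 tT.
  have K0 : 0 <= arcK l t <= arcK l T by rewrite arcK_le // andbT -(arcK0 l) arcK_le.
  have eK : arcK l T = e * c1 by rewrite cT ec.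
  move: K0; rewrite eK /K; move: ec; rewrite /e /sgn1 /sg; move: (arcK l t) => k.
  case: (leP 0 c1) => c10; rewrite ?mul1r ?mulN1r => ec' /andP[k0 k1].
    by split=> h; rewrite ?k0 ?k1 //; apply/andP; split; lra.
  by split=> h; apply/andP; split; lra.
- move=> tau x y c s tau0 pc x0 y0 c0 s0 xE' yE' cle.
  (* The sign is that of the competitor's argument and not that of [c1], since only
     [|c1| <= |c tau|] is given. *)
  have pc' := plane_curve_reflect (0 <= c tau) pc.
  apply: (@minimality R tau x _ _ s l T pc' tau0 x0) => //.
  + by rewrite y0 mulr0.
  + by rewrite c0 mulr0.
  + by rewrite plane_norm_reflect; apply: radE.
  + by rewrite sgn1_norm cT.
- move=> tau x y c s tau0 pc x0 y0 c0 s0 xE' yE' cle sT rn.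
  have rp : 0 < plane_norm x y tau by rewrite sqrtr_gt0 xE' yE' lt_def rn.
  split.
    have pc' := plane_curve_reflect (0 <= c tau) pc.
    have H1 : snl l T = plane_norm x (fun t => sgn1 R (0 <= c tau) * y t) tau.
      by rewrite plane_norm_reflect; apply: radE.
    have H2 : arcK l T <= sgn1 R (0 <= c tau) * c tau by rewrite sgn1_norm cT.
    have H3 : sgn1 R (0 <= c tau) * y 0 = 0 by rewrite y0 mulr0.
    have H4 : sgn1 R (0 <= c tau) * c 0 = 0 by rewrite c0 mulr0.
    have [|_] := @minimal_on_arc R tau x _ _ s l T pc' tau0 x0 H3 H4 s0 l0 T0 Th H1 H2 sT _ tau
        tau0 (lexx _).
      by rewrite plane_norm_reflect.
    by rewrite sgn1_norm sT cT.
  move=> cE' t t0 tt.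
  have pc' := plane_curve_reflect sg pc.
  have H1 : snl l T = plane_norm x (fun t => sgn1 R sg * y t) tau.
    by rewrite plane_norm_reflect; apply: radE.
  have H2 : arcK l T <= sgn1 R sg * c tau by rewrite cE' /sg sgn1_norm cT.
  have H3 : sgn1 R sg * y 0 = 0 by rewrite y0 mulr0.
  have H4 : sgn1 R sg * c 0 = 0 by rewrite c0 mulr0.
  have H5 : x tau = arcX l a b T by rewrite xE'.
  have H6 : sgn1 R sg * y tau = arcY l a b T by rewrite yE'.
  have H7 : 0 < plane_norm x (fun t => sgn1 R sg * y t) tau by rewrite plane_norm_reflect.
  have [h1 h2 h3] := @minimal_unique R tau x _ _ s l T pc' tau0 x0 H3 H4 s0 l0 T0 Th H1 H2 a b
      H5 H6 sT H7 t t0 tt.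
  by rewrite /X /Y /K h1 -h2 -h3 /e !sgn1K.
(* A return to the axis forces [l > 1] and a full period; the radius attained only once is that of
   the turning point. *)
- move=> rz; have r1z : r1 = 0 by rewrite /r1 rz sqrtr0.
  have l1 : 1 < l.
    rewrite ltNge; apply/negP => l1; have : 0 < snl l T by apply: snl_gt0; rewrite // ltNge l1.
    by rewrite rT r1z ltxx.
  have TE : T = half_period l *+ 2.
    apply/eqP; rewrite eq_le Th // leNgt; apply/negP => h.
    by have := snl_gt0 l0 T0 (fun=> h); rewrite rT r1z ltxx.
  have h0 := half_period_gt0 l1; have [w0 _] := om_gt1 l1.
  exists (half_period l); rewrite XY snl_half //; split => //.
  + by rewrite TE mulr2n ltrDl.
  + by rewrite expf_neq0 // invr_neq0 // gt_eqF.
  move=> t t0 tT; rewrite XY => /eqP.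
  rewrite eqrXn2 ?invr_ge0 ?(ltW w0) //; last by apply: snl_ge0 => // _; rewrite -TE.
  rewrite -snl_half // => /eqP E.
  have [th|/ltW th] := leP t (half_period l).
    by apply: (snl_inj l0) => //; exact: ltW.
  have : half_period l *+ 2 - t = half_period l.
    apply: (snl_inj l0) => //; rewrite ?snl_refl // ?(ltW h0) // ?subr_ge0 -?TE //.
    by move=> _; rewrite TE mulr2n lerBlDr lerD2l.
  by rewrite mulr2n; move: (half_period l) => u; lra.
Qed.

End Geodesics.

(** * The frame of the universal cover *)

Section CoverFrame.
Variable R : realType.
Local Notation C := R[i].
Implicit Types (c x y t u v : R).

Definition z1_norm x y := Num.sqrt (1 + (x ^+ 2 + y ^+ 2)).

Lemma z1_norm_gt0 x y : 0 < z1_norm x y.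
Proof. by rewrite sqrtr_gt0 ltr_pwDl // addr_ge0 ?sqr_ge0. Qed.

Lemma z1_norm2 x y : z1_norm x y ^+ 2 = 1 + (x ^+ 2 + y ^+ 2).
Proof. by rewrite sqr_sqrtr // addr_ge0 ?addr_ge0 ?sqr_ge0. Qed.

Lemma cover_z1E c x y : cover_z1 (c, x +i* y) = (z1_norm x y * cos c) +i* (z1_norm x y * sin c).
Proof. by rewrite /cover_z1 /= -/(z1_norm x y); apply/eqP;
    rewrite eq_complex /= !mul0r subr0 addr0 !eqxx. Qed.

Lemma complex_ext (z w : C) : complex.Re z = complex.Re w -> complex.Im z = complex.Im w -> z = w.
Proof. by case: z w => [a b] [a' b'] /= -> ->. Qed.

(** With [z1 = N exp (i c)], [p1 + i p2] is [z1 v], and [conj v / z1 = conj (z1 v) / N^2] gives the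
    quotient inside the arctangent. As [v] has norm 1, the first entry of the right factor is the
    real number [M]. *)
Lemma cover_mul_field c x y v1 v2 t : v1 ^+ 2 + v2 ^+ 2 = 1 ->
  let N := z1_norm x y in let M := Num.sqrt (1 + t ^+ 2) in
  let p1 := N * (cos c * v1 - sin c * v2) in let p2 := N * (cos c * v2 + sin c * v1) in
  let g := cover_mul (c, x +i* y) (t * 0, t%:C * (v1 +i* v2)) in
  [/\ g.1 = c + t * 0 + atan ((t * (y * p1 - x * p2) / (N ^+ 2 * M)) / (1 + t * (x * p1 + y *
      p2) / (N ^+ 2 * M))),
      complex.Re g.2 = t * p1 + x * M & complex.Im g.2 = t * p2 + y * M].
Proof.
move=> v1v2 N M p1 p2 g.
have N0 : 0 < N by exact: z1_norm_gt0.
have N2 : N ^+ 2 = 1 + (x ^+ 2 + y ^+ 2) by exact: z1_norm2.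
have M0 : 0 < M by rewrite sqrtr_gt0 ltr_pwDl // sqr_ge0.
have hE : t%:C * (v1 +i* v2) = (t * v1) +i* (t * v2).
  by apply/complex_ext => /=; rewrite !mul0r ?subr0 ?addr0.
have zh : cover_z1 (t * 0, t%:C * (v1 +i* v2)) = M%:C.
  rewrite hE cover_z1E mulr0 cos0 sin0 mulr0 mulr1 /z1_norm.
  by rewrite !exprMn -mulrDr v1v2 mulr1.
have zg : cover_z1 (c, x +i* y) = (N * cos c) +i* (N * sin c) by exact: cover_z1E.
have cs := cos2Dsin2 c.
have D0 : N ^+ 2 * M != 0 by rewrite mulf_neq0 ?expf_neq0 ?gt_eqF.
have qE : (x +i* y) * (t%:C * (v1 +i* v2))^*%C / (cover_z1 (c, x +i* y) * cover_z1 (t * 0,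
    t%:C * (v1 +i* v2))) =
   (t * (x * p1 + y * p2) / (N ^+ 2 * M)) +i* (t * (y * p1 - x * p2) / (N ^+ 2 * M)).
  rewrite hE in zh *; rewrite zh zg.
  set Z := _ * M%:C.
  have Z0 : Z != 0.
    apply: mulf_neq0; last by rewrite eq_complex /= gt_eqF.
    apply/eqP => /eqP; rewrite eq_complex /= => /andP[/eqP h1 /eqP h2].
    have : N ^+ 2 * (cos c ^+ 2 + sin c ^+ 2) = 0.
      by rewrite mulrDr -!exprMn h1 h2 expr0n addr0.
    by rewrite cs mulr1 => /eqP; rewrite expf_eq0 /= gt_eqF.
  apply: (mulIf Z0); rewrite divfK // /Z.
  have e1 : p1 = N * (cos c * v1 - sin c * v2) by [].
  have e2 : p2 = N * (cos c * v2 + sin c * v1) by [].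
  apply/complex_ext => /=.
    rewrite !mulr0 !subr0 ?addr0 ?add0r e1 e2.
    rewrite [LHS](_ : _ = t * (x * v1 + y * v2) * (cos c ^+ 2 + sin c ^+ 2)).
      by field; rewrite !gt_eqF.
    by rewrite cs; ring.
  rewrite !mulr0 ?addr0 ?add0r ?subr0 e1 e2.
  rewrite [LHS](_ : _ = t * (y * v1 - x * v2) * (cos c ^+ 2 + sin c ^+ 2)).
    by field; rewrite !gt_eqF.
  by rewrite cs; ring.
split.
- pose q := 1 + (x +i* y) * (t%:C * (v1 +i* v2))^*%C / (cover_z1 (c, x +i* y) * cover_z1 (t * 0,
    t%:C * (v1 +i* v2))).
  have -> : g.1 = c + t * 0 + atan (complex.Im q / complex.Re q) by [].
  by rewrite /q qE /= add0r.
- rewrite /g /cover_mul [(_, _).2]/= zg zh hE /=; rewrite /p1; ring.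
- rewrite /g /cover_mul [(_, _).2]/= zg zh hE /=; rewrite /p2; ring.
Qed.

Lemma cover_fieldE c x y v1 v2 : v1 ^+ 2 + v2 ^+ 2 = 1 ->
  let N := z1_norm x y in
  let p1 := N * (cos c * v1 - sin c * v2) in let p2 := N * (cos c * v2 + sin c * v1) in
  cover_field (0, v1 +i* v2) (c, x +i* y) = ((y * p1 - x * p2) / N ^+ 2, p1 +i* p2).
Proof.
move=> v1v2 N p1 p2; rewrite /cover_field.
have N0 : 0 < N by exact: z1_norm_gt0.
have H t := cover_mul_field c x y t v1v2.
set f1 := (fun s : R => _.1); set f2 := (fun s : R => complex.Re _);
    set f3 := (fun s : R => complex.Im _).
have dM : is_derive (0 : R) 1 (fun t => Num.sqrt (1 + t ^+ 2)) 0.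
  der; first by rewrite expr0n addr0.
  by rewrite expr1 !mulr0 add0r !mul0r mulr0.
have M0 : Num.sqrt (1 + (0 : R) ^+ 2) = 1 by rewrite expr0n addr0 sqrtr1.
have -> : f1 = fun t => c + t * 0 + atan ((t * (y * p1 - x * p2) / (N ^+ 2 * Num.sqrt (1 + t ^+
    2))) / (1 + t * (x * p1 + y * p2) / (N ^+ 2 * Num.sqrt (1 + t ^+ 2)))).
  by apply/funext => t; have [h _ _] := H t; exact: h.
have -> : f2 = fun t => t * p1 + x * Num.sqrt (1 + t ^+ 2).
  by apply/funext => t; have [_ h _] := H t; exact: h.
have -> : f3 = fun t => t * p2 + y * Num.sqrt (1 + t ^+ 2).
  by apply/funext => t; have [_ _ h] := H t; exact: h.
have N2 : N ^+ 2 != 0 by rewrite expf_neq0 // gt_eqF.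
rewrite !derive1E; congr (_, _ +i* _); apply: derive_val.
- eapply is_derive_eq; [repeat der_step|].
  + by rewrite M0 mulr1.
  + by rewrite !mul0r addr0 oner_eq0.
  + by rewrite M0 mulr1.
  cbv beta; rewrite M0 /=; field.
  by rewrite gt_eqF.
- by der; ring.
- by der; ring.
Qed.

(** As [X] and [Y] are the fields of -1 and [i], the velocity of [w] is
    [z1 (- u1 + i u2) = p1 + i p2], and that of the argument is [Im (w conj w') / |z1|^2]. *)
Lemma cover_frameE c x y u1 u2 (k : 'I_3) : let N := z1_norm x y in
  let p1 := N * (- u1 * cos c - u2 * sin c) in let p2 := N * (u2 * cos c - u1 * sin c) in
  u1 * cover_coord k (cover_X (c, x +i* y)) + u2 * cover_coord k (cover_Y (c, x +i* y)) =
  [:: (y * p1 - x * p2) / N ^+ 2; p1; p2]`_k.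
Proof.
move=> N p1 p2.
have m1 : -1 = (-1) +i* 0 :> C by apply: complex_ext; rewrite /= ?oppr0.
rewrite /cover_X /cover_Y m1 !cover_fieldE; [|by rewrite expr0n /= add0r expr1n|by rewrite
    expr0n /= addr0 sqrrN expr1n].
rewrite /cover_coord /p1 /p2 -/N.
by case: k => -[|[|[|k]]] kP //=; ring.
Qed.

Lemma cover_frame_norm c x y u1 u2 : let N := z1_norm x y in
  let p1 := N * (- u1 * cos c - u2 * sin c) in let p2 := N * (u2 * cos c - u1 * sin c) in
  p1 ^+ 2 + p2 ^+ 2 = (1 + (x ^+ 2 + y ^+ 2)) * (u1 ^+ 2 + u2 ^+ 2).
Proof.
move=> N p1 p2; rewrite -z1_norm2 -/N.
rewrite [LHS](_ : _ = N ^+ 2 * (u1 ^+ 2 + u2 ^+ 2) * (cos c ^+ 2 + sin c ^+ 2));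
    last by rewrite /p1 /p2; ring.
by rewrite cos2Dsin2 mulr1.
Qed.

End CoverFrame.

(** * Geodesics in a chart *)

Section Charts.
Variable R : realType.
Local Notation mu := (@lebesgue_measure R).
Local Notation ac := (@absolutely_continuous R).
Implicit Types (X Y K dX dY f df u : R -> R) (a b t tau T : R).

Definition speed (u1 u2 : R -> R) t := Num.sqrt (u1 t ^+ 2 + u2 t ^+ 2).

Lemma speed_ge0 u1 u2 t : 0 <= speed u1 u2 t. Proof. exact: sqrtr_ge0. Qed.

Lemma speed2 u1 u2 t : speed u1 u2 t ^+ 2 = u1 t ^+ 2 + u2 t ^+ 2.
Proof. by rewrite sqr_sqrtr // addr_ge0 ?sqr_ge0. Qed.

Lemma speed_measurable (D : set R) u1 u2 : measurable_fun D u1 ->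
  measurable_fun D u2 -> measurable_fun D (speed u1 u2).
Proof.
move=> m1 m2; apply: (@measurableT_comp _ _ _ _ _ _ (@Num.sqrt R)).
  by apply: continuous_measurable_fun; exact: sqrt_continuous.
by apply: measurable_funD; exact: measurable_funX.
Qed.

Lemma curve_length_ge0 tau u1 u2 : (0 <= curve_length tau u1 u2)%E.
Proof. by apply: integral_ge0 => t _; rewrite lee_fin; exact: speed_ge0. Qed.

Lemma curve_length_cumul tau u1 u2 (L : R) :
  measurable_fun `[0, tau] u1 -> measurable_fun `[0, tau] u2 ->
  curve_length tau u1 u2 = L%:E ->
  mu.-integrable `[0, tau] (EFin \o speed u1 u2) /\ cumul tau (speed u1 u2) tau = L.
Proof.
move=> m1 m2 lenE; split.
  apply/integrableP; split.
    by apply/measurable_EFinP; exact: speed_measurable.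
  have -> : (\int[mu]_(t in `[0%R, tau]) `|(EFin \o speed u1 u2) t| = L%:E)%E.
    rewrite -lenE; apply: eq_integral => t _; rewrite gee0_abs //.
    by rewrite lee_fin speed_ge0.
  exact: ltry.
rewrite -[RHS]/(fine L%:E) -lenE; congr fine; apply: eq_integral => t tI.
by rewrite patchE tI.
Qed.

Lemma ac_c1 a b f df : (forall t, a <= t -> t <= b -> is_derive t 1 f (df t)) ->
  {within `[a, b], continuous df} -> ac a b f.
Proof.
move=> fd cdf; have [ab|ba] := leP a b; last first.
  apply: (ac_derive_bounded (K := 0) fd) => t at_ tb.
  by have := lt_le_trans ba (le_trans at_ tb); rewrite ltxx.
have [p _ pm] := EVT_max ab cdf; have [q _ qm] := EVT_min ab cdf.
apply: (ac_derive_bounded (K := `|df p| + `|df q|) fd) => t at_ tb.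
have tI : t \in `[a, b] by rewrite in_itv /= at_ tb.
have h1 := pm _ tI; have h2 := qm _ tI; rewrite ler_norml; apply/andP; split.
  rewrite opprD -[leRHS]add0r; apply: lerD; first by rewrite oppr_le0.
  by apply: le_trans h2; rewrite lerNl -normrN ler_norm.
by apply: le_trans h1 _; apply: le_trans (ler_norm _) _; rewrite lerDl.
Qed.

(** The part of [model_geodesic] that ignores the end point and minimality, so that it applies to
    the rotated copy too. *)
Definition unit_curve T X Y K dX dY : Prop :=
  [/\ 0 < T, [/\ X 0 = 0, Y 0 = 0 & K 0 = 0], continuous dX, continuous dY &
   forall t, 0 <= t -> t <= T ->
    [/\ is_derive t 1 X (dX t), is_derive t 1 Y (dY t),
        is_derive t 1 K ((Y t * dX t - X t * dY t) / (1 + (X t ^+ 2 + Y t ^+ 2))) &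
        dX t ^+ 2 + dY t ^+ 2 = 1 + (X t ^+ 2 + Y t ^+ 2)]].

Lemma model_unit_curve x1 y1 c1 T X Y K dX dY : model_geodesic x1 y1 c1 T X Y K dX dY ->
  unit_curve T X Y K dX dY.
Proof. by case=> ? ? _ [? ?] ? _ _ _ _; split. Qed.

(** Rotation of [z2] by [pi] about the axis; this one rotation suffices to produce a second
    geodesic. *)
Lemma unit_curve_opp T X Y K dX dY : unit_curve T X Y K dX dY ->
  unit_curve T (fun t => - X t) (fun t => - Y t) K (fun t => - dX t) (fun t => - dY t).
Proof.
move=> [T0 [X0 Y0 K0] cX cY H]; split => //.
- by rewrite X0 Y0 oppr0.
- by move=> t; apply: cvgN; exact: cX.
- by move=> t; apply: cvgN; exact: cY.
move=> t t0 tT; have [dX' dY' dK' e] := H t t0 tT; split.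
- exact: drv_opp.
- exact: drv_opp.
- by rewrite !mulrNN !sqrrN.
- by rewrite !sqrrN.
Qed.

(* [emb c x y] is the point of [M] with [z2 = x + i y] and [arg z1 = c]. *)
Record geodesic_chart (M : sub_riemannian R) (emb : R -> R -> R -> M) : Prop := {
  gc_dom : forall c x y, sr_dom (emb c x y);
  gc_lift : forall tau gamma u1 u2, 0 < tau -> horizontal tau gamma u1 u2 ->
    gamma 0 = emb 0 0 0 -> mu.-integrable `[0, tau] (EFin \o speed u1 u2) ->
    exists x y c, [/\ plane_curve tau x y c (cumul tau (speed u1 u2)),
      [/\ x 0 = 0, y 0 = 0 & c 0 = 0] &
      forall t, t \in `[0, tau] -> gamma t = emb (c t) (x t) (y t)];
  gc_unit : forall T X Y K dX dY, unit_curve T X Y K dX dY -> exists u1 u2,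
    horizontal T (fun t => emb (K t) (X t) (Y t)) u1 u2 /\
    curve_length T u1 u2 = T%:E }.

Section Chart.
Variables (M : sub_riemannian R) (emb : R -> R -> R -> M).
Hypothesis chart : geodesic_chart emb.
Local Notation p := (emb 0 0 0).
Implicit Types (q : M) (gamma W : R -> M).

(** [gamma] runs along [W], possibly with pauses. A common reference [W] is what makes two
    minimizers equal up to reparametrization. *)
Definition follows tau gamma T W := exists nu,
  [/\ mu.-integrable `[0, tau] (EFin \o nu), forall t, 0 <= nu t,
      0 < tau, cumul tau nu tau = T &
      forall t, t \in `[0, tau] -> gamma t = W (cumul tau nu t)].

Lemma cumul_time_change tau nu : mu.-integrable `[0, tau] (EFin \o nu) ->
  (forall t, 0 <= nu t) -> 0 < tau -> time_change tau (cumul tau nu tau) (cumul tau nu).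
Proof.
move=> inu nu0 tau0; split.
  by move=> x y; rewrite !in_itv /= => /andP[x0 _] _; exact: cumul_le.
have ct := ac_within (cumul_ac inu).
apply/seteqP; split => v /=.
  move=> [t]; rewrite !in_itv /= => /andP[t0 tt] <-; apply/andP; split.
    by rewrite -(cumul0 tau nu); exact: cumul_le.
  exact: cumul_le.
rewrite in_itv /= => v0; have := @IVT _ _ _ _ v (ltW tau0) ct.
have h : cumul tau nu 0 <= cumul tau nu tau by apply: cumul_le => //; exact: ltW.
by rewrite min_l // max_r // cumul0 => /(_ v0)[t tI tv]; exists t.
Qed.

Lemma follows_same tau1 gamma1 tau2 gamma2 T W : follows tau1 gamma1 T W ->
  follows tau2 gamma2 T W -> same_up_to_reparam tau1 gamma1 tau2 gamma2.
Proof.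
move=> [n1 [i1 p1 t1 e1 g1]] [n2 [i2 p2 t2 e2 g2]].
exists T, W, (cumul tau1 n1), (cumul tau2 n2); split => //.
  by rewrite -e1; exact: cumul_time_change.
by rewrite -e2; exact: cumul_time_change.
Qed.

(** Over [q] the plane coordinates are determined, whereas several arguments are possible and [c1]
    is one of least absolute value; [- c1] may be another. *)
Definition closest q x1 y1 c1 := emb c1 x1 y1 = q /\
  forall c x y, emb c x y = q -> [/\ x = x1, y = y1 & `|c1| <= `|c|].

Lemma curve_lengths_lift q (L : R) tau gamma u1 u2 : 0 < tau -> horizontal tau gamma u1 u2 ->
  gamma 0 = p -> gamma tau = q -> curve_length tau u1 u2 = L%:E ->
  exists nu x y c, [/\ plane_curve tau x y c (cumul tau nu),
    [/\ x 0 = 0, y 0 = 0 & c 0 = 0],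
    (mu.-integrable `[0, tau] (EFin \o nu) /\ forall t, 0 <= nu t),
    cumul tau nu tau = L &
    forall t, t \in `[0, tau] -> gamma t = emb (c t) (x t) (y t)].
Proof.
move=> tau0 hor g0 gt lenE; have [_ _ m1 m2 _] := hor.
have [inu cE] := curve_length_cumul m1 m2 lenE.
have [x [y [c [pc st gE]]]] := gc_lift chart tau0 hor g0 inu.
by exists (speed u1 u2), x, y, c; split => //; split => // t; exact: speed_ge0.
Qed.

Lemma ereal_inf_curve_lengths q x1 y1 c1 T X Y K dX dY : closest q x1 y1 c1 ->
  model_geodesic x1 y1 c1 T X Y K dX dY -> ereal_inf (curve_lengths p q) = T%:E.
Proof.
move=> [qE cl] m; apply/eqP; rewrite eq_le; apply/andP; split.
  apply: ereal_inf_lbound; have [u1 [u2 [hor len]]] := gc_unit chart (model_unit_curve m).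
  exists T, (fun t => emb (K t) (X t) (Y t)), u1, u2.
  have [-> -> ->] := mg_start m; have [-> -> ->] := mg_end m.
  by split => //; exact: mg_gt0 m.
apply: le_ereal_inf_tmp => _ [tau [gamma [u1 [u2 [tau0 hor g0 gt ->]]]]].
case lenE : (curve_length tau u1 u2) => [L| |]; last 2 first.
- by rewrite leey.
- by have := curve_length_ge0 tau u1 u2; rewrite lenE.
have [nu [x [y [c [pc [x0 y0 c0] _ <- gE]]]]] := curve_lengths_lift tau0 hor g0 gt lenE.
have tI : tau \in `[0, tau] by rewrite in_itv /= ltW /=.
have := gE _ tI; rewrite gt => /esym /cl[xt yt ct].
by rewrite lee_fin; apply: (mg_min m (ltW tau0) pc) => //; exact: cumul0.
Qed.

Lemma unit_curve_minimizing q T X Y K dX dY : unit_curve T X Y K dX dY ->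
  emb (K T) (X T) (Y T) = q -> ereal_inf (curve_lengths p q) = T%:E ->
  minimizing_geodesic p q T (fun t => emb (K t) (X t) (Y t)).
Proof.
move=> uc qE infE; have [T0 [X0 Y0 K0] _ _ _] := uc.
have [u1 [u2 [hor len]]] := gc_unit chart uc.
split => //; first by rewrite X0 Y0 K0.
by exists u1, u2; split => //; rewrite infE.
Qed.

(** [mg_unique] yields only [|c tau| = |c1|]; the hypothesis on [c1] excludes the opposite argument
    and pins down the lift. *)
Lemma minimizing_follows q x1 y1 c1 T X Y K dX dY tau gamma : closest q x1 y1 c1 ->
  model_geodesic x1 y1 c1 T X Y K dX dY -> x1 ^+ 2 + y1 ^+ 2 != 0 ->
  (forall c, emb c x1 y1 = q -> `|c| = `|c1| -> c = c1) ->
  minimizing_geodesic p q tau gamma ->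
  follows tau gamma T (fun t => emb (K t) (X t) (Y t)).
Proof.
move=> cl m r1 cu [tau0 g0 gt [u1 [u2 [hor]]]]; rewrite (ereal_inf_curve_lengths cl m) => len.
have [nu [x [y [c [pc [x0 y0 c0] [inu nu0] cT gE]]]]] := curve_lengths_lift tau0 hor g0 gt len.
have tI : tau \in `[0, tau] by rewrite in_itv /= ltW /=.
have := gE _ tI; rewrite gt => /esym /[dup] qE /(cl.2 _ _ _)[xt yt ct].
have [ca ceq] := mg_unique m (ltW tau0) pc x0 y0 c0 (cumul0 _ _) xt yt ct cT r1.
exists nu; split => // t; rewrite in_itv /= => /andP[t0 tt].
rewrite gE ?in_itv /= ?t0 //.
have [|-> -> -> //] := ceq _ t t0 tt.
by apply: cu => //; rewrite -xt -yt qE.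
Qed.

(** Model geodesics have positive length, so the identity as an end point is separate: the infimum
    is 0, and by [arclen_const] a curve of length 0 stands still. *)
Lemma minimizing_const tau gamma : minimizing_geodesic p p tau gamma ->
  follows tau gamma 0 (fun=> p).
Proof.
move=> [tau0 g0 gt [u1 [u2 [hor]]]].
have -> : ereal_inf (curve_lengths p p) = 0%:E.
  apply/eqP; rewrite eq_le; apply/andP; split; last first.
    by apply: le_ereal_inf_tmp => _ [? [? [? [? [_ _ _ _ ->]]]]]; exact: curve_length_ge0.
  apply: ereal_inf_lbound; exists 1, (fun=> p), (fun=> 0), (fun=> 0); split => //.
    split => //.
    - by move=> t _; exact: gc_dom.
    - by move=> k; exact: ac_const.
    apply: nearW => t _ k; rewrite !mul0r addr0; exact: drv_cst.
  rewrite /curve_length (eq_integral (cst 0%E)) ?integral0 // => t _.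
  by rewrite expr0n /= addr0 sqrtr0.
move=> len.
have [nu [x [y [c [pc [x0 y0 c0] [inu nu0] cT gE]]]]] := curve_lengths_lift tau0 hor g0 gt len.
exists nu; split => // t tI; have := tI; rewrite in_itv /= => /andP[t0 tt].
have s0 : cumul tau nu 0 = cumul tau nu t.
  apply/eqP; rewrite eq_le cumul_le //=.
  by rewrite (le_trans (cumul_le inu nu0 t0 tt)) // cT cumul0.
have [xt yt ct] := arclen_const pc (lexx 0) t0 tt s0.
by rewrite gE // xt yt ct x0 y0 c0.
Qed.

End Chart.
End Charts.

(** * Controls of a unit-speed curve *)

Section UnitControls.
Variable R : realType.
Local Notation mu := (@lebesgue_measure R).
Variables (T : R) (X Y K dX dY : R -> R).
Implicit Types (t : R).
Hypothesis uc : unit_curve T X Y K dX dY.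

(** The controls solve [dX + i dY = z1 (- u1 + i u2)] with [z1 = z1_norm exp (i K)]. *)
Definition unit_u1 t := - (dX t * cos (K t) + dY t * sin (K t)) / z1_norm (X t) (Y t).
Definition unit_u2 t := (dY t * cos (K t) - dX t * sin (K t)) / z1_norm (X t) (Y t).

Lemma unit_velocity t :
  z1_norm (X t) (Y t) * (- unit_u1 t * cos (K t) - unit_u2 t * sin (K t)) = dX t /\
  z1_norm (X t) (Y t) * (unit_u2 t * cos (K t) - unit_u1 t * sin (K t)) = dY t.
Proof.
have N0 := gt_eqF (z1_norm_gt0 (X t) (Y t)); have cs := cos2Dsin2 (K t).
rewrite /unit_u1 /unit_u2; split.
  rewrite [LHS](_ : _ = dX t * (cos (K t) ^+ 2 + sin (K t) ^+ 2)).
    by rewrite cs mulr1.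
  by field; rewrite N0.
rewrite [LHS](_ : _ = dY t * (cos (K t) ^+ 2 + sin (K t) ^+ 2)).
  by rewrite cs mulr1.
by field; rewrite N0.
Qed.

Lemma unit_speed t : 0 <= t -> t <= T -> unit_u1 t ^+ 2 + unit_u2 t ^+ 2 = 1.
Proof.
move=> t0 tT; have [_ _ _ _ /(_ t t0 tT) [_ _ _ e]] := uc.
have N0 := gt_eqF (z1_norm_gt0 (X t) (Y t)); have cs := cos2Dsin2 (K t).
rewrite -z1_norm2 in e; rewrite /unit_u1 /unit_u2.
rewrite [LHS](_ : _ = (dX t ^+ 2 + dY t ^+ 2) * (cos (K t) ^+ 2 + sin (K t) ^+ 2) / z1_norm (X
    t) (Y t) ^+ 2).
  by rewrite cs e mulr1 divff // expf_neq0 // N0.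
by field; rewrite N0.
Qed.

Lemma derive_cnt (f : R -> R) (t df : R) : is_derive t 1 f df -> {for t, continuous f}.
Proof. by move=> fd; apply: differentiable_continuous; apply/derivable1_diffP; exact: ex_derive.
    Qed.

Lemma z1_norm_cnt t : 0 <= t -> t <= T -> {for t, continuous (fun s => z1_norm (X s) (Y s))}.
Proof.
move=> t0 tT; have [_ _ _ _ /(_ t t0 tT) [dx dy _ _]] := uc.
apply: cnt_comp; first exact: sqrt_continuous.
by apply: cnt_add; [exact: cnt_cst|apply: cnt_add; apply: cnt_sqr; exact: derive_cnt].
Qed.

Lemma unit_u_cnt t : 0 <= t -> t <= T ->
  {for t, continuous unit_u1} /\ {for t, continuous unit_u2}.
Proof.
move=> t0 tT; have [_ _ cX cY /(_ t t0 tT) [_ _ dk _]] := uc.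
have cc : {for t, continuous (fun s => cos (K s))}.
  by apply: cnt_comp; [exact: continuous_cos|exact: derive_cnt dk].
have sc : {for t, continuous (fun s => sin (K s))}.
  by apply: cnt_comp; [exact: continuous_sin|exact: derive_cnt dk].
have ic : {for t, continuous (fun s => (z1_norm (X s) (Y s))^-1)}.
  by apply: cnt_inv; [rewrite gt_eqF // z1_norm_gt0|exact: z1_norm_cnt].
split; apply: cnt_mul => //.
  by apply: cnt_opp; apply: cnt_add; apply: cnt_mul => //; [exact: cX|exact: cY].
by apply: cnt_add; [|apply: cnt_opp]; apply: cnt_mul => //; [exact: cY|exact: cX].
Qed.

Lemma unit_length : curve_length T unit_u1 unit_u2 = T%:E.
Proof.
have [T0 _ _ _ _] := uc.
rewrite /curve_length (_ : (\int[mu]_(t in _) _ = \int[mu]_(t in `[0%R, T]) 1)%E).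
  rewrite integral_cst //= lebesgue_measure_itv /= lte_fin T0 mul1e.
  by rewrite -EFinD subr0.
apply: eq_integral => t; rewrite inE /= in_itv /= => /andP[t0 tT].
by rewrite unit_speed // sqrtr1.
Qed.

Lemma unit_horizontal (M : sub_riemannian R) (gamma : R -> M) :
  (forall t, 0 <= t -> t <= T -> sr_dom (gamma t)) ->
  (forall k, exists2 df : R -> R, forall t, 0 <= t -> t <= T -> {for t, continuous df} &
    forall t, 0 <= t -> t <= T ->
      is_derive t 1 (fun s => sr_coord k (gamma s)) (df t) /\
      df t = unit_u1 t * sr_coord k (sr_X (gamma t)) + unit_u2 t * sr_coord k (sr_Y (gamma t))) ->
  horizontal T gamma unit_u1 unit_u2.
Proof.
move=> dom H; split.
- by move=> t; rewrite in_itv /= => /andP[t0 tT]; exact: dom.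
- move=> k; have [df cdf dfP] := H k; apply: (@ac_c1 R _ _ _ df).
    by move=> t t0 tT; have [] := dfP t t0 tT.
  exact: cnt_within.
- apply: subspace_continuous_measurable_fun => //.
  by apply: cnt_within => t t0 tT; have [] := unit_u_cnt t0 tT.
- apply: subspace_continuous_measurable_fun => //.
  by apply: cnt_within => t t0 tT; have [] := unit_u_cnt t0 tT.
apply: nearW => t; rewrite in_itv /= => /andP[t0 tT] k.
by have [df cdf dfP] := H k; have [d <-] := dfP t t0 tT.
Qed.

End UnitControls.

(** * The chart of the universal cover *)

Section CoverChart.
Variable R : realType.
Local Notation mu := (@lebesgue_measure R).
Local Notation ac := (@absolutely_continuous R).

Definition cover_emb (c x y : R) : cover_sr R := (c, x +i* y).

Lemma cover_chart : geodesic_chart cover_emb.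
Proof.
split => //.
- move=> tau gamma u1 u2 tau0 [_ acg m1 m2 aeg] g0 inu.
  pose i0 : 'I_3 := Ordinal (isT : 0 < 3)%N.
  pose i1 : 'I_3 := Ordinal (isT : 1 < 3)%N.
  pose i2 : 'I_3 := Ordinal (isT : 2 < 3)%N.
  pose x t := complex.Re (gamma t).2; pose y t := complex.Im (gamma t).2.
  pose c t := (gamma t).1.
  have gE t : gamma t = cover_emb (c t) (x t) (y t).
    by rewrite /cover_emb /c /x /y; case: (gamma t) => a [].
  exists x, y, c; split; last by move=> t _; exact: gE.
    split; [exact: (acg i1)|exact: (acg i2)|exact: (acg i0)|exact: cumul_ac|].
    apply: ae_imply (ae_and aeg (cumul_derive inu)) => t [ag ac] tI.
    have {}ag := ag tI; have {}ac := ac tI.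
    have d0 := ag i0; have d1 := ag i1; have d2 := ag i2.
    rewrite /sr_X /sr_Y /= gE cover_frameE in d0.
    rewrite /sr_X /sr_Y /= gE cover_frameE in d1.
    rewrite /sr_X /sr_Y /= gE cover_frameE in d2.
    exists (z1_norm (x t) (y t) * (- u1 t * cos (c t) - u2 t * sin (c t))).
    exists (z1_norm (x t) (y t) * (u2 t * cos (c t) - u1 t * sin (c t))).
    exists (speed u1 u2 t); split; [exact: speed_ge0|exact: d1|exact: d2|exact: ac|].
    by split; [rewrite -z1_norm2; exact: d0|rewrite cover_frame_norm speed2].
  by rewrite /x /y /c g0.
move=> T X Y K dX dY uc; exists (unit_u1 X Y K dX dY), (unit_u2 X Y K dX dY).
split; last exact: unit_length uc.
have [_ _ cX cY H] := uc.
have cx t : 0 <= t -> t <= T -> {for t, continuous X}.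
  by move=> t0 tT; have [d _ _ _] := H t t0 tT; exact: derive_cnt d.
have cy t : 0 <= t -> t <= T -> {for t, continuous Y}.
  by move=> t0 tT; have [_ d _ _] := H t t0 tT; exact: derive_cnt d.
apply: (unit_horizontal uc) => // k.
exists (fun t => [:: (Y t * dX t - X t * dY t) / (1 + (X t ^+ 2 + Y t ^+ 2)); dX t; dY t]`_k).
  move=> t t0 tT; case: k => -[|[|[|k]]] kP //=; last by exact: cY.
    apply: cnt_mul.
      by apply: cnt_add; [|apply: cnt_opp]; apply: cnt_mul;
          [exact: cy|exact: cX|exact: cx|exact: cY].
    apply: cnt_inv; first by rewrite gt_eqF // ltr_pwDl // addr_ge0 ?sqr_ge0.
    by apply: cnt_add; [exact: cnt_cst|apply: cnt_add; apply: cnt_sqr; [exact: cx|exact: cy]].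
  exact: cX.
move=> t t0 tT; have [dx dy dk _] := H t t0 tT; split.
  by case: k => -[|[|[|k]]] kP.
rewrite /sr_X /sr_Y /= [RHS]cover_frameE.
have [-> ->] := unit_velocity X Y K dX dY t.
by rewrite z1_norm2.
Qed.

End CoverChart.

(** * The chart of SU(1,1) *)

Section SU11Chart.
Variable R : realType.
Local Notation C := R[i].
Local Notation mu := (@lebesgue_measure R).
Local Notation ac := (@absolutely_continuous R).

Definition su_emb (c x y : R) : su11_sr R :=
  su_mx ((z1_norm x y * cos c) +i* (z1_norm x y * sin c)) (x +i* y).

(** The real coordinate [k] of the matrix [(v, w)] with [v = v1 + i v2], [w = w1 + i w2]. Being
    linear in these four numbers, it treats all eight coordinates at once. *)
Definition su_entry (k : 'I_2 * 'I_2 * bool) (v1 v2 w1 w2 : R) : R :=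
  let: (i, j, b) := k in
  (if b && (i != 0) then -1 else 1) *
  (if i == j then (if b then v2 else v1) else (if b then w2 else w1)).

Lemma I2P (i : 'I_2) : i = 0 \/ i = 1.
Proof. by case: i => -[|[|i]] iP //; [left|right]; apply: val_inj. Qed.

Lemma su_coordE k (a b x y : R) : su_coord k (su_mx (a +i* b) (x +i* y)) = su_entry k a b x y.
Proof.
case: k => -[i j] r; rewrite /su_coord /su_entry !mxE.
by case: (I2P i) => ->; case: (I2P j) => ->; case: r => /=; ring.
Qed.

Lemma su_frameE k (a b x y u1 u2 : R) : let A := su_mx (a +i* b) (x +i* y) in
  u1 * su_coord k (A *m lieX) + u2 * su_coord k (A *m lieY) =
  su_entry k (u2 * y - u1 * x) (- u1 * y - u2 * x) (- u1 * a - u2 * b) (u2 * a - u1 * b).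
Proof.
case: k => -[i j] r; rewrite /su_coord /su_entry !mxE !big_ord_recl !big_ord0 !mxE.
by case: (I2P i) => ->; case: (I2P j) => ->; case: r => /=; ring.
Qed.

Lemma SU11P (A : 'M[C]_2) : SU11 A <-> exists a b x y : R,
  A = su_mx (a +i* b) (x +i* y) /\ a ^+ 2 + b ^+ 2 = 1 + (x ^+ 2 + y ^+ 2).
Proof.
have E (z : C) : `|z| ^+ 2 = (complex.Re z ^+ 2 + complex.Im z ^+ 2)%:C.
  by rewrite normc_def -rmorphXn /= sqr_sqrtr // addr_ge0 ?sqr_ge0.
split.
  move=> [[a b] [[x y] [+ ->]]]; rewrite !E -rmorphB /= => /(congr1 (@complex.Re R)) /= h.
  by exists a, b, x, y; split => //; rewrite -h subrK.
move=> [a [b [x [y [-> h]]]]]; exists (a +i* b), (x +i* y); split => //.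
by rewrite !E /= h -rmorphB /= addrK.
Qed.

Lemma su_emb_dom c x y : SU11 (su_emb c x y).
Proof.
apply/SU11P; exists (z1_norm x y * cos c), (z1_norm x y * sin c), x, y; split => //.
by rewrite !exprMn -mulrDr cos2Dsin2 mulr1 z1_norm2.
Qed.

Lemma su_unit_derive (X Y K dX dY : R -> R) T t : unit_curve T X Y K dX dY -> 0 <= t -> t <= T ->
  let u1 := unit_u1 X Y K dX dY in let u2 := unit_u2 X Y K dX dY in
  let a s := z1_norm (X s) (Y s) * cos (K s) in let b s := z1_norm (X s) (Y s) * sin (K s) in
  [/\ is_derive t 1 a (u2 t * Y t - u1 t * X t), is_derive t 1 b (- u1 t * Y t - u2 t * X t),
      is_derive t 1 X (- u1 t * a t - u2 t * b t) & is_derive t 1 Y (u2 t * a t - u1 t * b t)].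
Proof.
move=> uc t0 tT u1 u2 a b; have [_ _ _ _ /(_ t t0 tT) [dx dy dk _]] := uc.
have [v1 v2] := unit_velocity X Y K dX dY t; rewrite -/(u1 t) -/(u2 t) in v1 v2.
have N0 := z1_norm_gt0 (X t) (Y t); have N2 := z1_norm2 (X t) (Y t).
have cs := cos2Dsin2 (K t).
have dN : is_derive t 1 (fun s => z1_norm (X s) (Y s)) ((X t * dX t + Y t * dY t) / z1_norm (X
    t) (Y t)).
  rewrite /z1_norm; der; first by rewrite -N2 exprn_gt0.
  by rewrite -/(z1_norm (X t) (Y t)); field; rewrite gt_eqF.
rewrite -N2 in dk.
split.
- rewrite /a; der; rewrite -v1 -v2; move: (z1_norm (X t) (Y t)) N0 => N N0.
  rewrite [RHS](_ : _ = (u2 t * Y t - u1 t * X t) * (cos (K t) ^+ 2 + sin (K t) ^+ 2)).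
    by field; rewrite gt_eqF.
  by rewrite cs mulr1.
- rewrite /b; der; rewrite -v1 -v2; move: (z1_norm (X t) (Y t)) N0 => N N0.
  rewrite [RHS](_ : _ = (- u1 t * Y t - u2 t * X t) * (cos (K t) ^+ 2 + sin (K t) ^+ 2)).
    by field; rewrite gt_eqF.
  by rewrite cs mulr1.
- by apply: is_derive_eq dx _; rewrite -v1 /a /b; ring.
- by apply: is_derive_eq dy _; rewrite -v2 /a /b; ring.
Qed.

Lemma su_entry_cnt k (f g h e : R -> R) t : {for t, continuous f} -> {for t, continuous g} ->
  {for t, continuous h} -> {for t, continuous e} ->
  {for t, continuous (fun s => su_entry k (f s) (g s) (h s) (e s))}.
Proof.
move=> cf cg ch ce; case: k => -[i j] r; rewrite /su_entry.
by apply: cnt_mul; [exact: cnt_cst|case: (i == j); case: r].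
Qed.

Lemma su_entry_derive k (f g h e : R -> R) (t df dg dh de : R) :
  is_derive t 1 f df -> is_derive t 1 g dg -> is_derive t 1 h dh -> is_derive t 1 e de ->
  is_derive t 1 (fun s => su_entry k (f s) (g s) (h s) (e s)) (su_entry k df dg dh de).
Proof.
move=> cf cg ch ce; case: k => -[i j] r; rewrite /su_entry.
have H : is_derive t 1 (fun s => if i == j then if r then g s else f s else if r then e s else h
    s)
    (if i == j then if r then dg else df else if r then de else dh).
  by case: (i == j); case: r.
by apply: is_derive_eq (drv_mul (drv_cst t (if r && (i != 0) then -1 else 1)) H) _;
    rewrite mul0r add0r.
Qed.

Lemma su_unit T (X Y K dX dY : R -> R) : unit_curve T X Y K dX dY ->
  horizontal (M := su11_sr R) T (fun t => su_emb (K t) (X t) (Y t))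
    (unit_u1 X Y K dX dY) (unit_u2 X Y K dX dY).
Proof.
move=> uc; apply: (unit_horizontal uc); first by move=> t _ _; exact: su_emb_dom.
move=> k; set u1 := unit_u1 _ _ _ _ _; set u2 := unit_u2 _ _ _ _ _.
pose a s := z1_norm (X s) (Y s) * cos (K s); pose b s := z1_norm (X s) (Y s) * sin (K s).
have D t (t0 : 0 <= t) (tT : t <= T) := su_unit_derive uc t0 tT.
rewrite /= -/u1 -/u2 in D.
exists (fun t => su_entry k (u2 t * Y t - u1 t * X t) (- u1 t * Y t - u2 t * X t)
   (- u1 t * a t - u2 t * b t) (u2 t * a t - u1 t * b t)) => t t0 tT.
  have [da db dx dy] := D t t0 tT; have [c1 c2] := unit_u_cnt uc t0 tT.
  have ca := derive_cnt da; have cb := derive_cnt db.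
  have cx := derive_cnt dx; have cy := derive_cnt dy.
  have cn1 := cnt_opp c1.
  apply: su_entry_cnt; apply: cnt_add; try apply: cnt_opp; exact: cnt_mul.
have [da db dx dy] := D t t0 tT; split.
  rewrite /sr_coord /su11_sr (_ : (fun s => _) = (fun s => su_entry k (a s) (b s) (X s) (Y s))).
    exact: su_entry_derive.
  by apply/funext => s; rewrite su_coordE.
by rewrite [RHS]su_frameE.
Qed.

End SU11Chart.

(** * Lifting horizontal curves of SU(1,1) *)

Section SU11Lift.
Variable R : realType.
Local Notation mu := (@lebesgue_measure R).
Local Notation ac := (@absolutely_continuous R).
Implicit Types (t tau : R).

(* The continuous argument of [z1 = a + i b] is recovered as the integral of the rate
   [Im (w conj w') / |z1| ^ 2] along the projected curve. *)
Lemma arg_lift tau (a b x y u1 u2 : R -> R) : 0 < tau ->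
  ac 0 tau a -> ac 0 tau b -> ac 0 tau x -> ac 0 tau y ->
  measurable_fun `[0, tau] u1 -> measurable_fun `[0, tau] u2 ->
  mu.-integrable `[0, tau] (EFin \o speed u1 u2) ->
  (forall t, t \in `[0, tau] -> a t ^+ 2 + b t ^+ 2 = 1 + (x t ^+ 2 + y t ^+ 2)) ->
  {ae mu, forall t, t \in `[0, tau] ->
    [/\ is_derive t 1 a (u2 t * y t - u1 t * x t), is_derive t 1 b (- u1 t * y t - u2 t * x t),
      is_derive t 1 x (- u1 t * a t - u2 t * b t) & is_derive t 1 y (u2 t * a t - u1 t * b t)]} ->
  a 0 = 1 -> b 0 = 0 -> x 0 = 0 -> y 0 = 0 ->
  exists c, [/\ plane_curve tau x y c (cumul tau (speed u1 u2)), c 0 = 0 &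
    forall t, t \in `[0, tau] -> a t = z1_norm (x t) (y t) * cos (c t) /\
      b t = z1_norm (x t) (y t) * sin (c t)].
Proof.
move=> tau0 aca acb acx acy m1 m2 inu D ae a0 b0 x0 y0.
pose px t := - u1 t * a t - u2 t * b t; pose py t := u2 t * a t - u1 t * b t.
pose rate t := (y t * px t - x t * py t) / (1 + (x t ^+ 2 + y t ^+ 2)).
have D0 t : 0 < 1 + (x t ^+ 2 + y t ^+ 2) by rewrite ltr_pwDl // addr_ge0 ?sqr_ge0.
have pn t : t \in `[0, tau] -> px t ^+ 2 + py t ^+ 2 = (1 + (x t ^+ 2 + y t ^+ 2)) * speed u1 u2
    t ^+ 2.
  by move=> tI; rewrite speed2 -D // /px /py; ring.
have acD2 : ac 0 tau (fun t => 1 + (x t ^+ 2 + y t ^+ 2)).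
  have ac2 f : ac 0 tau f -> ac 0 tau (fun t => f t ^+ 2).
    by move=> h; under eq_fun do rewrite expr2; exact: (acM (ltW tau0) h h).
  by apply: acD (ac_const _ _ _) _; apply: acD; exact: ac2.
have acI : ac 0 tau (fun t => (1 + (x t ^+ 2 + y t ^+ 2))^-1).
  by apply: (ac_inv (d := 1)) acD2 _ => // t _ _; rewrite lerDl addr_ge0 ?sqr_ge0.
have ac_meas f : ac 0 tau f -> measurable_fun `[0, tau] f.
  by move=> acf; apply: subspace_continuous_measurable_fun => //; exact: ac_within.
(* The rate is dominated by the speed, because [|w| |w'| <= (1 + |w|^2) * speed]. *)
have irate : mu.-integrable `[0, tau] (EFin \o rate).
  apply: le_integrable inu => //.
    apply/measurable_EFinP; rewrite /rate /px /py.
    apply: measurable_funM; last exact: ac_meas.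
    have [ma mb mx my] := And4 (ac_meas _ aca) (ac_meas _ acb) (ac_meas _ acx) (ac_meas _ acy).
    apply: measurable_funB; apply: measurable_funM => //; apply: measurable_funB;
      apply: measurable_funM => //; exact: measurable_funN.
  move=> t tI; rewrite /= lee_fin (ger0_norm (speed_ge0 _ _ _)).
  rewrite /rate normrM normfV (gtr0_norm (D0 t)) ler_pdivrMr // .
  have S0 := speed_ge0 u1 u2 t.
  have h : (y t ^+ 2 + (x t) ^+ 2) * (px t ^+ 2 + py t ^+ 2) <= (speed u1 u2 t * (1 + (x t ^+ 2
      + y t ^+ 2))) ^+ 2.
    rewrite pn // exprMn mulrC -mulrA mulrCA; apply: ler_wpM2l; first exact: sqr_ge0.
    by rewrite [leRHS]expr2; apply: ler_wpM2l; [exact: ltW (D0 t)|rewrite [leLHS]addrC lerDr].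
  have P0 : 0 <= speed u1 u2 t * (1 + (x t ^+ 2 + y t ^+ 2)) by rewrite mulr_ge0 // ltW.
  rewrite ler_norml; apply/andP; split.
    rewrite lerNl opprB -[leLHS]addrC -[- _]mulNr; apply: cauchy_schwarz2 => //.
    by rewrite sqrrN.
  rewrite -[- (x t * _)]mulNr; apply: cauchy_schwarz2 => //; by rewrite sqrrN.
pose c := cumul tau rate.
have acc : ac 0 tau c by exact: cumul_ac.
have acN : ac 0 tau (fun t => z1_norm (x t) (y t)).
  (* The modulus of [z1] is the Euclidean norm of [(1, |w|)], so absolute continuity is inherited
     twice from [ac_plane_norm]. *)
  rewrite (_ : (fun t => _) = plane_norm (fun=> 1) (plane_norm x y)).
    by apply: ac_plane_norm; [exact: ac_const|exact: ac_plane_norm].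
  by apply/funext => t; rewrite /plane_norm expr1n sqr_sqrtr // addr_ge0 ?sqr_ge0.
have acIN : ac 0 tau (fun t => (z1_norm (x t) (y t))^-1).
  apply: (ac_inv (d := 1)) acN _ => // t _ _.
  by rewrite -[leLHS]sqrtr1 ler_wsqrtr // lerDl addr_ge0 ?sqr_ge0.
have accos : ac 0 tau (fun t => cos (c t)).
  by rewrite (_ : (fun t => _) = fun t => cos (1 * c t)); [exact: ac_cos|apply/funext => t;
      rewrite mul1r].
have acsin : ac 0 tau (fun t => sin (c t)).
  by rewrite (_ : (fun t => _) = fun t => sin (1 * c t)); [exact: ac_sin|apply/funext => t;
      rewrite mul1r].
(* [F + i G = z1 exp (- i c) / |z1|] has zero derivative almost everywhere and keeps its initial
   value 1. *)
pose F t := (a t * cos (c t) + b t * sin (c t)) * (z1_norm (x t) (y t))^-1.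
pose G t := (b t * cos (c t) - a t * sin (c t)) * (z1_norm (x t) (y t))^-1.
have acF : ac 0 tau F by apply: acM (ltW tau0) _ acIN; apply: acD; exact: acM (ltW tau0) _ _.
have acG : ac 0 tau G by apply: acM (ltW tau0) _ acIN; apply: acB; exact: acM (ltW tau0) _ _.
have FG : {ae mu, forall t, t \in `[0, tau] -> is_derive t 1 F 0 /\ is_derive t 1 G 0}.
  apply: ae_imply (ae_and ae (cumul_derive irate)) => t [h1 h2] tI.
  have [da db dx dy] := h1 tI; have {h2}dc : is_derive t 1 c (rate t) := h2 tI.
  have N0 := z1_norm_gt0 (x t) (y t); have N2 := z1_norm2 (x t) (y t).
  have Dt := D t tI; rewrite -N2 in Dt.
  have dN : is_derive t 1 (fun s => z1_norm (x s) (y s)) ((x t * px t + y t * py t) / z1_norm (x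
      t) (y t)).
    rewrite /z1_norm; der; first by rewrite -N2 exprn_gt0.
    by rewrite -/(z1_norm (x t) (y t)) /px /py; field; rewrite gt_eqF.
  pose S := x t * px t + y t * py t; pose Q := y t * px t - x t * py t.
  (* Together with [eB] this is the logarithmic derivative [z1' / z1 = (S + i Q) / |z1|^2]. *)
  have eA : u2 t * y t - u1 t * x t = (a t * S - b t * Q) / z1_norm (x t) (y t) ^+ 2.
    apply: (mulIf (x := z1_norm (x t) (y t) ^+ 2)); first by rewrite gt_eqF // exprn_gt0.
    by rewrite divfK ?gt_eqF ?exprn_gt0 // -Dt /S /Q /px /py; ring.
  have eB : - u1 t * y t - u2 t * x t = (b t * S + a t * Q) / z1_norm (x t) (y t) ^+ 2.
    apply: (mulIf (x := z1_norm (x t) (y t) ^+ 2)); first by rewrite gt_eqF // exprn_gt0.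
    by rewrite divfK ?gt_eqF ?exprn_gt0 // -Dt /S /Q /px /py; ring.
  rewrite eA in da; rewrite eB in db; rewrite /rate -/Q -N2 in dc; rewrite -/S in dN.
  split.
    rewrite /F; der; first by rewrite gt_eqF.
    by field; rewrite gt_eqF.
  rewrite /G; der; first by rewrite gt_eqF.
  by field; rewrite gt_eqF.
have c0 : c 0 = 0 by exact: cumul0.
exists c; split => //.
  split => //; first exact: cumul_ac.
  apply: ae_imply (ae_and ae (ae_and (cumul_derive inu) (cumul_derive irate))) => t [h1 [h2 h3]]
      tI.
  have [da db dx dy] := h1 tI.
  exists (px t), (py t), (speed u1 u2 t); split; [exact: speed_ge0|exact: dx|exact: dy|exact:
      h2|].
  by split; [exact: h3|exact: pn].
move=> t tI; have := tI; rewrite in_itv /= => /andP[t0 tt].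
have Nn0 : z1_norm (x t) (y t) != 0 by rewrite gt_eqF // z1_norm_gt0.
have sub z : z \in `[0, t] -> z \in `[0, tau].
  by rewrite !in_itv /= => /andP[-> zt]; rewrite (le_trans zt tt).
have N00 : z1_norm (x 0) (y 0) = 1 by rewrite x0 y0 /z1_norm expr0n /= !addr0 sqrtr1.
have FE : F t = 1.
  rewrite (ae_derive0 t0 (acS (lexx 0) tt acF)).
    by rewrite /F c0 a0 b0 N00 cos0 sin0; field.
  by apply: ae_imply FG => z h /sub /h[].
have GE : G t = 0.
  rewrite (ae_derive0 t0 (acS (lexx 0) tt acG)).
    by rewrite /G c0 a0 b0 N00 cos0 sin0; field.
  by apply: ae_imply FG => z h /sub /h[].
have {FE}h1 : a t * cos (c t) + b t * sin (c t) = z1_norm (x t) (y t).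
  by rewrite -[RHS]mul1r -FE /F mulfVK.
have {GE}h2 : b t * cos (c t) - a t * sin (c t) = 0.
  by rewrite -[LHS](mulfVK Nn0) -/(G t) GE mul0r.
have cs := cos2Dsin2 (c t); rewrite -h1; split.
  rewrite -[LHS]mulr1 -cs [LHS](_ : _ = (a t * cos (c t) + b t * sin (c t)) * cos (c t) - sin (c
      t) * (b t * cos (c t) - a t * sin (c t))).
    by rewrite h2 mulr0 subr0.
  ring.
rewrite -[LHS]mulr1 -cs [LHS](_ : _ = (a t * cos (c t) + b t * sin (c t)) * sin (c t) + cos (c
    t) * (b t * cos (c t) - a t * sin (c t))).
  by rewrite h2 mulr0 addr0.
ring.
Qed.

Lemma su_chart : geodesic_chart (@su_emb R).
Proof.
split => //.
- exact: su_emb_dom.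
- move=> tau gamma u1 u2 tau0 [dom acg m1 m2 aeg] g0 inu.
  pose a t := su_coord (0, 0, false) (gamma t); pose b t := su_coord (0, 0, true) (gamma t).
  pose x t := su_coord (0, 1, false) (gamma t); pose y t := su_coord (0, 1, true) (gamma t).
  have gE t : t \in `[0, tau] -> gamma t = su_mx (a t +i* b t) (x t +i* y t) /\
      a t ^+ 2 + b t ^+ 2 = 1 + (x t ^+ 2 + y t ^+ 2).
    move=> /dom /SU11P [a' [b' [x' [y' [gE e]]]]].
    rewrite /a /b /x /y gE !su_coordE /su_entry /= !mul1r; split => //.
  have ae0 : {ae mu, forall t, t \in `[0, tau] ->
    [/\ is_derive t 1 a (u2 t * y t - u1 t * x t), is_derive t 1 b (- u1 t * y t - u2 t * x t),
      is_derive t 1 x (- u1 t * a t - u2 t * b t) & is_derive t 1 y (u2 t * a t - u1 t * b t)]}.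
    apply: ae_imply aeg => t + tI => /(_ tI) ag; have [gt _] := gE t tI.
    have d (k : 'I_2 * 'I_2 * bool) := ag k.
    rewrite /sr_X /sr_Y /= gt in d.
    have d1 := d (0, 0, false); have d2 := d (0, 0, true).
    have d3 := d (0, 1, false); have d4 := d (0, 1, true).
    rewrite su_frameE /su_entry /= !mul1r in d1.
    rewrite su_frameE /su_entry /= !mul1r in d2.
    rewrite su_frameE /su_entry /= !mul1r in d3.
    rewrite su_frameE /su_entry /= !mul1r in d4.
    by split.
  have z0 : z1_norm 0 0 = 1 :> R by rewrite /z1_norm expr0n /= !addr0 sqrtr1.
  have a0 : a 0 = 1 by rewrite /a g0 su_coordE /su_entry /= z0 cos0 !mul1r.
  have b0 : b 0 = 0 by rewrite /b g0 su_coordE /su_entry /= z0 sin0 !mul1r.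
  have x0 : x 0 = 0 by rewrite /x g0 su_coordE /su_entry /= mul1r.
  have y0 : y 0 = 0 by rewrite /y g0 su_coordE /su_entry /= mul1r.
  have [c [pc c0 cE]] := arg_lift tau0 (acg (0, 0, false)) (acg (0, 0, true))
    (acg (0, 1, false)) (acg (0, 1, true)) m1 m2 inu (fun t tI => (gE t tI).2) ae0 a0 b0 x0 y0.
  exists x, y, c; split => // t tI; have [gt _] := gE t tI; have [e1 e2] := cE t tI.
  by rewrite gt /su_emb -e1 -e2.
move=> T X Y K dX dY uc; exists (unit_u1 X Y K dX dY), (unit_u2 X Y K dX dY).
by split; [exact: su_unit|exact: unit_length uc].
Qed.

End SU11Lift.

(** * Cut loci *)

Section CutLoci.
Variable R : realType.
Local Notation C := R[i].
Implicit Types (a b x y c t : R).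

(** Reparametrization keeps the image; geodesics are shown to be different by comparing images. *)
Lemma same_range (M : sub_riemannian R) (tau1 : R) (gamma1 : R -> M) tau2 gamma2 :
  same_up_to_reparam tau1 gamma1 tau2 gamma2 ->
  forall t, t \in `[0, tau1] -> exists2 t', t' \in `[0, tau2] & gamma1 t = gamma2 t'.
Proof.
move=> [ell [sg [s1 [s2 [[_ r1] [_ r2] g1 g2]]]]] t tI.
have : (s1 @` `[0, tau1]%classic) (s1 t) by exists t.
by rewrite r1 -r2 => -[t' tI' e]; exists t' => //; rewrite g1 // g2 //= e.
Qed.

Section Generic.
Variables (M : sub_riemannian R) (emb : R -> R -> R -> M) (px py : M -> R).
Hypothesis chart : geodesic_chart emb.
Hypothesis pxE : forall c x y, px (emb c x y) = x.
Hypothesis pyE : forall c x y, py (emb c x y) = y.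
Local Notation p := (emb 0 0 0).

(** The two geodesics are a model geodesic and its copy rotated by [pi]. If they had the same image,
    the radius attained only once would make the point at time [t0] its own opposite, hence a point
    of the axis. *)
Lemma axis_cut (q : M) c1 : closest emb q 0 0 c1 -> c1 != 0 -> cut_locus p q.
Proof.
move=> cl c0; have [qE _] := cl.
have [T [X [Y [K [dX [dY m]]]]]] : exists T X Y K dX dY, model_geodesic 0 0 c1 T X Y K dX dY.
  by apply: model_geodesic_exists; rewrite c0 orbT.
have infE := ereal_inf_curve_lengths chart cl m; have uc := model_unit_curve m.
have [XT YT KT] := mg_end m.
exists T, (fun t => emb (K t) (X t) (Y t)), T, (fun t => emb (K t) (- X t) (- Y t)); split.
- by apply: (unit_curve_minimizing chart uc) => //; rewrite XT YT KT.
- by apply: (unit_curve_minimizing chart (unit_curve_opp uc)) => //; rewrite XT YT KT oppr0.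
have [|t0 [t00 t0T r0 at0]] := mg_axis m; first by rewrite expr0n addr0.
move=> /same_range /(_ t0); rewrite in_itv /= !ltW // => /(_ isT) [t + e].
rewrite in_itv /= => /andP[t1 t2].
have ex := congr1 px e; rewrite !pxE in ex; have ey := congr1 py e; rewrite !pyE in ey.
have tt : t = t0 by apply: at0 => //; rewrite ex ey !sqrrN.
move: ex ey r0; rewrite tt => /eqP; rewrite -addr_eq0 -mulr2n mulrn_eq0 /= => /eqP ->.
by move=> /eqP; rewrite -addr_eq0 -mulr2n mulrn_eq0 /= => /eqP ->; rewrite expr0n addr0 eqxx.
Qed.

Lemma off_axis_not_cut (q : M) x y c1 : closest emb q x y c1 -> x ^+ 2 + y ^+ 2 != 0 ->
  (forall c, emb c x y = q -> `|c| = `|c1| -> c = c1) -> ~ cut_locus p q.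
Proof.
move=> cl r0 cu [tau1 [g1 [tau2 [g2 [m1 m2 ns]]]]].
have [T [X [Y [K [dX [dY m]]]]]] : exists T X Y K dX dY, model_geodesic x y c1 T X Y K dX dY.
  by apply: model_geodesic_exists; rewrite r0.
exact/ns/(follows_same (minimizing_follows chart cl m r0 cu m1) (minimizing_follows chart cl m
    r0 cu m2)).
Qed.

Lemma origin_not_cut : ~ cut_locus p p.
Proof.
move=> [tau1 [g1 [tau2 [g2 [m1 m2 ns]]]]].
exact/ns/(follows_same (minimizing_const chart m1) (minimizing_const chart m2)).
Qed.

End Generic.

(** On the cover the argument is a coordinate of the end point, so [closest] and its uniqueness are
    immediate and only the axis contributes. *)
Lemma cover_cut_locus : cut_locus (M := cover_sr R) cover_one =
  [set p : R * C | exists c : R, c <> 0 /\ p = (c, 0)].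
Proof.
have cl (c x y : R) : closest (@cover_emb R) (c, x +i* y) x y c.
  by split => // c' x' y' [-> -> ->].
have cu (c x y c' : R) : cover_emb c' x y = (c, x +i* y) -> `|c'| = `|c| -> c' = c by case.
have chart := cover_chart R; have -> : cover_one = cover_emb 0 0 0 :> cover_sr R by [].
apply/seteqP; split => [[c [x y]]|_ [c [/eqP c0 ->]]].
  have [r0|/negPn/eqP r0] := boolP (x ^+ 2 + y ^+ 2 != 0).
    by move=> /(off_axis_not_cut chart (cl c x y) r0 (cu c x y)).
  have /eqP := r0; rewrite paddr_eq0 ?sqr_ge0 // !sqrf_eq0 => /andP[/eqP-> /eqP->] h.
  exists c; split => // c0; move: h; rewrite c0; exact: origin_not_cut chart.
refine (axis_cut (px := fun g : cover_sr R => complex.Re g.2) (py := fun g : cover_sr R =>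
    complex.Im g.2) chart _ _ (c1 := c) _ _) => //.
exact: (cl c 0 0).
Qed.

Lemma su_emb_inj c c' x y x' y' : su_emb c x y = su_emb c' x' y' :> 'M[C]_2 ->
  [/\ x = x', y = y', cos c = cos c' & sin c = sin c'].
Proof.
move=> e; have E k := congr1 (su_coord k) e.
have := E (0, 1, false); have := E (0, 1, true).
have := E (0, 0, false); have := E (0, 0, true).
rewrite !su_coordE /su_entry /= !mul1r => + + ey ex; rewrite ex ey.
have N0 : z1_norm x' y' != 0 by rewrite gt_eqF // z1_norm_gt0.
by move=> /(mulfI N0) -> /(mulfI N0) ->.
Qed.

(** The cosine is strictly decreasing on [[0, pi]], which excludes a smaller [|c|] with the same
    cosine. *)
Lemma principal_min c c1 : `|c1| <= pi -> cos c = cos c1 -> `|c1| <= `|c|.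
Proof.
move=> cp ce; rewrite leNgt; apply/negP => h.
have I1 : `|c1| \in `[0, pi] by rewrite in_itv /= normr_ge0.
have I2 : `|c| \in `[0, pi] by rewrite in_itv /= normr_ge0 ltW // (lt_le_trans h).
by move: h; rewrite -ltr_cos // !cos_norm ce ltxx.
Qed.

Lemma su_closest c1 x y : `|c1| <= pi -> closest (@su_emb R) (su_emb c1 x y) x y c1.
Proof.
by move=> cp; split => // c x' y' /su_emb_inj[-> -> ce _]; split => //; exact: principal_min.
Qed.

Lemma su_embP a b x y : a ^+ 2 + b ^+ 2 = 1 + (x ^+ 2 + y ^+ 2) -> exists c, `|c| <= pi /\
  a +i* b = (z1_norm x y * cos c) +i* (z1_norm x y * sin c).
Proof.
rewrite -z1_norm2 => h; have N0 := z1_norm_gt0 x y; set N := z1_norm x y in h N0 *.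
have u1 : (a / N) ^+ 2 + (b / N) ^+ 2 = 1.
  by rewrite !expr_div_n -mulrDl h divff // expf_neq0 // gt_eqF.
have uI : -1 <= a / N <= 1.
  rewrite -ler_norml; apply: sqr_le => //.
  by rewrite expr1n real_normK ?num_real // -u1 lerDl sqr_ge0.
have cE : cos (acos (a / N)) = a / N by have [] := acos_def uI.
have sE : sin (acos (a / N)) = `|b| / N.
  by rewrite sin_acos // -u1 addrC addKr sqrtr_sqr normrM normfV (gtr0_norm N0).
have aI : `|acos (a / N)| <= pi by have [/andP[a0 ap] _] := acos_def uI; rewrite ger0_norm.
have nz : N != 0 by rewrite gt_eqF.
have [b0|b0] := leP 0 b.
  exists (acos (a / N)); split => //; rewrite cE sE ger0_norm //.
  by congr (_ +i* _); rewrite mulrC divfK.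
exists (- acos (a / N)); rewrite normrN cosN sinN cE sE (ltr0_norm b0); split => //.
by congr (_ +i* _); rewrite ?mulNr ?opprK mulrC divfK.
Qed.

(** Both [pi] and [- pi] are nearest arguments over the point. The first geodesic passes the
    argument [pi / 2], with sine 1, while on the second the argument stays in [[- pi, 0]], where the
    sine is not positive; so the images differ. *)
Lemma su_negative_cut x y : x ^+ 2 + y ^+ 2 != 0 ->
  cut_locus (M := su11_sr R) (su_emb 0 0 0) (su_emb pi x y).
Proof.
move=> r0; have chart := su_chart R.
have p0 := pi_gt0 R.
have npi : `|pi : R| = pi by rewrite gtr0_norm.
have qE : su_emb (- pi) x y = su_emb pi x y by rewrite /su_emb cosN sinN sinpi oppr0.
have cl : closest (@su_emb R) (su_emb pi x y) x y pi by apply: su_closest; rewrite npi.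
have cl' : closest (@su_emb R) (su_emb pi x y) x y (- pi).
  by rewrite -qE; apply: su_closest; rewrite normrN npi.
have [T [X [Y [K [dX [dY m]]]]]] : exists T X Y K dX dY, model_geodesic x y pi T X Y K dX dY.
  by apply: model_geodesic_exists; rewrite r0.
have [T' [X' [Y' [K' [dX' [dY' m']]]]]] :
    exists T X Y K dX dY, model_geodesic x y (- pi) T X Y K dX dY.
  by apply: model_geodesic_exists; rewrite r0.
have infE := ereal_inf_curve_lengths chart cl m; have infE' := ereal_inf_curve_lengths chart cl'
    m'.
have [XT YT KT] := mg_end m; have [XT' YT' KT'] := mg_end m'.
exists T, (fun t => su_emb (K t) (X t) (Y t)), T', (fun t => su_emb (K' t) (X' t) (Y' t)); split.
- by apply: (unit_curve_minimizing chart (model_unit_curve m)) => //; rewrite XT YT KT.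
- by apply: (unit_curve_minimizing chart (model_unit_curve m')) => //; rewrite XT' YT' KT'.
have T0 := mg_gt0 m; have [X0 Y0 K0] := mg_start m.
have cK : {within `[0, T], continuous K}.
  by apply: cnt_within => t t0 tT; have [_ _ d _] := mg_der m t0 tT; exact: derive_cnt d.
have [|t tI Kt] := IVT (ltW T0) cK (v := pi / 2).
  by rewrite K0 KT (min_l (ltW p0)) (max_r (ltW p0)) divr_ge0 ?ltW //= ltr_pdivrMr // ltr_pMr //
      ltr1n.
move=> /same_range /(_ t tI) [t' + /su_emb_inj[_ _ _]].
rewrite in_itv /= => /andP[t0 tT]; rewrite Kt sin_pihalf => s1.
have [_ h] := mg_range m' t0 tT; have {h} := h; rewrite oppr_le0 (ltW p0) => /(_ isT) /andP[h1
    h2].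
have : 0 <= sin (- K' t') by apply: sin_ge0_pi; rewrite oppr_ge0 h2 lerNl.
by rewrite sinN -s1 oppr_ge0 leNgt ltr01.
Qed.

Lemma su_emb_one : su_emb 0 0 0 = 1%:M :> 'M[C]_2.
Proof.
have z0 : z1_norm 0 0 = 1 :> R by rewrite /z1_norm expr0n /= !addr0 sqrtr1.
apply/matrixP => i j; rewrite /su_emb z0 cos0 sin0 mulr1 mulr0 !mxE.
by case: (I2P i) => ->; case: (I2P j) => -> //=; apply: complex_ext; rewrite /= ?oppr0.
Qed.

Lemma su_cut_locus : cut_locus (M := su11_sr R) (1%:M : 'M[C]_2) =
  [set A : 'M[C]_2 | exists z1 z2 : C,
     [/\ `|z1| ^+ 2 - `|z2| ^+ 2 = 1, A = su_mx z1 z2 & z1 < 0 \/ (z2 = 0 /\ A <> 1%:M)]].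
Proof.
have chart := su_chart R; rewrite -su_emb_one.
have E (z : C) : `|z| ^+ 2 = (complex.Re z ^+ 2 + complex.Im z ^+ 2)%:C.
  by rewrite normc_def -rmorphXn /= sqr_sqrtr // addr_ge0 ?sqr_ge0.
have axis (A : 'M[C]_2) a b : A = su_mx (a +i* b) 0 -> a ^+ 2 + b ^+ 2 = 1 ->
    A <> su_emb 0 0 0 -> cut_locus (M := su11_sr R) (su_emb 0 0 0) A.
  move=> AE ab A1; have [|c [cp ce]] := @su_embP a b 0 0.
    by rewrite expr0n /= !addr0.
  have {}AE : A = su_emb c 0 0 by rewrite AE ce.
  rewrite AE; refine (axis_cut (px := su_coord (0, 1, false) : su11_sr R -> R) (py := su_coord
      (0, 1, true) : su11_sr R -> R) chart _ _ (c1 := c) _ _).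
  - by move=> *; rewrite su_coordE /su_entry /= mul1r.
  - by move=> *; rewrite su_coordE /su_entry /= mul1r.
  - exact: su_closest.
  by apply/eqP => c0; apply: A1; rewrite AE c0.
apply/seteqP; split => A.
  move=> /[dup] cutA [tau [g [_ [_ [[tau0 _ gA [u1 [u2 [[dom _ _ _ _] _]]]] _ _]]]]].
  have /SU11P [a [b [x [y [AE ab]]]]] : SU11 A.
    by rewrite -gA; apply: dom; rewrite in_itv /= ltW /=.
  exists (a +i* b), (x +i* y); split => //.
    by rewrite !E /= ab -rmorphB /= addrK.
  apply: contrapT => /not_orP[z1n z2n].
  have [c [cp ce]] := su_embP ab.
  have {}AE : A = su_emb c x y by rewrite AE ce.
  have [r0|/negPn/eqP r0] := boolP (x ^+ 2 + y ^+ 2 != 0); last first.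
    have /eqP := r0; rewrite paddr_eq0 ?sqr_ge0 // !sqrf_eq0 => /andP[/eqP x0 /eqP y0].
    have A1 : A = su_emb 0 0 0.
      by apply: contrapT => A1; apply: z2n; rewrite x0 y0.
    by move: cutA; rewrite A1; exact: origin_not_cut chart.
  move: cutA; rewrite AE; apply: (off_axis_not_cut chart (su_closest x y cp) r0) => c'.
  (* The only other candidate is [- c]. It lies over the same point only if [sin c = 0], that is
     [c = 0] or [|c| = pi], and the latter means [z1 < 0]. *)
  move=> /su_emb_inj[_ _ cc ss] /eqP; rewrite eqr_norm2 => /orP[/eqP //|/eqP c'E].
  have s0 : sin c = 0.
    by apply/eqP; move: ss; rewrite c'E sinN => /eqP; rewrite eq_sym -addr_eq0 -mulr2n mulrn_eq0.
  rewrite c'E; have [->|c0] := eqVneq c 0; first by rewrite oppr0.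
  exfalso; have c0' : 0 < `|c| by rewrite normr_gt0.
  have cpi : `|c| = pi.
    apply/eqP; rewrite eq_le cp leNgt; apply/negP => clt.
    have := @sin_gt0_pi R `|c|; rewrite c0' clt => /(_ isT).
    by case: (ler0P c) => _; rewrite ?sinN s0 ?oppr0 ltxx.
  apply: z1n; rewrite ce -cos_norm cpi cospi s0 mulr0 mulrN1.
  by rewrite ltcE /= eqxx oppr_lt0 z1_norm_gt0.
move=> [[a b] [[x y] [+ AE h]]]; rewrite !E -rmorphB => /(congr1 (@complex.Re R)) /= ab.
have {}ab : a ^+ 2 + b ^+ 2 = 1 + (x ^+ 2 + y ^+ 2) by rewrite -ab subrK.
have [r0|/negPn/eqP r0] := boolP (x ^+ 2 + y ^+ 2 != 0); last first.
  have /eqP := r0; rewrite paddr_eq0 ?sqr_ge0 // !sqrf_eq0 => /andP[/eqP x0 /eqP y0].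
  apply: (axis _ a b); rewrite ?AE ?x0 ?y0 //; first by rewrite ab r0 addr0.
  (* On the axis the two alternatives overlap: a negative [z1] already rules out the identity. *)
  case: h => [|[_ A1]]; last by move: A1; rewrite AE x0 y0.
  rewrite ltcE /= => /andP[_ a0] /(congr1 (su_coord (0, 0, false))).
  rewrite !su_coordE /su_entry /= !mul1r cos0 mulr1 => aN.
  by move: a0; rewrite aN ltNge ltW // z1_norm_gt0.
case: h => [|[z0 _]]; last by case: z0 r0 => -> ->; rewrite expr0n addr0 eqxx.
rewrite ltcE /= => /andP[/eqP b0 a0].
have N0 := z1_norm_gt0 x y.
have aN : a = - z1_norm x y.
  move: ab; rewrite -b0 expr0n /= addr0 -z1_norm2 => /eqP;
      rewrite eqf_sqr => /orP[/eqP aE|/eqP //].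
  by move: a0; rewrite aE ltNge ltW.
have -> : A = su_emb pi x y by rewrite AE /su_emb cospi sinpi mulr0 mulrN1 -aN b0.
exact: su_negative_cut.
Qed.

End CutLoci.

Theorem corollary3 (R : realType) :
  cut_locus (M := cover_sr R) cover_one =
    [set p : R * R[i] | exists c : R, c <> 0 /\ p = (c, 0)]
  /\
  cut_locus (M := su11_sr R) (1%:M : 'M[R[i]]_2) =
    [set A : 'M[R[i]]_2 | exists z1 z2 : R[i],
       [/\ `|z1| ^+ 2 - `|z2| ^+ 2 = 1, A = su_mx z1 z2
         & z1 < 0 \/ (z2 = 0 /\ A <> 1%:M)]].
Proof. by split; [exact: cover_cut_locus|exact: su_cut_locus]. Qed.
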